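(* There exists an absolute constant $C>0$ such that the following statement holds. Let $n,\Delta,b\in\mathbb{N}$ satisfy $\Delta\ge\log n$. Then the $(1:b)$ Maker-Breaker $\mathcal{T}(n,\Delta)$-universality game is Maker's win on every $(n,d)$-expander with \[ d\ge \min\{\Delta n^{1/2},\ \Delta^{5\sqrt{\log n}}\}\, C b\log n. \]
   Context: All graphs are finite and simple. $\log$ denotes the natural logarithm. Expanders: for a graph $G$ and $X\subseteq V(G)$, $N_G(X)=\bigl(\bigcup_{v\in X}N_G(v)\bigr)\setminus X$, and $e_G(X,Y)$ is the number of edges between disjoint sets $X,Y$. Given $n\in\mathbb{N}$ and $d>0$, an $n$-vertex graph $G$ is an $(n,d)$-expander if (i) $|N_G(X)|\ge d|X|$ for all $X\subseteq V(G)$ with $1\le |X|<\frac{n}{2d}$; and (ii) $e_G(X,Y)>0$ for all disjoint $X,Y\subseteq V(G)$ with $|X|=|Y|\ge\frac{n}{2d}$. Universality: $\mathcal{T}(n,\Delta)$ is the family of all $n$-vertex trees with maximum degree at most $\Delta$. A graph is $\mathcal{T}(n,\Delta)$-universal if it contains every $T\in\mathcal{T}(n,\Delta)$ as a (not necessarily induced) subgraph. Games: an $(a:b)$ Maker-Breaker game is played on a finite hypergraph $H=(V,\mathcal{F})$ by two players, Maker and Breaker, who alternate turns, Maker starting. In each of their turns Maker claims $a$ and Breaker claims $b$ previously unclaimed vertices of $H$, respectively, and the game ends when all vertices have been claimed. Maker wins if by the end he has claimed all vertices of some hyperedge; otherwise (that is, if Breaker has claimed at least one vertex in each hyperedge)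 Breaker wins. The game is Maker's win if Maker has a strategy that wins regardless of Breaker's strategy. The Maker-Breaker $\mathcal{T}(n,\Delta)$-universality game on an $n$-vertex graph $G$ is the game on the hypergraph with vertex set $E(G)$ whose hyperedges are all $F\subseteq E(G)$ such that the graph $(V(G),F)$ is $\mathcal{T}(n,\Delta)$-universal.
   Formalization: The formal statement adds the assumption d ≤ n: as literally stated the claim fails, since K_n is an (n,d)-expander for every d ≥ n/2 (e.g. K_3 with Δ=2, b=2 and d huge, where Maker gets only one edge). *)

(* Defs.v *)
From mathcomp Require Import all_boot all_order all_algebra.
From mathcomp Require Import boolp reals exp.

Set Implicit Arguments.
Unset Strict Implicit.
Unset Printing Implicit Defensive.

Import Order.TTheory GRing.Theory Num.Theory.
Local Open Scope ring_scope.

Record sgraph := SGraph {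
  svertex :> finType;
  adj : rel svertex;
  adj_sym : symmetric adj;
  adj_irrefl : irreflexive adj }.

Definition neighbors (G : sgraph) (x : G) : {set G} := [set y | adj x y].

Definition edges (G : sgraph) : {set {set G}} :=
  [set [set x; y] | x in [set: G], y in neighbors x].

Definition max_degree (G : sgraph) : nat := \max_(x : G) #|neighbors x|.

Definition ext_neighbors (G : sgraph) (X : {set G}) : {set G} :=
  (\bigcup_(x in X) neighbors x) :\: X.

Definition num_edges_between (G : sgraph) (X Y : {set G}) : nat :=
  #|[set [set x; y] | x in X, y in Y & adj x y]|.

(* For d >= n / 2 the first condition is vacuous and the second one only says
   that the graph is complete: K_n is an (n, d)-expander for every such d,
   however large.  Nothing here bounds d from above. *)
Definition expander (R : realType) (n : nat) (d : R) (G : sgraph) : Prop :=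
  [/\ #|G| = n,
      forall X : {set G}, (1 <= #|X|)%N -> #|X|%:R < n%:R / (2 * d) ->
        d * #|X|%:R <= #|ext_neighbors X|%:R
    & forall X Y : {set G}, [disjoint X & Y] -> #|X| = #|Y| ->
        n%:R / (2 * d) <= #|X|%:R -> (0 < num_edges_between X Y)%N].

Definition connected (G : sgraph) : Prop :=
  (0 < #|G|)%N /\ forall x y : G, connect (@adj G) x y.

(* [ucycle] accepts the sequence [:: x; y] for every edge xy, hence the bound
   on the size. *)
Definition acyclic (G : sgraph) : Prop :=
  forall c : seq G, (2 < size c)%N -> ~ ucycle (@adj G) c.

Definition is_tree (G : sgraph) : Prop := connected G /\ acyclic G.

Definition contains_copy (G T : sgraph) : Prop :=
  exists2 f : T -> G, injective f & forall x y : T, adj x y -> adj (f x) (f y).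

Definition tree_universal (n Delta : nat) (G : sgraph) : Prop :=
  forall T : sgraph, #|T| = n -> is_tree T -> (max_degree T <= Delta)%N ->
    contains_copy G T.

Section SpanningSubgraph.
Variables (V : finType) (F : {set {set V}}).

Definition edge_rel : rel V := fun x y => (x != y) && ([set x; y] \in F).

Lemma edge_rel_sym : symmetric edge_rel.
Proof. by move=> x y; rewrite /edge_rel eq_sym setUC. Qed.

Lemma edge_rel_irrefl : irreflexive edge_rel.
Proof. by move=> x; rewrite /edge_rel eqxx. Qed.

Definition graph_of_edges : sgraph := SGraph edge_rel_sym edge_rel_irrefl.

End SpanningSubgraph.

(* The (a : b) Maker-Breaker game on the hypergraph with vertex set [V] and
   family of hyperedges [F].  A history is the list of the sets claimed in the
   turns played so far, oldest first; Maker plays the turns of even index.  A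
   player who has fewer unclaimed vertices left than he should claim takes all
   of them. *)
Section MakerBreaker.
Variables (X : finType) (a b : nat) (V : {set X}) (F : {set {set X}}).

Definition history := seq {set X}.
Definition strategy := history -> {set X}.

Definition unclaimed (h : history) : {set X} := V :\: \bigcup_(A <- h) A.

Definition maker_claimed (h : history) : {set X} :=
  \bigcup_(i < size h | ~~ odd i) nth set0 h i.

Definition legal_strategy (q : nat) (s : strategy) : Prop :=
  forall h : history,
    s h \subset unclaimed h /\ #|s h| = minn q #|unclaimed h|.

Fixpoint play (sM sB : strategy) (k : nat) : history :=
  if k is k'.+1 then
    let h := play sM sB k' in rcons h (if odd k' then sB h else sM h)
  else [::].

(* Moves made once every vertex is claimed are empty, so the choice of [k] is
   immaterial. *)
Definition maker_wins_play (sM sB : strategy) : Prop :=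
  exists k : nat, unclaimed (play sM sB k) = set0 /\
    exists2 A, A \in F & A \subset maker_claimed (play sM sB k).

Definition maker_win : Prop :=
  exists2 sM : strategy, legal_strategy a sM &
    forall sB : strategy, legal_strategy b sB -> maker_wins_play sM sB.

End MakerBreaker.

Definition universal_edge_sets (n Delta : nat) (G : sgraph) :
    {set {set {set G}}} :=
  [set F : {set {set G}} |
    (F \subset edges G) && `[< tree_universal n Delta (graph_of_edges F) >]].

Definition universality_game_maker_win (a b n Delta : nat) (G : sgraph) : Prop :=
  maker_win a b (edges G) (universal_edge_sets n Delta G).

(* Main.v *)
Require Import Defs.
From mathcomp Require Import all_boot all_order all_algebra perm.
From mathcomp Require Import boolp reals sequences exp.
From mathcomp Require Import zify ring lra.

(* Maker first turns the board into a good expander: by a potential argument he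
   hits every set of a family with sum of (1 + 1/(2b))^-|A| less than 1, and for
   the sets "edges between X and Y" ([#|X| = #|Y| = m]) and "edges leaving X outside
   Y" ([#|X| <= m], [#|Y| < D #|X|]) this follows from the expansion of [G] and a
   union bound, with D of order d / (b log n) and m of order n / D.

   Such a graph contains all trees of bounded degree.  Forests are grown by
   Friedman-Pippenger extensions, and balls of two trees of depth [h] are joined
   to connect two given vertices by a path with [2h] inner vertices.  A tree
   with few leaves has many disjoint bare paths: embed the rest and link the ends
   of these paths through all the remaining vertices, using layers matched by
   Hall's theorem and a sorting network (a Benes network made of cycles that can
   be traversed straight or crossed, covering the same vertices both ways).  A
   tree with many leaves is embedded without its leaves, in such a way that the
   parents of leaves satisfy Hall's condition towards the remaining vertices; the
   vertices violating it are few and are served by rerouting paths of length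
   [2h] in the tree, one for each of them.

   The two terms of the minimum come from [h = 1] and from [h] of order
   (log n)^(1/2): the growth needs c^h >= m for a branching c of order
   D / (h^2 log n), while the reroutable paths need n / m >= Delta^(2h). *)

Set Implicit Arguments.
Unset Strict Implicit.
Unset Printing Implicit Defensive.

(** * Hall's theorem and a selection lemma *)

(** Both endgames therefore finish with Hall's theorem, prepared in advance. Large sets satisfy its
    condition because any two sets of [m] vertices are joined by an edge. Small sets may violate it,
    but all violations are concentrated on a maximal bad set of fewer than [m] vertices, each of
    which can be given a neighbour of its own while there is still space. Hall's theorem does not
    control who is matched to whom; for paths with prescribed ends this forces a permuting network.
    It has to be built while there is space, before the permutation is known, so its vertex set must
    not depend on it. The bare paths have one common length, so every gadget has a size fixed
    beforehand, and their number is a power of two because of the recursive network. The order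
    [d / (b log n)] of [D] is what the game costs: a union bound over sets of [x] vertices needs
    [x log n] bits, and against [b] answers per turn a set must have about [2 * b] edges for each
    bit. *)

Lemma subset_of_card (T : finType) (X : {set T}) k : k <= #|X| ->
  exists2 S : {set T}, S \subset X & #|S| = k.
Proof.
move=> kX; exists [set x in take k (enum X)].
  by apply/subsetP => x; rewrite inE => /mem_take; rewrite mem_enum.
by rewrite cardsE (card_uniqP _) ?take_uniq ?enum_uniq // size_takel // -cardE.
Qed.

Section Selection.
Variables (I V : finType) (N : I -> {set V}).
Implicit Types (U : {set I}) (g : I -> nat).

Definition nbhd (U : {set I}) : {set V} := \bigcup_(x in U) N x.

Lemma nbhdP U y : reflect (exists2 x, x \in U & y \in N x) (y \in nbhd U).
Proof. exact: bigcupP. Qed.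

Lemma nbhdU U U' : nbhd (U :|: U') = nbhd U :|: nbhd U'.
Proof. exact: bigcup_setU. Qed.

Lemma nbhdS U U' : U \subset U' -> nbhd U \subset nbhd U'.
Proof.
move=> sU; apply/subsetP => y /nbhdP[x xU yx]; apply/nbhdP.
by exists x => //; apply: (subsetP sU).
Qed.

Lemma nbhdI_sub U U' : nbhd (U :&: U') \subset nbhd U :&: nbhd U'.
Proof. by rewrite subsetI !nbhdS ?subsetIl ?subsetIr. Qed.

Lemma nbhd1 x : nbhd [set x] = N x.
Proof. exact: big_set1. Qed.

Lemma nbhd_set0 : nbhd set0 = set0.
Proof. exact: big_set0. Qed.

End Selection.

Section SelectionLemma.
Variables (I V : finType) (N : I -> {set V}).
Implicit Types (U : {set I}) (g : I -> nat).

Lemma sum_setUI g U U' :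
  \sum_(x in U :|: U') g x + \sum_(x in U :&: U') g x =
  \sum_(x in U) g x + \sum_(x in U') g x.
Proof.
rewrite (big_setID U) /= setUK setDUl setDv set0U.
by rewrite [in RHS](big_setID U (fun x => g x) (A := U')) /= setIC [U' :&: U]setIC; lia.
Qed.

Definition expands (K : nat) (N : I -> {set V}) g :=
  forall U, #|U| <= K -> \sum_(x in U) g x <= #|nbhd N U|.

(* Tight sets are closed under union, so if every candidate [y] were blocked
   by a tight set, a single tight set would contain all the candidates in its
   neighbourhood and adding [s] to it would violate the hypothesis. *)
Lemma select_neighbour K g s (Av : {set V}) :
  1 < K -> expands K N g ->
  (forall U, #|U| <= K -> \sum_(x in U) g x = #|nbhd N U| -> #|U|.*2 <= K) ->
  #|Av| < g s ->
  exists y, [/\ y \in N s, y \notin Av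
    & expands K (fun x => N x :\ y) (fun x => g x - (x == s))].
Proof.
move=> K1 Nexp small Avs.
pose tight U := [&& #|U| <= K, s \notin U & \sum_(x in U) g x == #|nbhd N U|].
have tight_small U : tight U -> #|U|.*2 <= K.
  by case/and3P => UK _ /eqP; apply: small.
have tightU U U' : tight U -> tight U' -> tight (U :|: U').
  move=> tU tU'.
  have := tight_small _ tU; have := tight_small _ tU'.
  move: tU tU' => /and3P[UK sU /eqP eU] /and3P[U'K sU' /eqP eU'] l1 l2.
  have cU : #|U :|: U'| <= K.
    by have := (leq_card_setU U U').1; lia.
  apply/and3P; split=> //; first by rewrite inE negb_or sU.
  have i1 := Nexp _ cU.
  have cI : #|U :&: U'| <= K by apply: leq_trans UK; rewrite subset_leq_card ?subsetIl.
  have i2 := Nexp _ cI.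
  have e1 := sum_setUI g U U'.
  have e2 := cardsUI (nbhd N U) (nbhd N U').
  have i3 := subset_leq_card (nbhdI_sub N U U').
  rewrite nbhdU in i1 *.
  by apply/eqP; lia.
have tight0 : tight set0.
  by rewrite /tight cards0 big_set0 nbhd_set0 cards0 inE eqxx.
have [/existsP[y /and3P[ys yAv free]]|] := boolP [exists y, [&& y \in N s, y \notin Av &
    [forall U, tight U ==> (y \notin nbhd N U)]]].
  exists y; split=> // U UK.
  have -> : nbhd (fun x => N x :\ y) U = nbhd N U :\ y.
    apply/setP => z; rewrite in_setD1; apply/nbhdP/andP => [[x xU]|[zy /nbhdP[x xU xz]]].
      by rewrite in_setD1 => /andP[zy zx]; split=> //; apply/nbhdP; exists x.
    by exists x => //; rewrite in_setD1 zy.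
  have := Nexp _ UK; have := cardsD1 y (nbhd N U).
  have [sU|sU] := boolP (s \in U).
    rewrite [in X in _ -> X -> _](bigD1 s) //= [in X in _ -> _ -> X](bigD1 s) //= eqxx.
    have -> : \sum_(i in U | i != s) (g i - (i == s)) = \sum_(i in U | i != s) g i.
      by apply: eq_bigr => i /andP[_ /negPf ->]; rewrite subn0.
    have : 0 < g s by apply: leq_ltn_trans Avs.
    by lia.
  have -> : \sum_(i in U) (g i - (i == s)) = \sum_(i in U) g i.
    apply: eq_bigr => i iU; have [e|] := eqVneq i s; last by rewrite subn0.
    by rewrite e (negPf sU) in iU.
  have /forallP/(_ U) := free.
  rewrite /tight UK sU /=.
  by case: (y \in nbhd N U) => /=; rewrite ?implybF ?neq_ltn; lia.
rewrite negb_exists => /forallP blocked; exfalso.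
suff [U tU sub] : exists2 U, tight U & N s :\: Av \subset nbhd N U.
  have l := tight_small _ tU; case/and3P: tU => UK sU /eqP eU.
  have cU : #|s |: U| <= K by rewrite cardsU1 sU; lia.
  have := Nexp _ cU; rewrite big_setU1 //= nbhdU nbhd1.
  have : N s :|: nbhd N U \subset Av :|: nbhd N U.
    rewrite subUset subsetUr andbT; apply/subsetP => z zs.
    rewrite in_setU; case: (boolP (z \in Av)) => //= zAv.
    by apply: (subsetP sub); rewrite in_setD zAv.
  move/subset_leq_card => h1; have := (leq_card_setU Av (nbhd N U)).1; lia.
have : forall r : seq V, {subset r <= N s :\: Av} ->
    exists2 U, tight U & {subset r <= nbhd N U}.
  elim=> [|y r IH] rs; first by exists set0.
  have [z zr|U tU rU] := IH; first by apply: rs; rewrite inE zr orbT.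
  have := rs y (mem_head _ _); rewrite in_setD => /andP[yAv ys].
  have := blocked y; rewrite ys yAv /= negb_forall => /existsP[U'].
  rewrite negb_imply negbK => /andP[tU' yU'].
  exists (U :|: U'); first exact: tightU.
  move=> z; rewrite nbhdU in_setU in_cons => /orP[/eqP->|/rU->//].
  by rewrite yU' orbT.
case/(_ (enum (N s :\: Av))) => [z|U tU sub]; first by rewrite mem_enum.
by exists U => //; apply/subsetP => z zs; apply: sub; rewrite mem_enum.
Qed.

End SelectionLemma.

Section Hall.
Variables (I V : finType).

(** The selection lemma with the indicator of [X] as demand; taking [K] beyond twice [#|I|] makes
    its condition on tight sets automatic. The vertex [y0] only serves as a default value. *)
Lemma hall_aux k (N : I -> {set V}) (X : {set I}) : #|X| = k ->
  (forall U : {set I}, U \subset X -> #|U| <= #|nbhd N U|) ->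
  forall y0 : V, exists f : I -> V, {in X, forall x, f x \in N x} /\ {in X &, injective f}.
Proof.
elim: k N X => [|k IH] N X cX hall y0.
  by have := cards0_eq cX => ->; exists (fun=> y0); split=> x; rewrite inE.
have /card_gt0P[s sX] : 0 < #|X| by rewrite cX.
pose g x := (x \in X) : nat.
have sumg (U : {set I}) : \sum_(x in U) g x = #|U :&: X|.
  rewrite -sum1_card big_mkcond [RHS]big_mkcond /=; apply: eq_bigr => x _.
  by rewrite inE /g; case: (x \in U).
have [U _|U _ _||y [ys _ expy]] := @select_neighbour I V N (#|I|.*2.+2) g s set0 isT.
- rewrite sumg; apply: leq_trans (hall _ (subsetIr _ _)) _.
  by rewrite subset_leq_card ?nbhdS ?subsetIl.
- by have := max_card U; lia.
- by rewrite cards0 /g sX.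
have [||f [fN finj]] := IH (fun x => N x :\ y) (X :\ s) _ _ y0.
- by have := cardsD1 s X; rewrite sX cX add1n => -[].
- move=> U sU; have sXg x : x \in U -> g x - (x == s) = 1.
    by move=> xU; have := subsetP sU x xU; rewrite in_setD1 /g => /andP[/negPf-> ->].
  by have := expy U; rewrite (eq_bigr _ sXg) sum1_card; apply; have := max_card U; lia.
exists (fun x => if x == s then y else f x); split=> [x xX|x x' xX x'X].
  case: eqP => [->//|/eqP ne]; have := fN x; rewrite !in_setD1 ne xX => /(_ isT).
  by case/andP.
have off z : z \in X -> z != s -> f z != y.
  by move=> zX ne; have := fN z; rewrite !in_setD1 ne zX => /(_ isT)/andP[].
case: (eqVneq x s) => [->|ne]; case: (eqVneq x' s) => [->//|ne'].
- by move=> e; have := off _ x'X ne'; rewrite e eqxx.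
- by move=> e; have := off _ xX ne; rewrite e eqxx.
by apply: finj; rewrite in_setD1 ?ne ?ne'.
Qed.

Lemma hall (N : I -> {set V}) (X : {set I}) (y0 : V) :
  (forall U : {set I}, U \subset X -> #|U| <= #|nbhd N U|) ->
  exists f : I -> V, {in X, forall x, f x \in N x} /\ {in X &, injective f}.
Proof. by move=> h; apply: (hall_aux (erefl _) h). Qed.

End Hall.

(** * Leaves and bare paths of rooted trees *)

Lemma card_bigcup_leq (I T : finType) (S : {set I}) (F : I -> {set T}) :
  #|\bigcup_(i in S) F i| <= \sum_(i in S) #|F i|.
Proof.
apply: (big_rec2 (fun (U : {set T}) k => #|U| <= k)) => [|w U k _ Sk]; first by rewrite cards0.
by rewrite (leq_trans (leq_card_setU _ _).1) // leq_add2l.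
Qed.

Section RootedTree.
Variables (T : finType) (root : T) (par : T -> T) (dep : T -> nat) (Delta : nat).
Hypothesis dep_root : dep root = 0.
Hypothesis dep_par : forall v, v != root -> dep v = (dep (par v)).+1.

(** The value [par root] is arbitrary, hence the exclusion of [root]. For the same reason
    [iter j par v] is meaningful only for [j <= dep v]. *)
Definition kids v : {set T} := [set w | (w != root) && (par w == v)].

Hypothesis kids_le : forall v, #|kids v| <= Delta.

Lemma dep_eq0 v : dep v = 0 -> v = root.
Proof. by have [//|/dep_par->] := eqVneq v root. Qed.

Lemma dep_gt0 v : 0 < dep v -> v != root.
Proof. by apply: contraTneq => ->; rewrite dep_root. Qed.

Lemma dep_iter j v : j <= dep v -> dep (iter j par v) = dep v - j.
Proof.
elim: j => [|j IH] jv /=; first by rewrite subn0.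
have := IH (ltnW jv); set w := iter j par v => dw.
have wr : w != root by apply: dep_gt0; rewrite dw subn_gt0.
by have := dep_par wr; rewrite dw; lia.
Qed.

Lemma mem_kids v : v != root -> v \in kids (par v).
Proof. by rewrite inE eqxx andbT. Qed.

Definition desc j t : {set T} := [set v | (j <= dep v) && (iter j par v == t)].

Lemma card_desc j t : #|desc j t| <= Delta ^ j.
Proof.
elim: j => [|j IH].
  by rewrite expn0 -(cards1 t); apply/subset_leq_card/subsetP => v; rewrite !inE.
apply: (@leq_trans #|\bigcup_(w in desc j t) kids w|).
  apply/subset_leq_card/subsetP => v; rewrite inE iterSr => /andP[jv vt].
  have vr : v != root by apply/dep_gt0/(leq_ltn_trans _ jv).
  apply/bigcupP; exists (par v); last exact: mem_kids.
  by rewrite inE vt andbT; move: jv; rewrite (dep_par vr).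
apply: leq_trans (card_bigcup_leq _ _) _.
apply: (@leq_trans (\sum_(w in desc j t) Delta)); first by apply: leq_sum.
by rewrite sum_nat_const expnSr leq_mul2r IH orbT.
Qed.

Lemma card_shallow r : #|[set v | dep v < r]| <= \sum_(j < r) Delta ^ j.
Proof.
elim: r => [|r IH]; first by rewrite big_ord0 leqn0 cards_eq0; apply/eqP/setP => v; rewrite !inE.
rewrite big_ord_recr /=; apply: leq_trans (leq_add IH (card_desc r root)).
apply: leq_trans (leq_card_setU _ _).1.
apply/subset_leq_card/subsetP => v; rewrite !inE ltnS leq_eqVlt => /orP[/eqP dv|->//].
rewrite -dv leqnn /=; apply/orP; right; apply/eqP/dep_eq0.
by rewrite dep_iter ?dv ?subnn.
Qed.

(** Averaging over the residues. Among any [r] consecutive ancestors of a vertex at most one belongs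
    to a given class, which is how the classes separate tops from each other. *)
Lemma depth_class (S : {set T}) r : 0 < r ->
  exists c : nat, #|S| <= r * #|[set v in S | dep v %% r == c]|.
Proof.
move=> r0; have [/existsP[c cP]|] := boolP [exists c : 'I_r, #|S| <= r * #|[set v in S | dep v %% r == c]|].
  by exists (val c).
rewrite negb_exists => /forallP small; exfalso.
have part : #|S| = \sum_(c < r) #|[set v in S | dep v %% r == c]|.
  rewrite -sum1_card (partition_big (fun v => Ordinal (ltn_pmod (dep v) r0)) xpredT) //=.
  apply: eq_bigr => c _; rewrite -sum1_card; apply: eq_bigl => v.
  by rewrite inE -val_eqE.
have S0 : 0 < #|S| by move: (small (Ordinal r0)); case: #|S|.
have : \sum_(c < r) r * #|[set v in S | dep v %% r == c]| <= \sum_(c < r) #|S|.-1.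
  by apply: leq_sum => c _; have := small c; move: (_ * _) S0; clear; lia.
rewrite -big_distrr /= -part sum_nat_const card_ord leq_pmul2l //.
by move: S0; clear; lia.
Qed.

Lemma dep_iter_inj r i i' w : i < r -> i' < r -> i <= dep w -> i' <= dep w ->
  dep (iter i par w) = dep (iter i' par w) %[mod r] -> i = i'.
Proof.
move=> ir i'r iw i'w; rewrite !dep_iter // => e.
wlog ii' : i i' ir i'r iw i'w e / i <= i'.
  by move=> W; case: (leqP i i') => [|/ltnW] h; [apply: W|apply/esym/W].
have : r %| i' - i.
  rewrite /dvdn.
  have -> : i' - i = dep w - i - (dep w - i') by move: ii' i'w iw; clear; lia.
  have [r0|r0] := posnP r; first by rewrite r0 in ir.
  by rewrite modnB ?leq_sub2l // e ltnn mul0n add0n subnn.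
have [d0 _|d0 /(dvdn_leq d0)] := posnP (i' - i); first by move: ii' d0; clear; lia.
by move: i'r ii'; clear; lia.
Qed.

Lemma sum_kids : \sum_v #|kids v| = #|T|.-1.
Proof.
transitivity #|[set v | v != root]|.
  rewrite -sum1_card [RHS](partition_big par xpredT) //=; apply: eq_bigr => v _.
  by rewrite -sum1_card; apply: eq_bigl => w; rewrite !inE.
by rewrite -(cardsC1 root); apply: eq_card => v; rewrite !inE.
Qed.

Definition leaves : {set T} := [set v | kids v == set0].

(** For every number [k] of children, [[k != 1] + 1 <= k + 2 * [k = 0]]. Summing over the vertices
    gives the bound, as there are [#|T| - 1] children in all. *)
Lemma card_not_single : #|[set v | #|kids v| != 1]| <= #|leaves|.*2.
Proof.
have := sum_kids; have : \sum_(v : T) 1 = #|T| by rewrite -sum1_card.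
have cl : \sum_v (v \in leaves : nat) = #|leaves| by rewrite -sum1_card [RHS]big_mkcond.
have cn : \sum_v (v \in [set v | #|kids v| != 1] : nat) = #|[set v | #|kids v| != 1]|.
  by rewrite -sum1_card [RHS]big_mkcond.
have : \sum_v (v \in [set v | #|kids v| != 1] : nat) + \sum_(v : T) 1 <=
   \sum_v #|kids v| + \sum_v (v \in leaves : nat) + \sum_v (v \in leaves : nat).
  rewrite -!big_split /=; apply: leq_sum => v _; rewrite !inE -cards_eq0.
  by case: #|kids v| => [|[|k]].
by rewrite cl cn => h1 h2 h3; move: h1; rewrite h2 h3; lia.
Qed.

(** Walk down through only children. Nothing is claimed about the children of the last vertex [b],
    since the bottom of a bare path may branch. *)
Lemma chain_down t j :
  (exists w i, [/\ i < j, i <= dep w, iter i par w = t & #|kids w| != 1]) \/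
  (exists b, [/\ j <= dep b, iter j par b = t
     & forall i, 0 < i <= j -> #|kids (iter i par b)| = 1]).
Proof.
elim: j => [|j [[w [i [ij iw wt nw]]]|[b [jb bt sb]]]].
- by right; exists t; split=> // i; lia.
- by left; exists w, i; rewrite ltnW.
have [cb|nb] := eqVneq #|kids b| 1; last by left; exists b, j.
right; have /card_gt0P[b' b'b] : 0 < #|kids b| by rewrite cb.
move: b'b; rewrite inE => /andP[b'r /eqP b'b].
exists b'; split; first by rewrite dep_par // b'b.
  by rewrite iterSr b'b.
by case=> // -[|i] ij; rewrite iterSr b'b ?cb //; apply: sb.
Qed.

Lemma single_kid_eq v w : v != root -> w != root -> par v = par w -> #|kids (par v)| = 1 -> v = w.
Proof.
move=> vr wr e /eqP/cards1P[x kx].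
have := mem_kids vr; have := mem_kids wr.
by rewrite -e kx !inE => /eqP-> /eqP->.
Qed.

Lemma single_chain_inj i b b' : i <= dep b -> i <= dep b' -> iter i par b = iter i par b' ->
  (forall l, 0 < l <= i -> #|kids (iter l par b)| = 1) -> b = b'.
Proof.
elim: i => // i IH ib ib' /= e sb; apply: IH; rewrite 1?ltnW //.
  apply: single_kid_eq => //; last by apply: (sb i.+1); rewrite ltnSn.
    by apply: dep_gt0; rewrite dep_iter ?subn_gt0 // ltnW.
  by apply: dep_gt0; rewrite dep_iter ?subn_gt0 // ltnW.
by move=> l /andP[l0 li]; apply: sb; rewrite l0 ltnW.
Qed.

(* In each depth class modulo [k], a vertex that is not single spoils at most one
   top of a bare path. *)
Lemma many_bare_paths k : 1 < k -> 4 * k * #|leaves| <= #|T| ->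
  exists (Tp : {set T}) (bot : T -> T), [/\ #|T| <= 2 * k * #|Tp|,
    forall t, t \in Tp -> k.-1 <= dep (bot t) /\ iter k.-1 par (bot t) = t,
    forall t i, t \in Tp -> 0 < i < k -> #|kids (iter i par (bot t))| = 1
  & forall t t' i i', t \in Tp -> t' \in Tp -> i < k -> i' < k ->
      iter i par (bot t) = iter i' par (bot t') -> t = t' /\ i = i'].
Proof.
move=> k1 fewl; have k0 := ltnW k1; have [c cP] := depth_class [set: T] k0.
set S := [set v in _ | _] in cP; rewrite cardsT in cP.
pose goodb t b := [&& k.-1 <= dep b, iter k.-1 par b == t
  & [forall i : 'I_k, (0 < i) ==> (#|kids (iter i par b)| == 1)]].
pose Tp := [set t in S | [exists b, goodb t b]].
pose bot t := odflt t [pick b | goodb t b].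
have botP t : t \in Tp -> goodb t (bot t).
  rewrite inE => /andP[_ /existsP[b gb]]; rewrite /bot; case: pickP => //= /(_ b).
  by rewrite gb.
have classS t : t \in S -> dep t %% k = c by case/setIdP => _ /eqP.
exists Tp, bot; split=> [|t /botP/and3P[? /eqP ? _] //|t i /botP/and3P[_ _ /forallP sP] /andP[i0 ik]|].
- pose NS := [set v | #|kids v| != 1].
  pose wit t w := [exists i : 'I_k, [&& i <= dep w, iter i par w == t & w \in NS]].
  have witP t : t \in S :\: Tp -> exists w, wit t w.
    rewrite in_setD inE => /andP[ntp tS]; rewrite tS /= negb_exists in ntp.
    have [[w [i [ij iw wt nw]]]|[b [jb bt sb]]] := chain_down t k.-1.
      have ik : i < k by lia.
      by exists w; apply/existsP; exists (Ordinal ik); rewrite /= iw wt eqxx inE.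
    have /forallP/(_ b) := ntp; rewrite /goodb jb bt eqxx /= => /negP[].
    apply/forallP => i; apply/implyP => i0; rewrite sb // i0.
    by have := ltn_ord i; lia.
  pose wt t := odflt t [pick w | wit t w].
  have wtP t : t \in S :\: Tp -> wit t (wt t).
    by move=> /witP[w ww]; rewrite /wt; case: pickP => //= /(_ w); rewrite ww.
  have wtI : {in S :\: Tp &, injective wt}.
    move=> t t' tS t'S e; have /existsP[i /and3P[iw /eqP it _]] := wtP t tS.
    have /existsP[i' /and3P[i'w /eqP it' _]] := wtP t' t'S.
    have et : dep t = dep t' %[mod k].
      by move: tS t'S => /setDP[/classS-> _] /setDP[/classS->].
    rewrite -e in i'w it'; rewrite -it -it' in et *.
    by rewrite (dep_iter_inj _ _ iw i'w et).
  have badS : #|S :\: Tp| <= #|NS|.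
    rewrite -(card_in_imset wtI); apply/subset_leq_card/subsetP => _ /imsetP[t tS ->].
    by have /existsP[i /and3P[]] := wtP t tS.
  have sub : Tp \subset S by apply/subsetP => t; rewrite inE => /andP[].
  have := card_not_single; have := cardsD S Tp; rewrite (setIidPr sub).
  have := subset_leq_card sub; rewrite -/NS; move: badS cP fewl; clear.
  by move: #|NS| #|leaves| #|S| #|Tp| #|S :\: Tp| #|T| => *; nia.
- by have := sP (Ordinal ik); rewrite /= i0 => /eqP.
move=> t t' i i' tP t'P ik i'k e.
have /and3P[db /eqP bt sb] := botP t tP; have /and3P[db' /eqP bt' sb'] := botP t' t'P.
have single x l : goodb x (bot x) -> 0 < l < k -> #|kids (iter l par (bot x))| = 1.
  move=> /and3P[_ _ /forallP sx] /andP[l0 lk]; have := sx (Ordinal lk).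
  by rewrite /= l0 => /eqP.
(* The common vertex has depth [dep t + k.-1 - i], and all tops have the same residue, so [i] and
   [i'] agree modulo [k]. *)
have eqi : i = i'.
  have dbot x : goodb x (bot x) -> dep (bot x) = dep x + k.-1.
    case/and3P => kd /eqP/(congr1 dep) + _; rewrite dep_iter // => <-.
    by rewrite subnK.
  have := congr1 dep e; rewrite !dep_iter ?dbot ?botP //; try by move: ik i'k; clear; lia.
  move=> ed; have : dep t + i' = dep t' + i %[mod k].
    by congr (_ %% _); move: ed ik i'k; clear; lia.
  have sub x : x \in Tp -> x \in S by case/setIdP.
  move/eqP; rewrite -modnDml (classS t) ?sub // -(classS t') ?sub // modnDml eqn_modDl.
  by rewrite !modn_small // => /eqP.
split=> //; subst i'.
rewrite -bt -bt'; congr (iter _ _ _).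
apply: (single_chain_inj _ _ e).
- by lia.
- by lia.
by move=> l /andP[l0 li]; apply: (single _ _ (botP t tP)); rewrite l0 (leq_ltn_trans li).
Qed.

(** At most [Delta ^ r.-1] vertices of [P] lie at distance [r.-1] below a given top. The shallow
    vertices are discarded so that a top still has a parent, to which its bundle will be
    attached. *)
Lemma many_bundles (P : {set T}) r M : 0 < r -> 0 < Delta ->
  \sum_(j < r) Delta ^ j + Delta ^ r.-1 * (r * M) <= #|P| ->
  exists (Tp : {set T}) (foot : T -> T), [/\ M <= #|Tp|,
    forall t, t \in Tp -> [/\ foot t \in P, r <= dep (foot t) & iter r.-1 par (foot t) = t]
  & forall t t', t \in Tp -> t' \in Tp -> dep t = dep t' %[mod r]].
Proof.
move=> r0 D0 bigP; pose P2 := [set p in P | r <= dep p].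
pose Tall := iter r.-1 par @: P2; have [c cP] := depth_class Tall r0.
set S := [set v in _ | _] in cP.
exists S, (fun t => odflt t [pick p in P2 | iter r.-1 par p == t]); split.
- have : #|P| <= \sum_(j < r) Delta ^ j + #|P2|.
    apply: leq_trans (leq_add (card_shallow r) (leqnn _)).
    apply: leq_trans (leq_card_setU _ _).1.
    by apply/subset_leq_card/subsetP => p pP; rewrite !inE pP; case: ltnP.
  have : #|P2| <= #|Tall| * Delta ^ r.-1.
    rewrite -sum_nat_const.
    apply: (@leq_trans (\sum_(t in Tall) #|desc r.-1 t|)); last first.
      by apply: leq_sum => t _; apply: card_desc.
    apply: leq_trans (card_bigcup_leq _ _); apply/subset_leq_card/subsetP => p pP2.
    apply/bigcupP; exists (iter r.-1 par p); first exact: imset_f.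
    by move: pP2; rewrite !inE eqxx andbT => /andP[_]; apply/leq_trans/leq_pred.
  move=> h2 h1; have := leq_trans bigP h1; rewrite leq_add2l => /leq_trans/(_ h2).
  rewrite [_ * _ ^ _]mulnC leq_pmul2l ?expn_gt0 ?D0 // => /leq_trans/(_ cP).
  by rewrite leq_pmul2l.
- move=> t /setIdP[/imsetP[p pP2 tp] _]; case: pickP => [q /=|/(_ p)]; last by rewrite pP2 tp eqxx.
  by case/andP => /setIdP[qP rq] /eqP qt.
by move=> t t' /setIdP[_ /eqP->] /setIdP[_ /eqP->].
Qed.

End RootedTree.

(** * Extendable forests in expanders *)

Section Extendability.
Variables (V : finType) (e : rel V) (m d h c : nat).
Hypothesis e_sym : symmetric e.
Hypothesis m_gt0 : 0 < m.
Hypothesis joined : forall X Y : {set V}, [disjoint X & Y] -> m <= #|X| -> m <= #|Y| ->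
  exists x y, [/\ x \in X, y \in Y & e x y].
Implicit Types (A : {set V * V}) (x y : V).

Definition nb x : {set V} := [set y | e x y].
Definition used A : {set V} := [set a.2 | a in A].
Definition ch A x := #|[set a in A | a.1 == x]|.

(* A state [A] is the set of arcs (parent, child) of a forest grown in the
   graph; [used A] consists of all its vertices, since also a new root is
   recorded as the child of an otherwise childless vertex.  Every vertex is
   entitled to [d] children, and [good_exp] is the Friedman-Pippenger condition
   which guarantees that they can be provided. *)
Record good A : Prop := Good {
  good_edge : forall a, a \in A -> e a.1 a.2;
  good_inj : {in A &, injective snd};
  good_exp : expands m.*2 (fun x => nb x :\: used A) (fun x => d - ch A x) }.

Lemma card_used A : good A -> #|used A| = #|A|.
Proof. by move=> gA; rewrite card_in_imset //; apply: good_inj. Qed.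

Lemma usedS A A' : A \subset A' -> used A \subset used A'.
Proof. exact: imsetS. Qed.

Lemma usedU1 A a : used (a |: A) = a.2 |: used A.
Proof. by rewrite /used imsetU1. Qed.

Lemma usedU A A' : used (A :|: A') = used A :|: used A'.
Proof. by rewrite /used imsetU. Qed.

Lemma mem_used A a : a \in A -> a.2 \in used A.
Proof. exact: imset_f. Qed.

Lemma nbhd_setD W (U : {set V}) : nbhd (fun x => nb x :\: W) U = nbhd nb U :\: W.
Proof.
apply/setP => y; rewrite in_setD; apply/nbhdP/andP => [[x xU]|[yW /nbhdP[x xU yx]]].
  by rewrite in_setD => /andP[yW yx]; split=> //; apply/nbhdP; exists x.
by exists x => //; rewrite in_setD yW.
Qed.

Lemma card_non_neighbours (U : {set V}) : m <= #|U| -> #|~: (nbhd nb U :|: U)| < m.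
Proof.
move=> mU; rewrite ltnNge; apply/negP => mC.
have dis : [disjoint U & ~: (nbhd nb U :|: U)].
  by rewrite disjoints_subset setCK subsetUr.
have [x [y [xU]]] := joined dis mU mC.
rewrite !inE negb_or => /andP[yN _] exy; case/negP: yN.
by apply/nbhdP; exists x; rewrite ?inE.
Qed.

Lemma card_nbhd_ge (U W : {set V}) : m <= #|U| ->
  #|V| < #|nbhd nb U :\: W| + #|W| + #|U| + m.
Proof.
move=> /card_non_neighbours; have := cardsC (nbhd nb U :|: U).
have := (leq_card_setU (nbhd nb U) U).1; have := cardsID W (nbhd nb U).
by have := subset_leq_card (subsetIr (nbhd nb U) W); lia.
Qed.

Lemma sum_ch A (U : {set V}) : \sum_(x in U) ch A x = #|[set a in A | a.1 \in U]|.
Proof.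
transitivity (\sum_(x in U) \sum_(a in A | a.1 == x) 1).
  by apply: eq_bigr => x _; rewrite /ch -sum1_card; apply: eq_bigl => a; rewrite inE.
rewrite -sum1_card (partition_big (fun a : V * V => a.1) (mem U)) /=; last first.
  by move=> a; rewrite inE => /andP[].
apply: eq_bigr => x xU; apply: eq_bigl => a; rewrite !inE.
by case: (a.1 =P x) => [->|]; rewrite ?andbF // xU !andbT.
Qed.

Lemma ch_addl A a x : a \notin A -> ch (a |: A) x = ch A x + (a.1 == x).
Proof.
move=> aA; rewrite /ch -!sum1_card [LHS]big_mkcond [X in _ = X + _]big_mkcond /=.
rewrite (bigD1 a) //= [in RHS](bigD1 a) //= !inE eqxx (negPf aA) /= add0n addnC.
congr (_ + _).
by apply: eq_bigr => b /negPf nba; rewrite !inE nba.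
Qed.

Lemma ch_setD A A' x : A \subset A' -> ch A' x = ch A x + ch (A' :\: A) x.
Proof.
move=> sA; rewrite /ch -(cardsID A); congr (_ + _); apply: eq_card => a; rewrite !inE.
  case: (boolP (a \in A)) => aA; last by rewrite andbF.
  by rewrite (subsetP sA) //= andbT.
by case: (a \in A) => //=; rewrite andbF.
Qed.

(** A deleted arc from [x] to [y] gives [x] one unit of demand back but also returns [y] to its free
    neighbours, so the right side of [good_exp] grows at least as much as the left one. This allows
    temporary trees to be thrown away. *)
Lemma good_sub A A' : A' \subset A -> good A -> good A'.
Proof.
move=> sA [eA iA xA]; split.
- by move=> a aA'; apply: eA; apply: (subsetP sA).
- by move=> a b aA' bA'; apply: iA; apply: (subsetP sA).
move=> U UK; have := xA U UK; rewrite !nbhd_setD.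
have h1 : \sum_(x in U) (d - ch A' x) <= \sum_(x in U) (d - ch A x)
    + \sum_(x in U) ch (A :\: A') x.
  by rewrite -big_split /=; apply: leq_sum => x _; rewrite (ch_setD x sA); lia.
have h2 : #|nbhd nb U :\: used A| + \sum_(x in U) ch (A :\: A') x
    <= #|nbhd nb U :\: used A'|.
  rewrite sum_ch; set E := [set a in A :\: A' | _].
  have injE : {in E &, injective snd}.
    by move=> a b; rewrite !inE -!andbA => /and3P[_ aA _] /and3P[_ bA _]; apply: iA.
  rewrite -(card_in_imset injE) -cardsUI.
  rewrite [X in _ + #|pred_of_set X|](_ : _ = set0) ?cards0 ?addn0; last first.
    apply/eqP; rewrite -subset0; apply/subsetP => y; rewrite !inE => /andP[/andP[yA _]].
    case/imsetP => a; rewrite !inE -!andbA => /and3P[_ aA _] ey.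
    by rewrite ey mem_used in yA.
  apply/subset_leq_card/subsetP => y; rewrite in_setU => /orP[|].
    rewrite !in_setD => /andP[yA ->]; rewrite andbT.
    by apply: contra yA; apply/subsetP/usedS.
  case/imsetP => a; rewrite !inE -!andbA => /and3P[aA' aA aU] ->.
  apply/andP; split; last by apply/nbhdP; exists a.1; rewrite ?inE // eA.
  apply/negP => /imsetP[b bA' eab]; case/negP: aA'.
  by rewrite (iA _ _ aA (subsetP sA _ bA') eab).
by lia.
Qed.

Lemma ext_step A s (Av : {set V}) : good A -> #|A| + (d.*2 + 3) * m <= #|V| ->
  ch A s + #|Av| < d ->
  exists y, [/\ e s y, y \notin used A, y \notin Av & good ((s, y) |: A)].
Proof.
move=> gA room chs; case: (gA) => eA iA xA.
have [|||y [ys yAv expy]] := select_neighbour (Av := Av) (s := s) _ xA; try by lia.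
  move=> U UK; rewrite nbhd_setD => tU; rewrite leq_double leqNgt; apply/negP => mU.
  have := card_nbhd_ge (used A) (ltnW mU); rewrite -tU card_used //.
  have : \sum_(x in U) (d - ch A x) <= \sum_(x in U) d by apply: leq_sum => x _; lia.
  rewrite sum_nat_const.
  have : #|U| * d <= m.*2 * d by rewrite leq_mul2r UK orbT.
  by move: room UK; rewrite -!muln2; nia.
move: ys; rewrite in_setD inE => /andP[yA esy].
exists y; split=> //.
have syA : (s, y) \notin A by apply: contra yA => /mem_used.
split.
- by move=> a; rewrite in_setU1 => /orP[/eqP->|/eA].
- move=> a b; rewrite !in_setU1 => /orP[/eqP->|aA] /orP[/eqP->|bA] //= eab.
  + by rewrite eab mem_used in yA.
  + by rewrite -eab mem_used in yA.
  by apply: iA.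
move=> U UK; move: (expy U UK).
rewrite (eq_bigr (fun x => d - ch ((s, y) |: A) x)).
  move/leq_trans; apply; rewrite nbhd_setD usedU1 /=.
  apply/subset_leq_card/subsetP => z /nbhdP[x xU]; rewrite !inE => /and3P[zy zA ezx].
  rewrite negb_or zy zA /=; apply/nbhdP; exists x => //; by rewrite inE.
by move=> x _; rewrite ch_addl //= [s == x]eq_sym; lia.
Qed.

(** The root is hung below a vertex without children, which exists because there are fewer arcs than
    vertices. Roots thus cost a vertex at most its first child. *)
Lemma new_root A : good A -> 0 < d -> #|A| + (d.*2 + 3) * m <= #|V| ->
  exists a, [/\ a.2 \notin used A, good (a |: A) & ch A a.1 = 0].
Proof.
move=> gA d0 room.
have [s chs] : exists s, ch A s = 0.
  have [/existsP[s /eqP]|] := boolP [exists s, ch A s == 0]; first by exists s.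
  rewrite negb_exists => /forallP pos; exfalso.
  have := sum_ch A [set: V].
  have : #|[set: V]| <= \sum_(x in [set: V]) ch A x.
    by rewrite -sum1_card; apply: leq_sum => x _; rewrite lt0n; apply: pos.
  have : #|[set a in A | a.1 \in [set: V]]| <= #|A|.
    by apply/subset_leq_card/subsetP => a; rewrite inE => /andP[].
  by rewrite cardsT; nia.
have [|y [_ yA _ gy]] := @ext_step A s set0 gA room; first by rewrite chs cards0.
by exists (s, y).
Qed.

Lemma new_roots A t : good A -> 0 < d -> #|A| + t + (d.*2 + 3) * m <= #|V| ->
  exists A', [/\ A \subset A', good A', #|A'| = #|A| + t
    & forall x, ch A' x <= maxn (ch A x) 1].
Proof.
move=> gA d0; elim: t => [|t IH] room.
  by exists A; split=> // [|x]; rewrite ?addn0 // leq_maxl.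
have [|A1 [sA1 gA1 cA1 chA1]] := IH; first by lia.
have [|a [aA1 ga cha]] := new_root gA1 d0; first by lia.
have naA : a \notin A1 by apply: contra aA1 => /mem_used.
exists (a |: A1); split=> //.
- exact: subset_trans (subsetUr _ _).
- by rewrite cardsU1 naA cA1; lia.
move=> x; rewrite ch_addl //; have := chA1 x; case: eqP => [<-|_]; first by rewrite cha; lia.
by lia.
Qed.

Lemma ch_card0 A x : (forall a, a \in A -> a.1 != x) -> ch A x = 0.
Proof.
move=> nx; apply/eqP; rewrite cards_eq0 -subset0; apply/subsetP => a.
by rewrite !inE => /andP[/nx/negPf->].
Qed.

Lemma ch_setU A A' x : ch (A :|: A') x <= ch A x + ch A' x.
Proof.
rewrite /ch; apply: leq_trans (leq_card_setU _ _).1.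
by apply/subset_leq_card/subsetP => a; rewrite !inE andb_orl.
Qed.

Lemma grow_level A (L Av : {set V}) t : good A ->
  (forall x, x \in L -> ch A x + c + #|Av| <= d) -> t <= c * #|L| ->
  #|A| + t + (d.*2 + 3) * m <= #|V| ->
  exists A', [/\ A \subset A', good A', #|A'| = #|A| + t
    & forall a, a \in A' -> a \notin A ->
        [/\ a.1 \in L, a.2 \notin used A & a.2 \notin Av]].
Proof.
move=> gA chL; elim: t => [|t IH] tc room.
  by exists A; split=> // [|a -> //]; rewrite addn0.
have [||A1 [sA1 gA1 cA1 newA1]] := IH; try by lia.
have [x xL chx] : exists2 x, x \in L & ch A1 x < ch A x + c.
  have [/existsP[x /andP[xL chx]]|] := boolP [exists x, (x \in L) && (ch A1 x < ch A x + c)].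
    by exists x.
  rewrite negb_exists => /forallP full; exfalso.
  have : \sum_(x in L) c <= \sum_(x in L) ch (A1 :\: A) x.
    apply: leq_sum => x xL; have := full x; rewrite xL /= (ch_setD x sA1); lia.
  rewrite sum_nat_const sum_ch mulnC.
  have : #|[set a in A1 :\: A | a.1 \in L]| <= #|A1 :\: A|.
    by apply/subset_leq_card/subsetP => a; rewrite inE => /andP[].
  by rewrite cardsD (setIidPr sA1) cA1; lia.
have [||y [_ yA1 yAv gy]] := @ext_step A1 x Av gA1; first by lia.
  by have := chL x xL; lia.
exists ((x, y) |: A1); split=> //.
- exact: subset_trans (subsetUr _ _).
- rewrite cardsU1 cA1 (_ : _ \notin _) ?addnA 1?addnC ?addn1 ?addnS //; first by lia.
  by apply: contra yA1 => /mem_used.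
move=> a; rewrite in_setU1 => /orP[/eqP->|aA1 aA]; last exact: newA1.
by move=> _; split=> //; apply: contra yA1; apply/subsetP/usedS.
Qed.

Hypothesis c_gt0 : 0 < c.

Lemma path_target (S : {set V * V}) x p y :
  path (fun u v => (u, v) \in S) x p -> y \in p -> y \in used S.
Proof.
elim: p x => //= u p IH x /andP[xu up]; rewrite in_cons => /orP[/eqP->|]; last exact: IH up.
exact: (mem_used xu).
Qed.

(** Levels are cut off at [m] vertices, so that depth [j] costs at most [j * m]. The start [a] lies
    in the forest or in [Av], hence the growth never runs into it; in the second case it may stay
    outside the forest. *)
Lemma grow_tree A a (Av : {set V}) j : good A -> (a \in used A) || (a \in Av) ->
  ch A a + c + #|Av| <= d ->
  (forall x, x \notin used A -> x \notin Av -> ch A x + c + #|Av| <= d) ->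
  #|A| + j * m + (d.*2 + 3) * m <= #|V| ->
  exists A' (L : {set V}), [/\ A \subset A', good A', #|A'| <= #|A| + j * m, #|L| = minn (c ^ j) m
    & [/\ forall b, b \in A' -> b \notin A ->
            [/\ (b.1 == a) || (b.1 \in used A' :\: used A), b.2 \notin used A & b.2 \notin Av],
          forall x, x \in L -> [/\ (x == a) || (x \in used A' :\: used A) && (x \notin Av),
            (j == 0) || (x \in used A' :\: used A) & ch A' x = ch A x]
        & forall x, x \in L -> exists p, [/\ size p = j, uniq p, last a p = x
            & path (fun u v => (u, v) \in A' :\: A) a p]]].
Proof.
move=> gA aA cha chA; elim: j => [|j IH] room.
  exists A, [set a]; split=> //; rewrite ?addn0 ?cards1 ?expn0 //.
    by apply/esym/minn_idPl.
  split=> [b -> //|x|x]; rewrite inE => /eqP->; first by rewrite eqxx.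
  by exists [::].
have [|A1 [L [sA1 gA1 cA1 cL [newA1 L1 pathA1]]]] := IH; first by lia.
have aA1 x : x \notin used A1 -> x \notin Av -> x != a.
  move=> xA xAv; apply/eqP => ea; subst x; case/orP: aA; last by rewrite (negPf xAv).
  by move/(subsetP (usedS sA1)); rewrite (negPf xA).
have [|||A2 [sA2 gA2 cA2 newA2]] := @grow_level A1 L Av (minn (c ^ j.+1) m) gA1.
- move=> x xL; have [xa _ ->] := L1 x xL.
  case/orP: xa => [/eqP->//|/andP[]]; rewrite in_setD => /andP[xA _ xAv].
  exact: chA.
- rewrite cL expnS; case: (leqP (c ^ j) m) => _; first exact: geq_minl.
  by apply: leq_trans (geq_minr _ _) _; rewrite leq_pmull.
- by lia.
have usedA2 y : y \in used A2 -> (y \in used A1) ||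
    [exists b in A2, [&& b \notin A1, b.2 == y & b.1 \in L]].
  case/imsetP => b bA2 ->; have [bA1|bA1] := boolP (b \in A1).
    by rewrite mem_used.
  apply/orP; right; apply/existsP; exists b; rewrite bA2 bA1 eqxx.
  by have [] := newA2 b bA2 bA1.
exists A2, [set b.2 | b in A2 :\: A1].
have usedD b : b \in A2 -> b \notin A1 -> [/\ b.2 \in used A2 :\: used A1, b.2 \in used A2 :\: used A,
    b.2 \notin Av & b.1 \in L].
  move=> bA2 bA1; have [? b2 ?] := newA2 b bA2 bA1; rewrite !in_setD b2 mem_used //.
  by split=> //; rewrite andbT; apply: contra b2; apply/subsetP/usedS.
split=> //.
- exact: subset_trans sA2.
- by rewrite cA2; have := geq_minr (c ^ j.+1) m; lia.
- rewrite card_in_imset; last first.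
    by move=> x y /setDP[xA _] /setDP[yA _]; apply: (good_inj gA2).
  by rewrite cardsD (setIidPr sA2) cA2 addKn.
split.
- move=> b bA2 bA; have [bA1|bA1] := boolP (b \in A1).
    have [b1 b2 b3] := newA1 b bA1 bA; split=> //.
    case/orP: b1 => [->//|]; rewrite !in_setD => /andP[-> /(subsetP (usedS sA2))->].
    by rewrite orbT.
  have [_ b2 b3 b1] := usedD b bA2 bA1; split=> //; last by move: b2; rewrite in_setD => /andP[].
  have [_] := L1 _ b1; case/orP => [/eqP j0|].
    have := L1 _ b1 => -[/orP[->//|/andP[]]]; rewrite !in_setD => /andP[-> /(subsetP (usedS sA2))->].
    by rewrite orbT.
  by rewrite !in_setD => /andP[-> /(subsetP (usedS sA2))->]; rewrite orbT.
- move=> x /imsetP[b /setDP[bA2 bA1] ->{x}].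
  have [b2 b2' bAv bL] := usedD b bA2 bA1; rewrite b2' bAv !orbT; split=> //.
  have [nb2 _] := setDP b2; move: b2; rewrite in_setD => /andP[b2A1 _].
  have b2a := aA1 _ b2A1 bAv.
  rewrite (ch_setD _ (subset_trans sA1 sA2)) [X in _ + X]ch_card0 ?addn0 // => z /setDP[zA2 zA].
  apply/eqP => ez; have [zA1|zA1] := boolP (z \in A1).
    have [] := newA1 z zA1 zA; rewrite ez (negPf b2a) /= in_setD => /andP[_].
    by rewrite (negPf b2A1).
  have [_ _ _ zL] := usedD z zA2 zA1; have [] := L1 _ zL.
  by rewrite ez (negPf b2a) /= => /andP[]; rewrite in_setD (negPf b2A1) andbF.
move=> x /imsetP[b /setDP[bA2 bA1] ->{x}].
have [b2 b2' bAv bL] := usedD b bA2 bA1.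
have [p [sp up lp pp]] := pathA1 _ bL.
have sub_rel u v : (u, v) \in A1 :\: A -> (u, v) \in A2 :\: A.
  by rewrite !in_setD => /andP[-> /(subsetP sA2)].
exists (rcons p b.2); rewrite size_rcons sp last_rcons; split=> //.
  rewrite rcons_uniq up andbT; apply/negP => bp.
  have b2A1 : b.2 \in used A1; last by move: b2; rewrite in_setD b2A1.
  by apply: (subsetP (usedS (subsetDl A1 A))); apply: path_target pp bp.
rewrite rcons_path (sub_path sub_rel pp) lp in_setD /= -surjective_pairing bA2 andbT.
by apply: contra bA1; apply/subsetP.
Qed.

(** * Connecting vertices by paths of fixed length *)

Definition arcs x (p : seq V) : {set V * V} := [set z in zip (belast x p) p].

Lemma arcs_sub (S : {set V * V}) x p : path (fun u v => (u, v) \in S) x p -> arcs x p \subset S.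
Proof.
move=> pS; apply/subsetP => z; rewrite inE.
elim: p x pS => //= y p IH x /andP[xy yp].
by rewrite in_cons => /orP[/eqP->//|]; apply: IH.
Qed.

Lemma used_arcs x p : used (arcs x p) = [set y in p].
Proof.
apply/setP => y; rewrite inE; apply/imsetP/idP => [[z]|yp].
  rewrite inE => zp ->; have := map_f snd zp; rewrite -/unzip2 unzip2_zip //.
  by rewrite size_belast.
have := yp; rewrite -{1}(@unzip2_zip _ _ (belast x p) p) ?size_belast // => /mapP[z zp ->].
by exists z; rewrite ?inE.
Qed.

Lemma ch_arcs x p y : ch (arcs x p) y <= (y == x) + count_mem y p.
Proof.
rewrite /ch; apply: (@leq_trans (count (fun z : V * V => z.1 == y) (zip (belast x p) p))).
  rewrite -size_filter cardE; apply: uniq_leq_size; first exact: enum_uniq.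
  by move=> z; rewrite mem_enum mem_filter !inE andbC.
rewrite -(count_map fst (pred1 y)) -/unzip1 unzip1_zip ?size_belast //.
have := congr1 (count_mem y) (lastI x p); rewrite /= -cats1 count_cat [x == y]eq_sym.
by move=> ->; rewrite leq_addr.
Qed.

Hypothesis c_exp : m <= c ^ h.

(** The last levels of the trees of depth [h] grown from [a] and from [b] have [m] vertices each, so
    an edge joins them. Only the arcs of the path are kept. They point away from [a] and from [b],
    and the middle edge is not recorded, so each end and each inner vertex pays at most one
    child. *)
Lemma connect_pair A a b (Av : {set V}) : good A -> 0 < h -> a != b ->
  (a \in used A) || (a \in Av) -> (b \in used A) || (b \in Av) ->
  ch A a + c + #|Av| <= d -> ch A b + c + #|Av| <= d ->
  (forall x, x \notin used A -> x \notin Av -> ch A x + c + #|Av| <= d) ->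
  #|A| + h.*2 * m + (d.*2 + 3) * m <= #|V| ->
  exists A' s, [/\ A \subset A', good A', #|A'| = #|A| + h.*2
    & [/\ uniq s, size s = h.*2, path e a (rcons s b),
          used A' = used A :|: [set x in s]
        & (forall x, x \in s -> (x \notin used A) && (x \notin Av)) /\
          forall x, ch A' x <= ch A x + (x == a) + (x == b) + (x \in s)]].
Proof.
move=> gA h0 ab aA bA cha chb chA room.
have minm : minn (c ^ h) m = m by apply/minn_idPr.
have [|A1 [L1 [sA1 gA1 cA1]]] := @grow_tree A a Av h gA aA cha chA; first by lia.
rewrite minm => cL1 [new1 L1P path1].
have src1 z : z \in A1 :\: A -> z.1 != a -> z.1 \in used A1 :\: used A.
  by case/setDP => zA1 zA; have [/orP[->|]] := new1 z zA1 zA.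
have used1Av x : x \in used A1 -> x \notin used A -> x \notin Av.
  case/imsetP => z zA1 -> zA; have zA' : z \notin A by apply: contra zA => /mem_used.
  by have [] := new1 z zA1 zA'.
have chA1 x : x != a -> x \notin used A1 :\: used A -> ch A1 x = ch A x.
  move=> xa xA; rewrite (ch_setD _ sA1) [X in _ + X]ch_card0 ?addn0 // => z zA1.
  by apply/eqP => ez; move: (src1 z zA1) xA; rewrite ez => ->.
have aA1 : (a \in used A1) || (a \in Av).
  by case/orP: aA => [/(subsetP (usedS sA1))->//|->]; rewrite orbT.
have chA1out x : x \notin used A1 -> x \notin Av -> ch A1 x + c + #|Av| <= d.
  move=> xA xAv; rewrite chA1; first by apply: chA => //; apply: contra xA; apply/subsetP/usedS.
    by apply/eqP => ea; move: aA1; rewrite -ea (negPf xA) (negPf xAv).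
  by rewrite in_setD (negPf xA) andbF.
have chA1b : ch A1 b + c + #|Av| <= d.
  rewrite chA1 // 1?eq_sym //; rewrite in_setD; case: (boolP (b \in used A)) => //= nbA.
  move: bA; rewrite (negPf nbA) /= => bAv; apply/negP => bA1.
  by have := used1Av _ bA1 nbA; rewrite bAv.
have bA1 : (b \in used A1) || (b \in Av).
  by case/orP: bA => [/(subsetP (usedS sA1))->//|->]; rewrite orbT.
have [|A2 [L2 [sA2 gA2 _]]] := @grow_tree A1 b Av h gA1 bA1 chA1b chA1out; first by lia.
rewrite minm => cL2 [new2 L2P path2].
have usedD A3 A4 : A3 \subset A4 -> good A4 -> used (A4 :\: A3) = used A4 :\: used A3.
  move=> s34 g4; apply/setP => x; rewrite in_setD; apply/imsetP/andP.
    move=> [z /setDP[z4 z3] ->]; rewrite (mem_used z4); split=> //; apply/imsetP => -[w w3 ezw].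
    by move: z3; rewrite (good_inj g4 z4 (subsetP s34 _ w3) ezw) w3.
  move=> [x3 /imsetP[z z4 ez]]; exists z => //; rewrite in_setD z4 andbT.
  by apply: contra x3 => z3; rewrite ez mem_used.
have h0' : h == 0 = false by rewrite eqn0Ngt h0.
have dis : [disjoint L1 & L2].
  rewrite disjoint_subset; apply/subsetP => x /L1P[_]; rewrite h0' /= in_setD => /andP[_ xA1] _.
  by apply/negP => /L2P[_]; rewrite h0' /= in_setD xA1.
have [x [y [xL1 yL2 exy]]] : exists x y, [/\ x \in L1, y \in L2 & e x y].
  by apply: joined => //; rewrite ?cL1 ?cL2.
have [p [sp up lp pp]] := path1 x xL1.
have [q [sq uq lq pq]] := path2 y yL2.
have p_new z : z \in p -> z \in used A1 :\: used A.
  by move/(path_target pp); rewrite usedD.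
have q_new z : z \in q -> z \in used A2 :\: used A1.
  by move/(path_target pq); rewrite usedD.
have edge_path A3 u r : good A3 -> path (fun u v => (u, v) \in A3) u r -> path e u r.
  by move=> g3; apply: sub_path => v w /(good_edge g3).
set s := p ++ rev q.
have us : uniq s.
  rewrite cat_uniq up rev_uniq uq andbT; apply/hasPn => z; rewrite mem_rev => /q_new.
  by rewrite in_setD => /andP[zA1 _]; apply: contra zA1 => /p_new; rewrite in_setD => /andP[].
have s_new z : z \in s -> (z \notin used A) && (z \notin Av).
  rewrite mem_cat mem_rev => /orP[/p_new|/q_new]; rewrite in_setD => /andP[zA zA'].
    by rewrite zA used1Av.
  have [w w2 ez] := imsetP zA'; have w1 : w \notin A1 by apply: contra zA => w1; rewrite ez mem_used.
  have [_ _] := new2 w w2 w1; rewrite -ez => ->; rewrite andbT.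
  by apply: contra zA; apply/subsetP/usedS.
have sub' : A :|: arcs a p :|: arcs b q \subset A2.
  rewrite !subUset (subset_trans sA1 sA2) /=; apply/andP; split.
    by apply: subset_trans (arcs_sub pp) (subset_trans (subsetDl _ _) sA2).
  by apply: subset_trans (arcs_sub pq) (subsetDl _ _).
have used' : used (A :|: arcs a p :|: arcs b q) = used A :|: [set z in s].
  rewrite !usedU !used_arcs; apply/setP => z; rewrite !inE mem_cat mem_rev.
  by rewrite orbA.
have g' := good_sub sub' gA2.
exists (A :|: arcs a p :|: arcs b q), s; split=> //.
- by rewrite -setUA subsetUl.
- rewrite -(card_used g') used' cardsU card_used //.
  rewrite (_ : used A :&: _ = set0) ?cards0 ?subn0; last first.
    apply/eqP; rewrite -subset0; apply/subsetP => z; rewrite !inE => /andP[zA zs].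
    by have := s_new z zs; rewrite zA.
  by rewrite cardsE (card_uniqP us) size_cat size_rev sp sq addnn.
split=> //.
- by rewrite size_cat size_rev sp sq addnn.
- rewrite rcons_cat cat_path lp; apply/andP; split.
    by apply: edge_path gA1 _; apply: sub_path pp => u v; rewrite in_setD => /andP[].
  rewrite -rev_cons lastI lq rev_rcons /= exy /= -lq rev_path.
  apply: (@sub_path _ e) => [u v|]; first by rewrite e_sym.
  by apply: edge_path gA2 _; apply: sub_path pq => u v; rewrite in_setD => /andP[].
split=> // z.
apply: leq_trans (ch_setU _ _ _) _; apply: leq_trans (leq_add (ch_setU _ _ _) (ch_arcs _ _ _)) _.
have := ch_arcs a p z; have := count_uniq_mem z us; rewrite count_cat count_rev.
move=> <-; clear; move: (nat_of_bool _) (nat_of_bool _) (ch A z) (ch _ z) (count_mem _ p) (count_mem _ q); lia.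
Qed.

Lemma used_setD A A' : A \subset A' -> good A' -> used (A' :\: A) = used A' :\: used A.
Proof.
move=> sA gA; apply/setP => x; rewrite in_setD; apply/imsetP/andP.
  move=> [z /setDP[zA' zA] ->]; rewrite (mem_used zA'); split=> //.
  apply/imsetP => -[w wA ezw].
  by move: zA; rewrite (good_inj gA zA' (subsetP sA _ wA) ezw) wA.
move=> [xA /imsetP[z zA' ez]]; exists z => //; rewrite in_setD zA' andbT.
by apply: contra xA => zA; rewrite ez mem_used.
Qed.

Lemma card_used_setD A A' : A \subset A' -> good A' -> #|used A' :\: used A| = #|A'| - #|A|.
Proof.
move=> sA gA; have gA0 := good_sub sA gA.
by rewrite cardsD (setIidPr (usedS sA)) !card_used.
Qed.

(** The bound on [ch] reserves one child for every path that ends at a vertex. Inner vertices are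
    new while all ends are already used, so no inner vertex is an end of another path. *)
Lemma connect_family (J : finType) (a b : J -> V) A : good A -> 0 < h ->
  (forall j, [/\ a j != b j, a j \in used A & b j \in used A]) ->
  (forall x, ch A x + (\sum_j ((a j == x) + (b j == x))) + c <= d) ->
  #|A| + #|J| * h.*2 + h.*2 * m + (d.*2 + 3) * m <= #|V| ->
  exists A' (s : J -> seq V), [/\ A \subset A', good A', #|A'| = #|A| + #|J| * h.*2,
      forall j, size (s j) = h.*2 /\ path e (a j) (rcons (s j) (b j))
    & (forall x, \sum_j count_mem x (s j) = (x \in used A' :\: used A)) /\
      forall x, ch A' x <=
        ch A x + (\sum_j ((a j == x) + (b j == x))) + (x \in used A' :\: used A)].
Proof.
move=> gA h0 ab chA room.
suff: forall r : seq J, uniq r -> size r <= #|J| ->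
  exists A' (s : J -> seq V), [/\ A \subset A', good A', #|A'| = #|A| + size r * h.*2,
      forall j, j \in r -> size (s j) = h.*2 /\ path e (a j) (rcons (s j) (b j))
    & (forall x, \sum_(j <- r) count_mem x (s j) = (x \in used A' :\: used A)) /\
      forall x, ch A' x <=
        ch A x + (\sum_(j <- r) ((a j == x) + (b j == x))) + (x \in used A' :\: used A)].
  case/(_ (enum J) (enum_uniq _)); first by rewrite -cardE.
  move=> A' [s [sA gA' cA' sP [cov chA']]]; exists A', s; rewrite [#|J|]cardE; split=> //.
    by move=> j; apply: sP; rewrite mem_enum.
  by split=> x; [have := cov x | have := chA' x]; rewrite !big_enum.
elim=> [_ _|j r IH /=/andP[jr ur] rJ].
  exists A, (fun=> [::]); rewrite addn0; split=> //.
  by split=> x; rewrite !big_nil setDv inE ?addn0.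
have [|A1 [s [sA gA1 cA1 sP [cov chA1]]]] := IH ur; first exact: ltnW.
have sumr (F : J -> nat) : \sum_(i <- j :: r) F i <= \sum_i F i.
  by rewrite big_uniq /= ?jr // big_mkcond /=; apply: leq_sum => i _; case: ifP.
have [abj aj bj] := ab j.
have used1 x : x \in used A -> ch A1 x + c <= d.
  move=> xA; apply: leq_trans (chA x); rewrite leq_add2r.
  apply: leq_trans (chA1 x) _; rewrite in_setD xA addn0 leq_add2l.
  by apply: leq_trans (sumr _); rewrite big_cons leq_addl.
have inA1 x : x \in used A -> (x \in used A1) || (x \in set0).
  by move/(subsetP (usedS sA))->.
have [||||A2 [p [sA2 gA2 cA2 [up sp pp used2 [newp chA2]]]]] :=
  @connect_pair A1 (a j) (b j) set0 gA1 h0 abj (inA1 _ aj) (inA1 _ bj).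
- by rewrite cards0 addn0 used1.
- by rewrite cards0 addn0 used1.
- move=> x xA1 _; rewrite cards0 addn0; apply: leq_trans (chA x); rewrite leq_add2r.
  apply: leq_trans (chA1 x) _; rewrite in_setD (negPf xA1) andbF addn0 leq_add2l.
  by apply: leq_trans (sumr _); rewrite big_cons leq_addl.
- by apply: leq_trans room; rewrite cA1 !leq_add2r leq_add2l leq_mul2r (ltnW rJ) orbT.
have p_new x : (x \in p) + (x \in used A1 :\: used A) = (x \in used A2 :\: used A).
  rewrite used2 !in_setD in_setU inE; have [xp|] := boolP (x \in p); last by rewrite orbF.
  have /andP[xA1 _] := newp x xp; rewrite (negPf xA1) andbF orbT andbT.
  by rewrite (contra (subsetP (usedS sA) x) xA1).
exists A2, (fun i => if i == j then p else s i); split=> //.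
- exact: subset_trans sA2.
- by rewrite cA2 cA1 mulSn -addnA [_ * _ + _]addnC.
- move=> i; rewrite in_cons; case: eqP => [-> _|_] //=; exact: sP.
have s_eq x : \sum_(i <- r) count_mem x (if i == j then p else s i) = \sum_(i <- r) count_mem x (s i).
  by apply: eq_big_seq => i ir; case: eqP ir => // ->; rewrite (negPf jr).
split=> x; rewrite big_cons ?eqxx.
  by rewrite s_eq cov count_uniq_mem // p_new.
move: (chA2 x) (chA1 x); rewrite [a j == x]eq_sym [b j == x]eq_sym -p_new; clear; lia.
Qed.

(** * Absorbing sets *)

Definition absorbing (Q : {set V}) := forall Y : {set V}, #|Y| <= m -> #|Y| <= #|nbhd nb Y :&: Q|.

(** Let [B] be largest among the sets of at most [2 * m] vertices with at most [#|B|] neighbours in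
    [Q]. If it had [m] vertices, it would miss fewer than [m] others and [Q] would have fewer than
    [2 * m + 2 * m + m] elements. A violating [Y] disjoint from [B] would make [Y :|: B] a larger
    such set. *)
Lemma maximal_bad_set (Q : {set V}) : 5 * m <= #|Q| ->
  exists2 B : {set V}, #|B| < m
    & forall Y : {set V}, #|Y| <= m -> [disjoint Y & B] -> #|Y| <= #|nbhd nb Y :&: Q|.
Proof.
move=> Qm; pose P (B : {set V}) := (#|B| <= m.*2) && (#|nbhd nb B :&: Q| <= #|B|).
have P0 : P set0 by rewrite /P nbhd_set0 set0I cards0.
case: (@arg_maxnP _ set0 P (fun B : {set V} => #|B|) P0) => B /andP[Bm badB] maxB.
have Bsmall : #|B| < m.
  rewrite ltnNge; apply/negP => /card_non_neighbours.
  have : #|Q :\: (nbhd nb B :|: B)| <= #|~: (nbhd nb B :|: B)|.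
    by apply/subset_leq_card; rewrite setDE subsetIr.
  have := cardsID (nbhd nb B :|: B) Q; rewrite setIUr [Q :&: nbhd nb B]setIC.
  have := (leq_card_setU (nbhd nb B :&: Q) (Q :&: B)).1.
  have := subset_leq_card (subsetIr Q B); lia.
exists B => // Y Ym disYB; rewrite leqNgt; apply/negP => badY.
have cYB : #|Y :|: B| = #|Y| + #|B| by apply/eqP; rewrite (leq_card_setU Y B).2.
have := maxB (Y :|: B); rewrite /P cYB nbhdU setIUl.
have := (leq_card_setU (nbhd nb Y :&: Q) (nbhd nb B :&: Q)).1; lia.
Qed.

Lemma private_neighbours A (B : {set V}) : good A -> (forall u, u \in B -> ch A u < d) ->
  #|A| + #|B| + (d.*2 + 3) * m <= #|V| ->
  exists A', [/\ A \subset A', good A', #|A'| = #|A| + #|B|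
    & forall x, ch A' x = ch A x + (x \in B)].
Proof.
move=> gA chB room; rewrite [#|B|]cardE in room *.
suff: forall r : seq V, uniq r -> {subset r <= B} -> size r <= #|B| ->
  exists A', [/\ A \subset A', good A', #|A'| = #|A| + size r
    & forall x, ch A' x = ch A x + (x \in r)].
  case/(_ (enum B) (enum_uniq _)) => [x||A' [sA gA' cA' chA']]; first by rewrite mem_enum.
    by rewrite -cardE.
  by exists A'; split=> // x; rewrite chA' mem_enum.
elim=> [_ _ _|x r IH /=/andP[xr ur] rB srB].
  by exists A; rewrite addn0; split=> // x; rewrite addn0.
have xB : x \in B by apply: rB; rewrite mem_head.
have [|||A1 [sA gA1 cA1 chA1]] := IH => //; first by move=> y yr; apply: rB; rewrite in_cons yr orbT.
  exact: ltnW.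
have [||y [_ yA1 _ gy]] := @ext_step A1 x set0 gA1; first by move: srB; rewrite cardE; lia.
  by rewrite chA1 (negPf xr) cards0 !addn0 chB.
have nA1 : (x, y) \notin A1 by apply: contra yA1 => /mem_used.
exists ((x, y) |: A1); split=> //; first exact: subset_trans (subsetUr _ _).
  by rewrite cardsU1 nA1 cA1 add1n addnS.
move=> z; rewrite ch_addl //= chA1 in_cons [x == z]eq_sym.
by case: eqP => [->|_] /=; rewrite ?(negPf xr) ?addn0.
Qed.

(** The first [5 * m] new vertices absorb everything up to a bad set of fewer than [m] vertices, and
    each of these gets a new neighbour of its own; hence [6 * m]. The rest is padding up to the size
    [q]. *)
Lemma absorbing_extension A q : good A -> (forall x, maxn (ch A x) 1 < d) -> 6 * m <= q ->
  #|A| + q + (d.*2 + 3) * m <= #|V| ->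
  exists A', [/\ A \subset A', good A', #|A'| = #|A| + q, absorbing (used A' :\: used A)
    & forall x, ch A' x <= (maxn (ch A x) 1).+1].
Proof.
move=> gA chA qm room; have [v0 _|V0] := pickP V; last first.
  have cV0 : #|V| = 0 by apply: eq_card0.
  by move: (leq_trans (leq_addl _ _) room); rewrite cV0 leqn0 muln_eq0 addn3 /= => /eqP m0; move: m_gt0; rewrite m0.
have d0 : 0 < d by have := chA v0; lia.
have [|A1 [sA1 gA1 cA1 chA1]] := @new_roots A (5 * m) gA d0; first by lia.
have cQ1 : #|used A1 :\: used A| = 5 * m by rewrite card_used_setD // cA1 addKn.
have [|B Bm absB] := @maximal_bad_set (used A1 :\: used A); first by rewrite cQ1.
have [||A2 [sA2 gA2 cA2 chA2]] := @private_neighbours A1 B gA1.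
- by move=> u _; apply: leq_ltn_trans (chA1 u) (chA u).
- by lia.
have [|A3 [sA3 gA3 cA3 chA3]] := @new_roots A2 (q - 5 * m - #|B|) gA2 d0; first by lia.
exists A3; split=> //; first by rewrite (subset_trans sA1) // (subset_trans sA2).
- by lia.
- move=> Y Ym; have sYB : #|Y :\: B| <= m by apply: leq_trans Ym; apply/subset_leq_card/subsetDl.
  have dis : [disjoint Y :\: B & B] by rewrite disjoint_subset; apply/subsetP => x /setDP[].
  have := absB _ sYB dis; rewrite -(cardsID B Y) => h1.
  set E := [set a in A2 :\: A1 | a.1 \in Y :&: B].
  have cE : #|Y :&: B| <= #|E|.
    rewrite -sum_ch -sum1_card; apply: leq_sum => x /setIP[_ xB].
    by have := chA2 x; rewrite xB (ch_setD _ sA2) => /addnI ->.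
  have injE : {in E &, injective snd}.
    move=> z w /setIdP[/setDP[zA _] _] /setIdP[/setDP[wA _] _].
    exact: (good_inj gA2).
  rewrite -(card_in_imset injE) in cE.
  rewrite addnC; apply: leq_trans (leq_add h1 cE) _; rewrite -cardsUI.
  rewrite [X in _ + #|pred_of_set X|](_ : _ = set0) ?cards0 ?addn0; last first.
    apply/eqP; rewrite -subset0; apply/subsetP => y; rewrite in_setI => /andP[].
    rewrite !in_setI in_setD => /and3P[_ _ yA1] /imsetP[z]; rewrite inE => /andP[zA _] ez.
    by move: (mem_used zA); rewrite used_setD // in_setD -ez yA1.
  apply/subset_leq_card/subsetP => y; rewrite in_setU => /orP[|].
    rewrite !inE => /and3P[yY yA yA1]; rewrite yA /= (subsetP (usedS sA3)) ?(subsetP (usedS sA2)) //.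
    by rewrite andbT; apply: (subsetP (nbhdS _ (subsetDl Y B))).
  case/imsetP => z; rewrite inE => /andP[/setDP[zA2 zA1] /setIP[zY zB]] ->.
  have zA1' : z.2 \notin used A1.
    by have := mem_used (_ : z \in A2 :\: A1); rewrite used_setD // !in_setD zA2 zA1 => /(_ isT)/andP[].
  have zA' : z.2 \notin used A by apply: contra zA1'; apply/subsetP/usedS.
  have z3 : z.2 \in used A3 by apply/(subsetP (usedS sA3))/mem_used.
  rewrite in_setI in_setD zA' z3 !andbT.
  by apply/nbhdP; exists z.1 => //; rewrite inE (good_edge gA2).
move=> x; have := chA1 x; have := chA2 x; have := chA3 x; case: (x \in B); lia.
Qed.

(** Exact covers are recorded as sums of indicators throughout: such an equation says at once that
    nothing is repeated and that [S] is filled, and equations for disjoint pieces can be added. *)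
Lemma sum_injective_cover (J T : finType) (S : {set T}) (r : J -> T) : injective r ->
  (forall j, r j \in S) -> #|S| = #|J| -> forall v, \sum_j (r j == v) = (v \in S).
Proof.
move=> rI rS cS v; have [vS|vS] := boolP (v \in S); last first.
  by rewrite big1 // => j _; case: eqP => // ev; rewrite -ev rS in vS.
have imr : r @: [set: J] = S.
  apply/eqP; rewrite eqEcard card_imset // cardsT cS leqnn andbT.
  by apply/subsetP => _ /imsetP[j _ ->].
move: vS; rewrite -imr => /imsetP[j0 _ ->].
rewrite (bigD1 j0) //= eqxx big1 // => j nj; by rewrite (inj_eq rI) (negPf nj).
Qed.

Lemma set_param (J T : finType) (S : {set T}) : #|S| = #|J| ->
  exists r : J -> T, [/\ injective r, forall j, r j \in S
    & forall v, \sum_j (r j == v) = (v \in S)].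
Proof.
move=> cS; pose r j := enum_val (cast_ord (esym cS) (enum_rank j)).
have rI : injective r by move=> i j /enum_val_inj/cast_ord_inj/enum_rank_inj.
have rS j : r j \in S by apply: enum_valP.
by exists r; split=> //; apply: sum_injective_cover.
Qed.

Lemma count_mem_nth (T : eqType) (x0 v : T) s :
  \sum_(p < size s) (nth x0 s p == v) = count_mem v s.
Proof. by rewrite -sum1_count [RHS]big_mkcond (big_nth x0) big_mkord. Qed.

(** Space for [k] permanent vertices, for the two temporary trees of depth [h] that find a
    connecting path, with at most [m] vertices per level, and for [ext_step]. *)
Definition room A k := #|A| + k + h.*2 * m + (d.*2 + 3) * m <= #|V|.

Lemma room_le A k l : k <= l -> room A l -> room A k.
Proof. by move=> kl; apply: leq_trans; rewrite !leq_add2r leq_add2l. Qed.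

Lemma room_roots A k : room A k -> #|A| + k + (d.*2 + 3) * m <= #|V|.
Proof. by apply: leq_trans; rewrite leq_add2r leq_addr. Qed.

Lemma room_inhabited A k : room A k -> exists v : V, v \in V.
Proof.
move=> roomA; apply/card_gt0P; apply: leq_trans roomA.
by rewrite addn_gt0 muln_gt0 m_gt0 addn3 orbT.
Qed.

(* The constructions below give at most 10 children to a vertex that they take
   into use, besides the paths that start or end there. *)
Definition cap A (deg : V -> nat) :=
  forall v, maxn (ch A v) 1 + deg v + 10 * (v \notin used A) + c <= d.

(** * Switches and permuters *)

(** The cycle of a switch runs through four roots joined by paths with [h.*2] inner vertices, so it
    has [4 * K] vertices: two rows of [K] cells with two vertices each. *)
Let K := h.*2.+1.

Lemma used_setD_chain A A1 A2 : A \subset A1 -> A1 \subset A2 -> forall v,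
  (v \in used A1 :\: used A) + (v \in used A2 :\: used A1) = (v \in used A2 :\: used A).
Proof.
move=> sA1 sA2 v; rewrite !in_setD.
have := subsetP (usedS sA1) v; have := subsetP (usedS sA2) v.
by case: (v \in used A); case: (v \in used A1) => //; case: (v \in used A2) => // h1 h2;
  try by [have := h1 isT | have := h2 isT].
Qed.

Lemma cycle_extension A : good A -> 0 < h -> cap A (fun=> 0) -> room A K.*2.*2 ->
  exists A' (C : bool -> nat -> V), [/\ A \subset A', good A', #|A'| = #|A| + K.*2.*2,
      (forall b p, p.+1 < K.*2 -> e (C b p) (C b p.+1)) /\
      forall b, e (C b K.*2.-1) (C (~~ b) 0)
    & (forall v, \sum_b \sum_(p < K.*2) (C b p == v) = (v \in used A' :\: used A)) /\
      forall v, ch A' v <= maxn (ch A v) 1 + 3 * (v \in used A' :\: used A)].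
Proof.
move=> gA h0 capA roomA; have [v0 _] := room_inhabited roomA.
have d0 : 0 < d by have := capA v0; lia.
have [|A1 [sA1 gA1 cA1 chA1]] := @new_roots A 4 gA d0.
  by apply/room_roots/room_le/roomA; rewrite /K; lia.
have cS : #|used A1 :\: used A| = #|{: bool * bool}|.
  by rewrite card_used_setD // cA1 addKn card_prod card_bool.
have [r [rI rS rsum]] := set_param cS.
(* The cyclic order of the four roots: the first component is the row, the second one tells which
   half of the row the root begins. *)
pose next (j : bool * bool) := if j.2 then (~~ j.1, false) else (j.1, true).
have nextI : injective next by move=> [[] []] [[] []].
have used_r j : r j \in used A1 by have := rS j; rewrite in_setD => /andP[].
have deg v : \sum_j ((r j == v) + (r (next j) == v)) = 2 * (v \in used A1 :\: used A).
  rewrite big_split /= rsum mul2n -addnn; congr (_ + _).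
  by rewrite -rsum [RHS](reindex_inj nextI).
have := @connect_family (bool * bool)%type r (r \o next) A1 gA1 h0.
case=> [j|v||A2 [s [sA2 gA2 cA2 sP [cov chA2]]]].
- by split; rewrite ?used_r //= (inj_eq rI); case: j => [[] []].
- rewrite deg; have := capA v; have := chA1 v; rewrite in_setD.
  by case: (v \in used A) => /=; case: (v \in used A1) => /=; clear; lia.
- by apply: leq_trans roomA; rewrite cA1 card_prod card_bool !leq_add2r /K; lia.
have sA : A \subset A2 by apply: subset_trans sA2.
have new2 := used_setD_chain sA1 sA2.
pose C b := r (b, false) :: s (b, false) ++ r (b, true) :: s (b, true).
have sC b : size (C b) = K.*2.
  by rewrite /= size_cat /= !(sP _).1 /K; lia.
have pC b : path e (r (b, false)) (behead (C b) ++ [:: r (~~ b, false)]).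
  have [_] := sP (b, false); have [_] := sP (b, true).
  rewrite !rcons_path /= !cat_path /= last_cat /= -!andbA => /andP[p2 l2] /andP[p1 l1].
  by rewrite p1 l1 p2 l2.
have pC' b p : p < K.*2 -> e (nth v0 (C b) p) (nth v0 (behead (C b) ++ [:: r (~~ b, false)]) p).
  move=> pK; have /(pathP v0)/(_ p) := pC b.
  rewrite size_cat addn1 -(_ : size (C b) = (size (behead (C b))).+1) // sC => /(_ pK).
  rewrite [nth _ (_ :: _ ++ _) _](_ : _ = nth v0 (C b ++ [:: r (~~ b, false)]) p) //.
  by rewrite [in X in e X _]nth_cat sC pK.
exists A2, (fun b p => nth v0 (C b) p); split=> //.
- by rewrite cA2 cA1 card_prod card_bool /K; lia.
- split=> [b p pK|b].
    have := pC' b p (ltnW pK); rewrite nth_cat size_behead sC ifT; last by move: pK; lia.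
    by rewrite nth_behead.
  have := pC' b K.*2.-1; rewrite prednK; last by rewrite /K; lia.
  by rewrite nth_cat size_behead sC ltnn subnn; apply.
split=> v.
  have pr (F : bool * bool -> nat) : \sum_j F j = \sum_b \sum_g F (b, g).
    by rewrite pair_bigA /=; apply: eq_bigr => -[].
  rewrite -new2 -rsum -cov !pr -big_split /=.
  apply: eq_bigr => b _; rewrite -(sC b) count_mem_nth /= count_cat /= !big_bool /=.
  by rewrite ![_ == v]eq_sym; lia.
have := chA2 v; rewrite deg -new2; have := chA1 v; rewrite !in_setD.
have := subsetP (usedS sA1) v.
by case: (v \in used A); case: (v \in used A1); case: (v \in used A2); clear => //=; lia.
Qed.

Lemma sum_ord_double (F : nat -> nat) q :
  \sum_(p < q.*2) F p = \sum_(i < q) F i.*2 + \sum_(i < q) F i.*2.+1.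
Proof.
elim: q => [|q IH]; first by rewrite !big_ord0.
by rewrite doubleS !big_ord_recr /= IH -!addnA; congr (_ + _); rewrite addnCA.
Qed.

(** A wire visits [K] cells of two vertices, entering each through a connecting path, and leaves by
    one more such path. *)
Definition switch_size := K * h.*2.+2 + h.*2.

(* The cycle is read as two rows [b] of [K] cells, cell [i] of row [b] having
   an entrance [st b i] and an exit [en b i]; it runs through
   [en b 0, st b 0, en b 1, st b 1, ...] and then through the other row.
   Connecting paths lead from exit [i] to entrance [i + 1].  With [tau = false]
   each wire crosses the cells of its row; with [tau = true] it leaves cell [i]
   through the exit of cell [i + 1], hence uses the even cells of its row and
   then, [K] being odd, the odd cells of the other one. *)
Lemma switch_extension A (s t : bool -> V) : good A -> 0 < h ->
  (forall b, s b \in used A) -> (forall b, t b \in used A) ->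
  cap A (fun v => \sum_b ((s b == v) + (t b == v))) -> room A switch_size.*2 ->
  exists A' (P : bool -> bool -> seq V), [/\ A \subset A', good A',
      #|A'| = #|A| + switch_size.*2,
      forall tau b, size (P tau b) = switch_size /\
        path e (s b) (rcons (P tau b) (t (b (+) tau)))
    & (forall tau v, \sum_b count_mem v (P tau b) = (v \in used A' :\: used A)) /\
      forall v, ch A' v <= maxn (ch A v) 1 + \sum_b ((s b == v) + (t b == v))
        + 10 * (v \in used A' :\: used A)].
Proof.
move=> gA h0 sA tA capA roomA.
have [||A1 [C [sA1 gA1 cA1 [eC eC0] [covC chA1]]]] := cycle_extension gA h0.
- by move=> v; apply: leq_trans (capA v); rewrite !leq_add2r leq_add2l.
- by apply: room_le roomA; rewrite /switch_size /K; nia.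
pose en b i := C b i.*2; pose st b i := C b i.*2.+1.
have Cnew b p : p < K.*2 -> C b p \in used A1 :\: used A.
  move=> pK; have := covC (C b p); case: (C b p \in _) => //.
  by rewrite (bigD1 b) //= (bigD1 (Ordinal pK)) //= eqxx.
have Cinj b p q : p < K.*2 -> q < K.*2 -> p != q -> C b p != C b q.
  move=> pK qK pq; apply/eqP => epq; have := covC (C b p).
  rewrite (bigD1 b) //= (bigD1 (Ordinal pK)) //= (bigD1 (Ordinal qK)) /=; last first.
    by apply: contra pq => /eqP[->].
  by rewrite epq eqxx; case: (_ \in _).
(* Path [i] of a row leads from the exit of cell [i - 1] to the entrance of cell [i]; the ends [s b]
   and [t b] stand in for the missing exit at [i = 0] and the missing entrance at [i = K]. *)
pose src b i := if i == 0 then s b else en b i.-1.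
pose dst b i := if i < K then st b i else t b.
pose src' (j : bool * 'I_K.+1) := src j.1 j.2.
pose dst' (j : bool * 'I_K.+1) := dst j.1 j.2.
have pr (n : nat) (F : bool * 'I_n -> nat) : \sum_j F j = \sum_b \sum_i F (b, i).
  by rewrite pair_bigA /=; apply: eq_bigr => -[].
have deg v : \sum_j ((src' j == v) + (dst' j == v)) =
    \sum_b ((s b == v) + (t b == v)) + (v \in used A1 :\: used A).
  rewrite pr -covC -big_split /=; apply: eq_bigr => b _.
  have srcE : \sum_(i < K.+1) (src b i == v) = (s b == v) + \sum_(i < K) (C b i.*2 == v).
    by rewrite big_ord_recl.
  have dstE : \sum_(i < K.+1) (dst b i == v) = \sum_(i < K) (C b i.*2.+1 == v) + (t b == v).
    rewrite big_ord_recr /= /dst ltnn; congr (_ + _).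
    by apply: eq_bigr => i _; rewrite /= ltn_ord.
  rewrite big_split /= srcE dstE (sum_ord_double (fun p => (C b p == v) : nat)).
  by rewrite -!addnA; congr (_ + _); rewrite [RHS]addnC -addnA.
have := @connect_family (bool * 'I_K.+1)%type src' dst' A1 gA1 h0.
have h1 : h.*2 < K by [].
case=> [[b i]|v||A2 [k [sA2 gA2 cA2 kP [covk chA2]]]].
- rewrite /src' /dst' /= /src /dst; have in1 := subsetP (usedS sA1).
  have Cu p : p < K.*2 -> C b p \in used A1 by move/(Cnew b); rewrite in_setD => /andP[].
  have Cn p : p < K.*2 -> C b p \notin used A by move/(Cnew b); rewrite in_setD => /andP[].
  have ne p x : p < K.*2 -> x \in used A -> C b p != x.
    by move=> /Cn pn xA; apply: contra pn => /eqP->.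
  have sA1' := in1 _ (sA b); have tA1' := in1 _ (tA b).
  case: i => i iK /=; case: (posnP i) => [->|i0] /=.
    by split; rewrite ?sA1' ?Cu // eq_sym ne.
  case: (ltnP i K) => iK'; last first.
    have iK2 : i.-1.*2 < K.*2 by move: iK i0; clear; lia.
    by split; rewrite ?tA1' ?ne ?Cu.
  have iK2 : i.-1.*2 < K.*2 by move: iK' i0; clear; lia.
  have iK3 : i.*2.+1 < K.*2 by move: iK' i0; clear; lia.
  by split; rewrite ?Cinj ?Cu //; move: i0; clear; lia.
- rewrite deg; have := capA v; have := chA1 v; rewrite in_setD.
  by case: (v \in used A) => /=; case: (v \in used A1) => /=; clear; lia.
- apply: leq_trans roomA; rewrite cA1 card_prod card_bool card_ord !leq_add2r /switch_size /K.
  clear; nia.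
pose kk b i := k (b, inord i).
have kkP b i : i <= K -> size (kk b i) = h.*2 /\ path e (src b i) (rcons (kk b i) (dst b i)).
  by move=> iK; have := kP (b, inord i); rewrite /src' /dst' /= inordK.
(* [x tau b i] is the vertex by which a wire leaves cell [i] of row [b]. The cell [f tau b i] is the
   one at place [i] on wire [b]: when crossed, the cells [0, 2, ..., 2 * h] of row [b], then
   [1, 3, ..., 2 * h - 1] of the other row. *)
pose x tau b i := if tau then (if i.+1 < K then en b i.+1 else en (~~ b) 0) else en b i.
pose f tau b i : bool * nat :=
  if tau then (b (+) (h < i), if h < i then i.*2 - K else i.*2) else (b, i).
pose blk tau b i := kk b i ++ [:: st b i; x tau b i].
pose blks tau b q := flatten [seq blk tau (f tau b i).1 (f tau b i).2 | i <- iota 0 q].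
pose P tau b := blks tau b K ++ kk (b (+) tau) K.
have fK tau b i : i < K -> (f tau b i).2 < K.
  by rewrite /f /K; case: tau => //=; case: (ltnP h i) => /=; clear; lia.
have edge tau b i : i < K -> e (st b i) (x tau b i).
  move=> iK; rewrite /x; case: tau; last by rewrite e_sym eC // ltn_Sdouble.
  case: ltnP => iK'; first by rewrite eC // -doubleS ltn_double.
  by have -> : st b i = C b K.*2.-1; [rewrite /st; congr (C b _); move: iK iK'; clear; lia|apply: eC0].
pose nsrc tau b q := if q < K then src (f tau b q).1 (f tau b q).2 else src (b (+) tau) K.
have xsrc tau b q : q < K -> x tau (f tau b q).1 (f tau b q).2 = nsrc tau b q.+1.
  move=> qK; rewrite /nsrc /x /f /src; case: tau => /=; last first.
    by rewrite addbF; case: ltnP => // Kq; congr (en b _); move: qK Kq; rewrite /K; clear; lia.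
  have [qh|hq] := leqP q h.
    rewrite addbF addbT; have -> : h < q.+1 = (q == h) by move: qh; clear; lia.
    have -> : q.*2.+1 < K = (q != h) by move: qh; rewrite /K; clear; lia.
    have -> : q.+1 < K by move: qh h0; rewrite /K; clear; lia.
    have [->|ne] /= := eqVneq q h; rewrite ?addbT ?addbF //.
    by rewrite (_ : h.+1.*2 - K = 1) // /K; clear; lia.
  have -> : h < q.+1 by move: hq; clear; lia.
  have -> : (q.*2 - K).+1 < K by move: hq qK; rewrite /K; clear; lia.
  rewrite addbT; case: ltnP => qK'.
    have -> : q.+1.*2 - K == 0 = false by move: hq; rewrite /K; clear; lia.
    by congr (en _ _); move: hq; rewrite /K; clear; lia.
  by congr (en _ _); move: qK qK' hq; rewrite /K; clear; lia.
have walk tau b q : q <= K -> path e (s b) (blks tau b q) /\ last (s b) (blks tau b q) = nsrc tau b q.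
  elim: q => [_|q IH qK]; first by rewrite /blks /nsrc /f /src; case: tau; rewrite //= addbF.
  have [p0 l0] := IH (ltnW qK).
  rewrite /blks -addn1 iotaD map_cat flatten_cat /= cats0 -/(blks tau b q).
  rewrite last_cat cat_path l0 p0 add0n /= {1 2}/blk last_cat /= addn1 -xsrc //; split=> //.
  have iK := fK tau b _ qK; have [_] := kkP (f tau b q).1 _ (ltnW iK).
  rewrite {1}/nsrc qK /dst iK rcons_path cat_path => /andP[-> /= ->] /=.
  by rewrite edge.
(* The two wires together visit each cell exactly once, so sums along the wires are sums over all
   cells. *)
have reF tau (F : bool -> nat -> nat) :
    \sum_b \sum_(i < K) F (f tau b i).1 (f tau b i).2 = \sum_b \sum_(i < K) F b i.
  pose g (j : bool * 'I_K) := let c := f tau j.1 j.2 in (c.1, Ordinal (fK tau j.1 j.2 (ltn_ord j.2))).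
  have gI : injective g.
    move=> [b i] [b' i'] eg; have e1 := congr1 fst eg.
    have e2 := congr1 (fun z => val z.2) eg.
    move: e1 e2; rewrite /= /f => {eg g}; case: tau => /= e1 e2; last by rewrite e1 (ord_inj e2).
    have eii : i = i' :> nat.
      have := ltn_ord i; have := ltn_ord i'; move: e2; rewrite /K.
      by case: (ltnP h i); case: (ltnP h i'); clear; move: (nat_of_ord i) (nat_of_ord i') => p q; lia.
    by rewrite (ord_inj eii); rewrite eii in e1; rewrite (addIb e1).
  have -> : \sum_b \sum_(i < K) F b i = \sum_(j : bool * 'I_K) F j.1 j.2 by rewrite pr.
  by rewrite (reindex_inj gI) pr.
have rebool tau (F : bool -> nat) : \sum_b F (b (+) tau) = \sum_b F b.
  by rewrite !big_bool; case: tau; rewrite //= addnC.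
(* Crossed or straight, the vertices by which cells are left are all the exits, each once. This is
   why the covered set does not depend on [tau]. *)
have xE tau v : \sum_b \sum_(i < K) (x tau b i == v) = \sum_b \sum_(i < K) (C b i.*2 == v).
  case: tau => //.
  have xl b : \sum_(i < K) (x true b i == v) =
      \sum_(i < h.*2) (C b i.+1.*2 == v) + (C (~~ b) 0 == v).
    rewrite big_ord_recr /= ltnn; congr (_ + _).
    by apply: eq_bigr => i _; rewrite /= ltnS ltn_ord.
  have cl b : \sum_(i < K) (C b i.*2 == v) = (C b 0 == v) + \sum_(i < h.*2) (C b i.+1.*2 == v).
    by rewrite big_ord_recl.
  rewrite (eq_bigr _ (fun b _ => xl b)) (eq_bigr _ (fun b _ => cl b)) !big_bool /=.
  by clear; lia.
exists A2, P; split=> //; first exact: subset_trans sA2.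
- rewrite cA2 cA1 card_prod card_bool card_ord /switch_size /K; clear; nia.
- move=> tau b; have [p0 l0] := walk tau b K (leqnn K).
  have [s1 p1] := kkP (b (+) tau) K (leqnn K).
  split.
    rewrite size_cat s1 /switch_size; congr (_ + _).
    have : forall q, q <= K -> size (blks tau b q) = q * h.*2.+2.
      elim=> // q IH qK; rewrite /blks -addn1 iotaD map_cat flatten_cat /= cats0 -/(blks tau b q).
      rewrite size_cat IH 1?ltnW // size_cat /= add0n (kkP _ _ _).1 ?addn2; last exact/ltnW/fK.
      by rewrite addn1 mulSn addnC.
    exact.
  rewrite /P rcons_cat cat_path p0 l0 /nsrc ltnn.
  by move: p1; rewrite /dst ltnn.
split.
- move=> tau v; rewrite -(used_setD_chain sA1 sA2) -covC -covk pr.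
  rewrite /P.
  have cblk b : count_mem v (blks tau b K) = \sum_(i < K) count_mem v (blk tau (f tau b i).1 (f tau b i).2).
    rewrite /blks count_flatten -map_comp sumnE big_map -(big_mkord xpredT
      (fun i => count_mem v (blk tau (f tau b i).1 (f tau b i).2))) /index_iota subn0.
    by apply: eq_bigr.
  under eq_bigr => b _ do rewrite count_cat cblk.
  rewrite big_split /= (reF tau (fun b i => count_mem v (blk tau b i))).
  rewrite (rebool tau (fun b => count_mem v (kk b K))).
  have -> : \sum_b \sum_(i < K) count_mem v (blk tau b i) = \sum_b \sum_(i < K) count_mem v (kk b i)
      + (\sum_b \sum_(i < K) (C b i.*2.+1 == v) + \sum_b \sum_(i < K) (x tau b i == v)).
    rewrite -!big_split /=; apply: eq_bigr => b _; rewrite -!big_split /=; apply: eq_bigr => i _.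
    by rewrite count_cat /= addn0.
  have -> : \sum_b \sum_(i < K.+1) count_mem v (k (b, i)) =
      \sum_b \sum_(i < K) count_mem v (kk b i) + \sum_b count_mem v (kk b K).
    rewrite -big_split /=; apply: eq_bigr => b _.
    transitivity (\sum_(i < K.+1) count_mem v (kk b i)); last by rewrite big_ord_recr.
    by apply: eq_bigr => i _; rewrite /kk inord_val.
  have -> : \sum_b \sum_(p < K.*2) (C b p == v) =
      \sum_b \sum_(i < K) (C b i.*2 == v) + \sum_b \sum_(i < K) (C b i.*2.+1 == v).
    rewrite -big_split /=; apply: eq_bigr => b _.
    exact: (sum_ord_double (fun p => (C b p == v) : nat)).
  by rewrite xE; clear; lia.
move=> v; have := chA2 v; rewrite deg -(used_setD_chain sA1 sA2); have := chA1 v.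
by clear; lia.
Qed.

Lemma used_split A A' v : A \subset A' ->
  (v \in used A' : nat) = (v \in used A) + (v \in used A' :\: used A).
Proof.
move=> /usedS/subsetP/(_ v); rewrite in_setD.
by case: (v \in used A) => [->|_].
Qed.

Lemma leq_sum_seq (J : finType) (r : seq J) (F : J -> nat) : uniq r ->
  \sum_(i <- r) F i <= \sum_i F i.
Proof.
by move=> ur; rewrite big_uniq //= big_mkcond /=; apply: leq_sum => i _; case: ifP.
Qed.

Lemma switch_family (J : finType) (s t : J -> bool -> V) A : good A -> 0 < h ->
  (forall j b, s j b \in used A) -> (forall j b, t j b \in used A) ->
  cap A (fun v => \sum_j \sum_b ((s j b == v) + (t j b == v))) ->
  room A (#|J| * switch_size.*2) ->
  exists A' (P : J -> bool -> bool -> seq V), [/\ A \subset A', good A',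
      #|A'| = #|A| + #|J| * switch_size.*2,
      forall j tau b, size (P j tau b) = switch_size /\
        path e (s j b) (rcons (P j tau b) (t j (b (+) tau)))
    & (forall (tau : J -> bool) v,
        \sum_j \sum_b count_mem v (P j (tau j) b) = (v \in used A' :\: used A)) /\
      forall v, ch A' v <= maxn (ch A v) 1 + \sum_j \sum_b ((s j b == v) + (t j b == v))
        + 10 * (v \in used A' :\: used A)].
Proof.
move=> gA h0 sA tA capA roomA.
suff: forall r : seq J, uniq r -> size r <= #|J| ->
  exists A' (P : J -> bool -> bool -> seq V), [/\ A \subset A', good A',
      #|A'| = #|A| + size r * switch_size.*2,
      forall j, j \in r -> forall tau b, size (P j tau b) = switch_size /\
        path e (s j b) (rcons (P j tau b) (t j (b (+) tau)))
    & (forall (tau : J -> bool) v,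
        \sum_(j <- r) \sum_b count_mem v (P j (tau j) b) = (v \in used A' :\: used A)) /\
      forall v, ch A' v <= maxn (ch A v) 1 + \sum_(j <- r) \sum_b ((s j b == v) + (t j b == v))
        + 10 * (v \in used A' :\: used A)].
  case/(_ (enum J) (enum_uniq _)); first by rewrite -cardE.
  move=> A' [P [sA' gA' cA' PP [cov chA']]]; exists A', P; rewrite [#|J|]cardE; split=> //.
    by move=> j; apply: PP; rewrite mem_enum.
  by split=> [tau v|v]; [have := cov tau v | have := chA' v]; rewrite !big_enum.
elim=> [_ _|j r IH /=/andP[jr ur] rJ].
  exists A, (fun _ _ _ => [::]); rewrite addn0; split=> //.
  by split=> [tau v|v]; rewrite !big_nil setDv inE ?muln0 ?addn0 ?leq_maxl.
have [|A1 [P [sA1 gA1 cA1 PP [cov chA1]]]] := IH ur; first exact: ltnW.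
have ujr : uniq (j :: r) by rewrite /= jr.
have in1 x : x \in used A -> x \in used A1 by apply/subsetP/usedS.
case: (@switch_extension A1 (s j) (t j) gA1 h0).
- by move=> b; apply: in1.
- by move=> b; apply: in1.
- move=> v; move: (chA1 v) (capA v) (used_split v sA1).
  have := leq_sum_seq (fun j => \sum_b ((s j b == v) + (t j b == v))) ujr; rewrite big_cons.
  rewrite in_setD; case: (v \in used A); case: (v \in used A1) => //=; clear; lia.
- apply: leq_trans roomA; rewrite cA1 !leq_add2r -addnA leq_add2l.
  by rewrite -mulSnr leq_mul2r rJ orbT.
move=> A2 [Q [sA2 gA2 cA2 QP [covQ chA2]]].
exists A2, (fun i => if i == j then Q else P i); split=> //.
- exact: subset_trans sA2.
- by rewrite cA2 cA1 mulSnr addnA.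
- by move=> i; rewrite in_cons; case: eqP => [-> _|_] //=; apply: PP.
split=> [tau v|v]; rewrite big_cons ?eqxx.
  rewrite covQ -(used_setD_chain sA1 sA2) addnC; congr (_ + _); rewrite -(cov tau).
  by apply: eq_big_seq => i ir; case: eqP ir => // ->; rewrite (negPf jr).
move: (chA1 v) (chA2 v); rewrite -(used_setD_chain sA1 sA2); clear.
by move: (\sum_b _) (\sum_(_ <- r) _) (ch A v) (ch A1 v) => p q n1 n2; lia.
Qed.

(* Hall's theorem chooses one wire of each pair of inputs so that the chosen
   wires go to distinct pairs of outputs: these are the wires sent through the
   subnetwork [false]. *)
Lemma benes_routing (J : finType) (sigma : {perm bool * J}) :
  exists (tin tout : J -> bool) (rho : bool -> {perm J}), forall b j,
    sigma (b, j) = (b (+) tin j (+) tout (rho (b (+) tin j) j), rho (b (+) tin j) j).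
Proof.
have [j0 _|J0] := pickP J; last first.
  by exists (fun=> false), (fun=> false), (fun=> 1%g) => b j; have := J0 j.
pose N j := [set (sigma (false, j)).2; (sigma (true, j)).2].
have hallN (U : {set J}) : U \subset [set: J] -> #|U| <= #|nbhd N U|.
  move=> _; rewrite -leq_double -!mul2n -card_bool -!cardsT -!cardsX.
  rewrite -(card_imset _ (@perm_inj _ sigma)).
  apply/subset_leq_card/subsetP => _ /imsetP[[b j] /setXP[_ jU] ->].
  rewrite inE /= in_setT; apply/nbhdP; exists j => //; rewrite !inE.
  by case: b; rewrite eqxx ?orbT.
have [f [fN finj]] := hall j0 hallN.
have fI : injective f by move=> j k; apply: finj; rewrite inE.
pose tin j := f j != (sigma (false, j)).2.
have ftin j : (sigma (tin j, j)).2 = f j.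
  rewrite /tin; case: eqP => [->//|/eqP ne] /=.
  by have := fN j; rewrite !inE (negPf ne) => /(_ isT)/eqP.
(* The wire [(~~ tin j, j)] is not chosen, so it differs from every chosen one; if both go to the
   same output pair, they take different outputs. *)
have other i j : (sigma (~~ tin j, j)).2 = f i ->
    (sigma (~~ tin j, j)).1 = ~~ (sigma (tin i, i)).1.
  move=> e2; apply/eqP; rewrite -[_ == _]negbK; apply/negP => ne.
  have e1 : (sigma (~~ tin j, j)).1 = (sigma (tin i, i)).1.
    by move: ne; case: (_.1); case: (_.1).
  have : sigma (~~ tin j, j) = sigma (tin i, i).
    by apply: injective_projections; rewrite ?e1 ?e2 ?ftin.
  by move/perm_inj => [+ eji]; rewrite eji; case: (tin i).
pose g j := (sigma (~~ tin j, j)).2.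
have gI : injective g.
  move=> j k egjk; have [f' fK f'K] := injF_bij fI.
  have ej : (sigma (~~ tin j, j)).2 = f (f' (g j)) by rewrite f'K.
  have ek : (sigma (~~ tin k, k)).2 = f (f' (g j)) by rewrite f'K egjk.
  have : sigma (~~ tin j, j) = sigma (~~ tin k, k).
    by apply: injective_projections; rewrite ?(other _ _ ej) ?(other _ _ ek).
  by move/perm_inj => [_ ->].
pose rho (b : bool) := if b then perm gI else perm fI.
(* Chosen wires reach the output switches on the side [false], so a switch is crossed exactly when
   its chosen wire must leave at [true]. *)
pose tout l := let i := (perm fI)^-1%g l in (sigma (tin i, i)).1.
exists tin, tout, rho => b j.
have [->|nb] := eqVneq b (tin j).
  have ef : (perm fI)^-1%g (f j) = j by rewrite -(permE fI) permK.
  by rewrite addbb /rho /tout permE ef; apply: injective_projections; rewrite /= ?ftin.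
have -> : b = ~~ tin j by move: nb; case: b; case: (tin j).
rewrite addNb addbb /rho /tout /= permE.
have eg : (sigma (~~ tin j, j)).2 = f ((perm fI)^-1%g (g j)).
  by rewrite -(permE fI) permKV.
by apply: injective_projections; rewrite /= ?(other _ _ eg).
Qed.

Fixpoint wires (t : nat) : finType :=
  if t is t'.+1 then (bool * wires t')%type else unit.

Lemma card_wires t : #|wires t| = 2 ^ t.
Proof. by elim: t => [|t IH] /=; rewrite ?card_unit // card_prod card_bool IH expnS. Qed.

(** An input switch, an output switch, the two vertices where the wire enters and leaves a
    subnetwork, and the subnetwork itself; at the bottom a single connecting path. *)
Fixpoint permuter_size (t : nat) : nat :=
  if t is t'.+1 then switch_size.*2 + 2 + permuter_size t' else h.*2.

(* The set covered by the paths does not depend on [sigma], so that [sigma] may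
   be chosen after all other vertices have been distributed. *)
Lemma permuter_extension t (x y : wires t -> V) A : good A -> 0 < h ->
  (forall i, x i \in used A) -> (forall i, y i \in used A) -> (forall i j, x i != y j) ->
  cap A (fun v => \sum_i ((x i == v) + (y i == v))) ->
  room A (2 ^ t * permuter_size t) ->
  exists A', [/\ A \subset A', good A', #|A'| = #|A| + 2 ^ t * permuter_size t,
      forall sigma : {perm wires t}, exists P : wires t -> seq V,
        (forall i, size (P i) = permuter_size t /\ path e (x i) (rcons (P i) (y (sigma i)))) /\
        forall v, \sum_i count_mem v (P i) = (v \in used A' :\: used A)
    & forall v, ch A' v <= maxn (ch A v) 1 + \sum_i ((x i == v) + (y i == v))
        + 10 * (v \in used A' :\: used A)].
Proof.
elim: t x y A => [|t IH] x y A gA h0 xA yA xy capA roomA.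
  have [|||A' [s [sA' gA' cA' sP [cov chA']]]] := @connect_family unit x y A gA h0.
  - by move=> j; split.
  - by move=> v; apply: leq_trans (capA v); rewrite leq_add2r /=; lia.
  - by apply: leq_trans roomA; rewrite card_unit mul1n.
  exists A'; rewrite /= mul1n; rewrite card_unit mul1n in cA'; split=> //; last first.
    move=> v; apply: leq_trans (chA' v) _.
    by apply: leq_add; [rewrite leq_add2r leq_maxl|rewrite leq_pmull].
  by move=> sigma; exists s; split=> // -[]; case: (sigma tt).
pose J := wires t.
have cJ : #|{: bool * (bool * J)}| = 2 * (2 * 2 ^ t) by rewrite !card_prod card_bool card_wires.
have d0 : 0 < d by have [v _] := room_inhabited roomA; have := capA v; lia.
have [|A1 [sA1 gA1 cA1 chA1]] := @new_roots A (2 * (2 * 2 ^ t)) gA d0.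
  apply: leq_trans roomA; rewrite leq_add2r -[X in X <= _]addn0 leq_add ?leq_add2l //.
  by rewrite expnS /=; clear; nia.
have cS : #|used A1 :\: used A| = #|{: bool * (bool * J)}|.
  by rewrite card_used_setD // cA1 addKn cJ.
(* Interface vertices: [r (false, (b, j))] lies between input switch [j] and subnetwork [b], and
   [r (true, (b, j))] between subnetwork [b] and output switch [j]. *)
have [r [rI rS rsum]] := set_param cS.
have rA1 i : r i \in used A1 by have := rS i; rewrite in_setD => /andP[].
pose X v := \sum_(i : bool * J) (x i == v); pose Y v := \sum_(i : bool * J) (y i == v).
pose U v := \sum_(i : bool * J) (r (false, i) == v); pose W v := \sum_(i : bool * J) (r (true, i) == v).
have UW v : U v + W v = (v \in used A1 :\: used A).
  have -> : (v \in used A1 :\: used A : nat) = \sum_g \sum_(i : bool * J) (r (g, i) == v).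
    by rewrite -rsum pair_bigA /=; apply: eq_bigr => -[].
  by rewrite big_bool addnC.
have pr (F : bool * J -> nat) : \sum_i F i = \sum_j \sum_b F (b, j).
  by rewrite exchange_big pair_bigA /=; apply: eq_bigr => -[].
have in1 := subsetP (usedS sA1).
have degXY v : \sum_(i : bool * J) ((x i == v) + (y i == v)) = X v + Y v by rewrite big_split.
have [||||A2 [Pin [sA2 gA2 cA2 PinP [covin chA2]]]] := @switch_family J
  (fun j b => x (b, j)) (fun j b => r (false, (b, j))) A1 gA1 h0.
- by move=> j b; apply: in1.
- by move=> j b.
- move=> v /=; have -> : \sum_j \sum_b ((x (b, j) == v) + (r (false, (b, j)) == v)) = X v + U v.
    by rewrite -(pr (fun i => (x i == v) + (r (false, i) == v))) big_split.
  have := capA v; rewrite degXY; have := chA1 v; have := UW v; have := used_split v sA1.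
  by case: (v \in used A1); case: (v \in used A) => //=; clear; lia.
- apply: leq_trans roomA; rewrite cA1 card_wires !leq_add2r -addnA leq_add2l /= expnS.
  by clear; nia.
have degin v : \sum_j \sum_b ((x (b, j) == v) + (r (false, (b, j)) == v)) = X v + U v.
  by rewrite -(pr (fun i => (x i == v) + (r (false, i) == v))) big_split.
have degout v : \sum_j \sum_b ((r (true, (b, j)) == v) + (y (b, j) == v)) = W v + Y v.
  by rewrite -(pr (fun i => (r (true, i) == v) + (y i == v))) big_split.
have in2 := subsetP (usedS sA2).
have [||||A3 [Pout [sA3 gA3 cA3 PoutP [covout chA3]]]] := @switch_family J
  (fun j b => r (true, (b, j))) (fun j b => y (b, j)) A2 gA2 h0.
- by move=> j b; apply: in2.
- by move=> j b; apply/in2/in1.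
- move=> v /=; rewrite degout.
  have := capA v; rewrite degXY; have := chA2 v; rewrite degin; have := chA1 v; have := UW v.
  have := used_split v sA1; have := used_split v sA2.
  by case: (v \in used A2); case: (v \in used A1); case: (v \in used A) => //=; clear; lia.
- apply: leq_trans roomA; rewrite cA2 cA1 card_wires !leq_add2r -!addnA leq_add2l /= expnS.
  by clear; nia.
have in3 := subsetP (usedS sA3).
have chA3' v : ch A3 v <= maxn (ch A v) 1 + (X v + U v + (W v + Y v))
    + 10 * (v \in used A3 :\: used A1).
  rewrite -(used_setD_chain sA2 sA3).
  have := chA3 v; rewrite degout; have := chA2 v; rewrite degin; have := chA1 v.
  by move: (X v) (Y v) (U v) (W v) => ? ? ? ?; clear; lia.
pose Ub b v := \sum_(j : J) (r (false, (b, j)) == v).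
pose Wb b v := \sum_(j : J) (r (true, (b, j)) == v).
have Ubs v : Ub false v + Ub true v = U v.
  by rewrite /U pr exchange_big big_bool addnC.
have Wbs v : Wb false v + Wb true v = W v.
  by rewrite /W pr exchange_big big_bool addnC.
have degb b v : \sum_j ((r (false, (b, j)) == v) + (r (true, (b, j)) == v)) = Ub b v + Wb b v.
  by rewrite big_split.
have rne b (i j : J) : r (false, (b, i)) != r (true, (b, j)).
  by rewrite (inj_eq rI).
have [|||||A4 [sA4 gA4 cA4 Pf chA4]] := IH (fun j => r (false, (false, j)))
  (fun j => r (true, (false, j))) A3 gA3 h0.
- by move=> j; apply/in3/in2.
- by move=> j; apply/in3/in2.
- exact: rne.
- move=> v /=; rewrite degb.
  have := capA v; rewrite degXY; have := chA3' v.
  have := UW v; have := used_split v (subset_trans sA2 sA3); have := used_split v sA1.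
  move: (Ubs v) (Wbs v).
  by case: (v \in used A3); case: (v \in used A1); case: (v \in used A) => //=; clear; lia.
- apply: leq_trans roomA; rewrite cA3 cA2 cA1 card_wires !leq_add2r -!addnA leq_add2l /= expnS.
  by clear; nia.
have in4 := subsetP (usedS sA4).
have chA4' v : ch A4 v <= maxn (ch A v) 1 + (X v + U v + (W v + Y v)) + (Ub false v + Wb false v)
    + 10 * (v \in used A4 :\: used A1).
  rewrite -(used_setD_chain (subset_trans sA2 sA3) sA4).
  have := chA4 v; rewrite degb; have := chA3' v.
  by move: (X v) (Y v) (U v) (W v) (Ub false v) (Wb false v) => ? ? ? ? ? ?; clear; lia.
have [|||||A5 [sA5 gA5 cA5 Pt chA5]] := IH (fun j => r (false, (true, j)))
  (fun j => r (true, (true, j))) A4 gA4 h0.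
- by move=> j; apply/in4/in3/in2.
- by move=> j; apply/in4/in3/in2.
- exact: rne.
- move=> v /=; rewrite degb.
  have := capA v; rewrite degXY; have := chA4' v.
  have := UW v; have := used_split v (subset_trans (subset_trans sA2 sA3) sA4).
  have := used_split v sA1; move: (Ubs v) (Wbs v).
  by case: (v \in used A4); case: (v \in used A1); case: (v \in used A) => //=; clear; lia.
- apply: leq_trans roomA; rewrite cA4 cA3 cA2 cA1 card_wires !leq_add2r -!addnA leq_add2l /= expnS.
  by clear; nia.
have sA15 := subset_trans sA2 (subset_trans sA3 (subset_trans sA4 sA5)).
exists A5; split=> //; first exact: subset_trans sA15.
- rewrite cA5 cA4 cA3 cA2 cA1 card_wires /= expnS.
  by clear; nia.
- move=> sigma; have [tin [tout [rho rhoP]]] := benes_routing sigma.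
  have [Qf [QfP covf]] := Pf (rho false); have [Qt [QtP covt]] := Pt (rho true).
  pose Q (b : bool) := if b then Qt else Qf.
  pose P (i : bool * J) := let b := i.1 (+) tin i.2 in let j := rho b i.2 in
    Pin i.2 (tin i.2) i.1 ++ r (false, (b, i.2)) :: Q b i.2 ++ r (true, (b, j)) ::
    Pout j (tout j) b.
  exists P; split=> [[b j]|v].
    have [s1 p1] := PinP j (tin j) b.
    set b' := b (+) tin j in p1; set j' := rho b' j.
    have [s3 p3] := PoutP j' (tout j') b'.
    have [s2 p2] : size (Q b' j) = permuter_size t /\
        path e (r (false, (b', j))) (rcons (Q b' j) (r (true, (b', j')))).
      by rewrite /j'; case: (b') => /=; [apply: QtP|apply: QfP].
    rewrite /P /= -/b' -/j'; split.
      by rewrite size_cat /= size_cat /= s1 s2 s3 /=; clear; lia.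
    rewrite rhoP -/b' -/j' rcons_cat cat_path /= rcons_cat cat_path /=.
    by move: p1 p2 p3; rewrite !rcons_path => /andP[-> ->] /andP[-> ->].
  (* [phi1] gives the position of a wire after the input switches and [phi2] moves it through its
     subnetwork. Both are injective, so sums over wires become sums over positions. *)
  pose phi1 (i : bool * J) := (i.1 (+) tin i.2, i.2).
  have phi1I : injective phi1 by move=> [b j] [b' j'] [+ ejj]; rewrite ejj => /addIb ->.
  pose phi2 (i : bool * J) := (i.1, rho i.1 i.2).
  have phi2I : injective phi2 by move=> [b j] [b' j'] [->] /perm_inj ->.
  rewrite -(used_setD_chain sA1 sA15) -UW -(used_setD_chain sA2 (subset_trans sA3 (subset_trans sA4 sA5))).
  rewrite -(used_setD_chain sA3 (subset_trans sA4 sA5)) -(used_setD_chain sA4 sA5).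
  rewrite -(covin tin) -(covout tout) -covf -covt.
  have -> : \sum_i count_mem v (P i) = \sum_(i : bool * J) count_mem v (Pin i.2 (tin i.2) i.1)
     + (\sum_(i : bool * J) (r (false, phi1 i) == v) + (\sum_i count_mem v (Q (phi1 i).1 (phi1 i).2)
     + (\sum_(i : bool * J) (r (true, phi2 (phi1 i)) == v)
     + \sum_i (fun k : bool * J => count_mem v (Pout k.2 (tout k.2) k.1)) (phi2 (phi1 i))))).
    rewrite -!big_split /=; apply: eq_bigr => i _.
    by rewrite count_cat /= count_cat.
  have re1 (F : bool * J -> nat) : \sum_i F (phi1 i) = \sum_i F i by rewrite [RHS](reindex_inj phi1I).
  have re2 (F : bool * J -> nat) : \sum_i F (phi2 i) = \sum_i F i by rewrite [RHS](reindex_inj phi2I).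
  rewrite (re1 (fun i => (r (false, i) == v) : nat)) -/(U v).
  rewrite (re1 (fun i => count_mem v (Q i.1 i.2))).
  rewrite (re1 (fun i => (r (true, phi2 i) == v) : nat)).
  rewrite (re2 (fun i => (r (true, i) == v) : nat)) -/(W v).
  rewrite (re1 (fun i => (fun k : bool * J => count_mem v (Pout k.2 (tout k.2) k.1)) (phi2 i))).
  rewrite (re2 (fun k => count_mem v (Pout k.2 (tout k.2) k.1))).
  rewrite !pr [\sum_j \sum_b count_mem v (Q (b, j).1 (b, j).2)]exchange_big big_bool /=.
  by move: (U v) (W v) => ? ?; clear; lia.
move=> v; apply: leq_trans (chA5 v) _; rewrite degXY degb -(used_setD_chain sA1 sA15).
rewrite -(used_setD_chain (subset_trans sA2 (subset_trans sA3 sA4)) sA5) -UW.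
move: (chA4' v) (Ubs v) (Wbs v).
by move: (X v) (Y v) (U v) (W v) (Ub _ v) (Ub _ v) (Wb _ v) (Wb _ v) => ? ? ? ? ? ? ? ?; clear; lia.
Qed.

(** * Linking through all remaining vertices *)

Lemma absorbingS (Q Q' : {set V}) : Q \subset Q' -> absorbing Q -> absorbing Q'.
Proof.
by move=> sQ aQ Y /aQ/leq_trans; apply; apply/subset_leq_card/setIS.
Qed.

(** Hall's condition for at most [m] vertices is that [Y] is absorbing. For a larger [U], the part
    [Z] of [Y] without neighbours in [U] has fewer than [m] vertices, and as [X] is absorbing, [Z]
    has at least [#|Z|] neighbours in [X :\: U]; so at least [#|U|] vertices of [Y] are outside
    [Z]. *)
Lemma match_layers (X Y : {set V}) : [disjoint X & Y] -> #|X| = #|Y| ->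
  absorbing X -> absorbing Y ->
  exists f : V -> V, {in X, forall x, f x \in Y /\ e x (f x)} /\ {in X &, injective f}.
Proof.
move=> dis cXY aX aY; have [v0 _|V0] := pickP V; last first.
  by exists id; split=> x; have := V0 x.
have nbI (U : {set V}) : nbhd (fun x => nb x :&: Y) U = nbhd (nb) U :&: Y.
  apply/setP => y; rewrite in_setI; apply/nbhdP/andP => [[x xU]|[/nbhdP[x xU xy] yY]].
    by rewrite in_setI => /andP[xy yY]; split=> //; apply/nbhdP; exists x.
  by exists x => //; rewrite in_setI xy.
have [|f [fN fI]] := hall (N := fun x => nb x :&: Y) (X := X) v0; last first.
  by exists f; split=> // x /fN; rewrite in_setI inE => /andP[].
move=> U sU; rewrite nbI; case: (leqP #|U| m) => [/aY//|mU].
set Z := Y :\: nbhd (nb) U.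
have nZ x z : x \in U -> z \in Z -> e x z = false.
  move=> xU; rewrite in_setD => /andP[zU _]; apply/negP => exz; case/negP: zU.
  by apply/nbhdP; exists x; rewrite ?inE.
have disUZ : [disjoint U & Z].
  rewrite disjoint_subset; apply/subsetP => x xU; apply/negP; rewrite in_setD => /andP[_ xY].
  by have := disjointFr dis (subsetP sU x xU); rewrite xY.
have Zm : #|Z| < m.
  rewrite ltnNge; apply/negP => mZ; have [x [y [xU yZ]]] := joined disUZ (ltnW mU) mZ.
  by rewrite (nZ x y).
have := aX Z (ltnW Zm); have sub : nbhd (nb) Z :&: X \subset X :\: U.
  apply/subsetP => x; rewrite in_setI in_setD => /andP[/nbhdP[z zZ]].
  rewrite inE e_sym => exz ->; rewrite andbT; apply/negP => xU.
  by rewrite (nZ x z) in exz.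
move/leq_trans/(_ (subset_leq_card sub)); rewrite cardsD (setIidPr sU).
have := cardsID (nbhd (nb) U) Y; rewrite -/Z setIC -cXY.
by have := subset_leq_card sU; clear; lia.
Qed.

Lemma layered_paths (J : finType) (L : nat -> {set V}) (u : J -> V) q : injective u ->
  (forall j, u j \in L 0) ->
  (forall i, i <= q -> #|L i| = #|J| /\ absorbing (L i)) ->
  (forall i, i < q -> [disjoint L i & L i.+1]) ->
  exists G : J -> seq V, [/\ forall j, size (G j) = q /\ path e (u j) (G j),
      injective (fun j => last (u j) (G j)), forall j, last (u j) (G j) \in L q
    & forall v, \sum_j count_mem v (G j) = \sum_(i < q) (v \in L i.+1)].
Proof.
move=> uI u0; elim: q => [|q IH] LP disL.
  by exists (fun=> [::]); split=> // v; rewrite big1 ?big_ord0.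
have [i iq|i iq|G [GP GI GL covG]] := IH.
- by apply: LP; apply: leqW.
- by apply: disL; apply: ltnW.
have [c1 a1] := LP q (leqnSn q); have [c2 a2] := LP q.+1 (leqnn _).
have [|f [fY fI]] := match_layers (disL q (leqnn _)) _ a1 a2; first by rewrite c1.
exists (fun j => rcons (G j) (f (last (u j) (G j)))).
have fG j := fY _ (GL j).
have I' : injective (fun j => f (last (u j) (G j))).
  by move=> i j /(fI _ _ (GL i) (GL j))/GI.
split=> [j|i j|j|v].
- by rewrite size_rcons rcons_path (GP j).1 (GP j).2 (fG j).2.
- by rewrite !last_rcons => /I'.
- by rewrite last_rcons (fG j).1.
rewrite big_ord_recr /= -covG -(@sum_injective_cover _ _ _ _ I' (fun j => (fG j).1) c2).
by rewrite -big_split; apply: eq_bigr => j _; rewrite -cats1 count_cat /= addn0.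
Qed.

Lemma absorbing_family A q t : good A -> (forall x, maxn (ch A x) 1 + t < d) -> 6 * m <= q ->
  #|A| + t * q + (d.*2 + 3) * m <= #|V| ->
  exists A' (Q : nat -> {set V}), [/\ A \subset A', good A', #|A'| = #|A| + t * q,
     forall i, i < t -> #|Q i| = q /\ absorbing (Q i)
   & (forall v, \sum_(i < t) (v \in Q i) = (v \in used A' :\: used A)) /\
     forall x, ch A' x <= maxn (ch A x) 1 + t].
Proof.
move=> gA + qm; elim: t => [|t IH] capA roomA.
  exists A, (fun=> set0); split; rewrite ?addn0 //.
  by split=> x; rewrite ?big_ord0 ?setDv ?inE // addn0 leq_maxl.
have [x||A1 [Q [sA1 gA1 cA1 QP [cov chA1]]]] := IH.
- by have := capA x; clear; lia.
- by apply: leq_trans roomA; rewrite leq_add2r leq_add2l leq_mul2r leqnSn orbT.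
have [x||A2 [sA2 gA2 cA2 aQ chA2]] := absorbing_extension gA1 _ qm.
- by have := capA x; have := chA1 x; clear; lia.
- by apply: leq_trans roomA; rewrite cA1 leq_add2r -addnA leq_add2l mulSn addnC.
exists A2, (fun i => if i == t then used A2 :\: used A1 else Q i); split.
- exact: subset_trans sA2.
- by [].
- by rewrite cA2 cA1 -addnA mulSn [q + _]addnC.
- move=> i; rewrite ltnS leq_eqVlt; case: eqP => [_ _|_ /= /QP//].
  by rewrite card_used_setD // cA2 addKn.
split=> x.
  rewrite big_ord_recr /= eqxx -(used_setD_chain sA1 sA2) -cov; congr (_ + _).
  by apply: eq_bigr => i _; rewrite ltn_eqF.
by have := chA2 x; have := chA1 x; clear; lia.
Qed.

Lemma set_split (U : {set V}) t k : #|U| = t * k ->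
  exists P : nat -> {set V}, (forall i, i < t -> #|P i| = k) /\
    forall v, \sum_(i < t) (v \in P i) = (v \in U).
Proof.
elim: t U => [|t IH] U cU.
  by exists (fun=> set0); split=> // v; rewrite big_ord0 (cards0_eq cU) inE.
have [|S sS cS] := @subset_of_card V U k; first by rewrite cU mulSn leq_addr.
have [|P [cP covP]] := IH (U :\: S); first by rewrite cardsD (setIidPr sS) cU cS mulSn addKn.
exists (fun i => if i == t then S else P i); split=> [i|v].
  by rewrite ltnS leq_eqVlt; case: eqP => //= _; apply: cP.
rewrite big_ord_recr /= eqxx (eq_bigr (fun i : 'I_t => (v \in P i) : nat)); last first.
  by move=> i _; rewrite ltn_eqF.
by rewrite covP in_setD; have := subsetP sS v; case: (v \in S) => [->|_] //=; rewrite addn0.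
Qed.

(* The wires are connected to a layer, then run through [s] further layers into
   which all remaining vertices are distributed; each layer contains an absorbing
   set, hence consecutive layers are matched by Hall's theorem.  The uncontrolled
   order in which the wires arrive is corrected by a permuter. *)
Lemma linkage t s (a b : wires t -> V) A : good A -> 0 < h ->
  (forall i, a i \in used A) -> (forall i, b i \in used A) ->
  (forall v, maxn (ch A v) 1 + \sum_i ((a i == v) + (b i == v)) + s + 20 + c <= d) ->
  6 * m <= 2 ^ t ->
  #|V| = #|A| + 2 ^ t * (h.*2 + 2 + s + permuter_size t) ->
  s * (6 * m) + h.*2 * m + (d.*2 + 3) * m <= s * 2 ^ t ->
  exists P : wires t -> seq V,
    (forall i, size (P i) = h.*2 + 2 + s + permuter_size t /\ path e (a i) (rcons (P i) (b i))) /\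
    forall v, \sum_i count_mem v (P i) = (v \notin used A).
Proof.
move=> gA h0 aA bA capA mN cV roomS.
set N := 2 ^ t in mN cV roomS *.
(* Everything that is grown before the final distribution. The middle layers so far contain only
   their absorbing parts of [6 * m] vertices; the [s * (N - 6 * m)] vertices that will fill them up
   are the free space for all constructions. *)
pose used_total := #|A| + N.*2 + s * (6 * m) + N * h.*2 + N * permuter_size t.
have rm k : k <= used_total -> k + h.*2 * m + (d.*2 + 3) * m <= #|V|.
  move=> hk; rewrite -addnA.
  apply: (@leq_trans (#|A| + N.*2 + s * N + N * h.*2 + N * permuter_size t)); last first.
    by rewrite cV; clear; nia.
  move: hk roomS; rewrite /used_total -addnA.
  move: (s * (6 * m)) (s * N) (N * h.*2) (N * permuter_size t) (h.*2 * m) ((d.*2 + 3) * m).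
  by clear; lia.
have rm' k : k <= used_total -> k + (d.*2 + 3) * m <= #|V|.
  by move/rm; apply: leq_trans; rewrite leq_add2r leq_addr.
have ch_lt v k : k <= s + 10 -> maxn (ch A v) 1 + k < d.
  by move=> ks; have := capA v; have := c_gt0; move: ks; clear; lia.
have [v||A1 [sA1 gA1 cA1 aW chA1]] := absorbing_extension gA _ mN.
- by have := ch_lt v 0 isT; rewrite addn0.
- by apply: rm'; rewrite /used_total; clear; lia.
have [v||A2 [sA2 gA2 cA2 aX chA2]] := absorbing_extension gA1 _ mN.
- by have := ch_lt v 2; have := chA1 v; clear; lia.
- by apply: rm'; rewrite cA1 /used_total; clear; lia.
have [v|//||A3 [Q [sA3 gA3 cA3 QP [covQ chA3]]]] := @absorbing_family A2 (6 * m) s gA2.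
- by have := ch_lt v (s + 3); have := chA1 v; have := chA2 v; clear; lia.
- by apply: rm'; rewrite cA2 cA1 /used_total; clear; lia.
have cI : #|{: wires t}| = N by rewrite card_wires.
have cW : #|used A1 :\: used A| = #|{: wires t}| by rewrite card_used_setD // cA1 addKn.
have cX : #|used A2 :\: used A1| = #|{: wires t}| by rewrite card_used_setD // cA2 addKn.
have [w [wI wW wsum]] := set_param cW; have [x [xI xX xsum]] := set_param cX.
have sA13 := subset_trans sA2 sA3; have sA03 := subset_trans sA1 sA13.
have in03 := subsetP (usedS sA03); have in13 := subsetP (usedS sA13).
have in23 := subsetP (usedS sA3).
have chA3' v : ch A3 v <= maxn (ch A v) 1 + s + 2.
  by have := chA1 v; have := chA2 v; have := chA3 v; clear; lia.
have wW1 i : w i \in used A1 /\ w i \notin used A by have := wW i; rewrite in_setD => /andP[].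
have xX2 i : x i \in used A2 /\ x i \notin used A1 by have := xX i; rewrite in_setD => /andP[].
have [i|v||A4 [p [sA4 gA4 cA4 pP [covp chA4]]]] := @connect_family (wires t) a w A3 gA3 h0.
- split; rewrite ?(in03 _ (aA i)) ?(in13 _ (wW1 i).1) //.
  by apply/eqP => eaw; have := (wW1 i).2; rewrite -eaw aA.
- have := capA v; rewrite !big_split /= wsum; have := chA3' v.
  by case: (v \in _); move: (\sum_i _) (\sum_i _) => ? ?; clear; lia.
- by apply: rm; rewrite cI cA3 cA2 cA1 /used_total; clear; lia.
have in4 := subsetP (usedS sA4).
have xnb i j : x i != b j.
  apply/eqP => exb; have [_] := xX2 i; rewrite exb => /negP[].
  by apply: (subsetP (usedS sA1)); apply: bA.
have [i|i|//|v||A5 [sA5 gA5 cA5 perP chA5]] := @permuter_extension t x b A4 gA4 h0.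
- by apply/in4/in23; exact: (xX2 i).1.
- by apply/in4/in03.
- have := leq_b1 (v \in used A4 :\: used A3); have := leq_b1 (v \notin used A4).
  have := leq_b1 (v \in used A1 :\: used A); have := leq_b1 (v \in used A2 :\: used A1).
  have := capA v; have := chA4 v; have := chA3' v; rewrite !big_split /= xsum wsum.
  move: (\sum_i (a i == v)) (\sum_i (b i == v)) => s1 s2.
  move: (nat_of_bool _) (nat_of_bool _) (nat_of_bool _) (nat_of_bool _) (ch A4 v).
  move: (ch A3 v) (ch A v) => n1 n2 n3 n4 n5 n6 n7; clear; lia.
- by apply: rm; rewrite cA4 cI cA3 cA2 cA1 -/N /used_total; clear; lia.
have used_total5 : #|A5| = used_total.
  by rewrite cA5 cA4 cI cA3 cA2 cA1 -/N /used_total; clear; lia.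
have [|U [cU covU]] := @set_split (~: used A5) s (N - 6 * m).
  have := cardsC (used A5); rewrite (card_used gA5) used_total5 /used_total cV mulnBr.
  have : s * (6 * m) <= s * N by rewrite leq_mul2l mN orbT.
  rewrite !mulnDr [N * s]mulnC.
  move: (N * permuter_size t) (s * (6 * m)) (s * N) (N * h.*2) #|~: used A5|.
  by clear; lia.
(* Layer [0] is where the wires arrive from [a], layers [1] to [s] are absorbing parts with their
   filling, and layer [s.+1] consists of the inputs of the permuter. *)
pose L i := if i == 0 then used A1 :\: used A
  else if i <= s then Q i.-1 :|: U i.-1 else used A2 :\: used A1.
have QU v i : i < s -> v \in Q i -> v \in U i = false.
  move=> iS vQ; apply/negP => vU.
  have vA3 : v \in used A3 :\: used A2.
    have := covQ v; rewrite (bigD1 (Ordinal iS)) //= vQ.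
    by case: (v \in _ :\: _).
  have : v \in ~: used A5.
    by have := covU v; rewrite (bigD1 (Ordinal iS)) //= vU; case: (v \in ~: _).
  rewrite inE; apply/negP; rewrite negbK; apply: (subsetP (usedS (subset_trans sA4 sA5))).
  by move: vA3; rewrite in_setD => /andP[].
have covL v : (v \notin used A : nat) = (v \in L 0) + \sum_(i < s.+1) (v \in L i.+1)
    + (v \in used A4 :\: used A3) + (v \in used A5 :\: used A4).
  have -> : \sum_(i < s.+1) (v \in L i.+1) = (v \in used A3 :\: used A2) + (v \in ~: used A5)
      + (v \in used A2 :\: used A1).
    rewrite big_ord_recr /= {2}/L /= ltnn -covQ -covU -big_split /=; congr (_ + _).
    apply: eq_bigr => i _; rewrite /L /= ltn_ord in_setU.
    by case: (boolP (v \in Q i)) => [/(QU _ _ (ltn_ord i))->|].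
  have -> : (v \notin used A : nat) = (v \in used A5 :\: used A) + (v \in ~: used A5).
    have := subsetP (usedS (subset_trans sA03 (subset_trans sA4 sA5))) v.
    by rewrite in_setD in_setC; case: (v \in used A) => [->|_] //; case: (v \in used A5).
  rewrite -(used_setD_chain sA1 (subset_trans sA13 (subset_trans sA4 sA5))).
  rewrite -(used_setD_chain sA2 (subset_trans sA3 (subset_trans sA4 sA5))).
  rewrite -(used_setD_chain sA3 (subset_trans sA4 sA5)) -(used_setD_chain sA4 sA5) /L /=.
  by clear; lia.
have Lle1 v : \sum_(i < s.+2) (v \in L i) <= 1.
  apply: leq_trans (leq_b1 (v \notin used A)); rewrite covL big_ord_recl /= -!addnA.
  by rewrite leq_add2l leq_addr.
have [i /= iS|i /= iS|G [GP GI GL covG]] := @layered_paths (wires t) L w s.+1 wI wW.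
- rewrite /L; case: eqP => [_|/eqP i0]; first by rewrite cW.
  case: leqP => [iS'|_]; last by rewrite cX.
  have iS2 : i.-1 < s by rewrite prednK // lt0n.
  have [cQ aQ] := QP _ iS2; split; last by apply: absorbingS (subsetUl _ _) aQ.
  have dQU : [disjoint Q i.-1 & U i.-1].
    rewrite disjoint_subset; apply/subsetP => v vQ; apply/negP => vU.
    by rewrite (QU v _ iS2 vQ) in vU.
  have := (leq_card_setU (Q i.-1) (U i.-1)).2; rewrite dQU cQ cU // => /eqP->.
  by rewrite subnKC.
- rewrite disjoint_subset; apply/subsetP => v vi; apply/negP => vi1; have := Lle1 v.
  rewrite (bigD1 (Ordinal (leqW iS))) //= vi (bigD1 (Ordinal (iS : i.+1 < s.+2))) /= ?vi1 //.
  by rewrite -val_eqE /= gtn_eqF.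
have lastx i : exists j, last (w i) (G i) == x j.
  have lx : last (w i) (G i) \in used A2 :\: used A1 by have := GL i; rewrite /L /= ltnn.
  have [/existsP//|] := boolP [exists j, last (w i) (G i) == x j].
  rewrite negb_exists => /forallP nx.
  by have := xsum (last (w i) (G i)); rewrite lx big1 // => j _; rewrite eq_sym (negPf (nx j)).
(* [pi i] is the input of the permuter at which wire [i] happens to arrive; the permuter will
   realise the inverse of [pi]. *)
have [pi piP] := fin_all_exists lastx.
have piI : injective pi by move=> i j eij; apply: GI; rewrite /= (eqP (piP i)) (eqP (piP j)) eij.
have [R [RP covR]] := perP (perm piI)^-1%g.
exists (fun i => p i ++ w i :: G i ++ R (pi i)); split=> [i|v].
  have [s1 p1] := pP i; have [s2 p2] := GP i; have [s3 p3] := RP (pi i).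
  split; first by rewrite size_cat /= size_cat s1 s2 s3; clear; lia.
  rewrite rcons_cat cat_path /= rcons_cat cat_path p2 (eqP (piP i)).
  by move: p1 p3; rewrite !rcons_path -(permE piI) permK => /andP[-> ->] /andP[-> ->].
rewrite covL -covG -covp -covR /L /= -wsum.
rewrite [X in _ = _ + X](reindex_inj piI) -!big_split /=; apply: eq_bigr => i _.
by rewrite count_cat /= count_cat; clear; lia.
Qed.

(** * Embedding trees *)

Variables (T : finType) (root : T) (par : T -> T) (dep : T -> nat) (Delta : nat).
Hypothesis dep_root : dep root = 0.
Hypothesis dep_par : forall v, v != root -> dep v = (dep (par v)).+1.
Local Notation kids := (kids root par).
Hypothesis kids_le : forall v, #|kids v| <= Delta.

(* [D] consists of the vertices already reserved as images of leaves; a path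
   found by [connect_pair] ended at each of them, which cost one child. *)
Record emb (D : {set V}) (X : {set T}) (phi : T -> V) A : Prop := Emb {
  emb_good : good A;
  emb_inj : {in X &, injective phi};
  emb_used : used A = phi @: X;
  emb_edge : forall v, v \in X -> v != root -> par v \in X -> e (phi (par v)) (phi v);
  emb_free : forall x, x \notin used A -> ch A x <= 1 + (x \in D);
  emb_ch : forall v, v \in X -> ch A (phi v) <= 3 + #|kids v :&: X| }.

Lemma emb_card D X phi A : emb D X phi A -> #|A| = #|X|.
Proof. by case=> gA injA uA _ _ _; rewrite -(card_used gA) uA card_in_imset. Qed.

Lemma par_neq v : v != root -> par v != v.
Proof. by move=> /dep_par dv; apply/eqP => pv; move: dv; rewrite pv; lia. Qed.

(** A vertex whose parent is not in [X] is embedded as a new root. This happens when the inner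
    vertices of bare paths are left out. *)
Lemma emb_step D X phi A v : emb D X phi A -> v \notin X ->
  (forall w, w \in X -> w != root -> par w != v) -> Delta + 3 < d ->
  #|X| + (d.*2 + 3) * m <= #|V| ->
  exists phi' A', [/\ emb D (v |: X) phi' A', A \subset A' & {in X, phi' =1 phi}].
Proof.
move=> E vX novk Dd roomX; have cA := emb_card E; case: E => gA injA uA eA fA chA.
have [s [y [yA gy sP]]] : exists s y, [/\ y \notin used A, good ((s, y) |: A) &
    if (v != root) && (par v \in X) then e s y /\ s = phi (par v) else ch A s = 0].
  have [/andP[vr pX]|_] := boolP (_ && _).
    have [||y [ey yA _ gy]] := @ext_step A (phi (par v)) set0 gA; first by rewrite cA.
      rewrite cards0 addn0; apply: leq_ltn_trans Dd; apply: leq_trans (chA _ pX) _.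
      by rewrite addnC leq_add2r; apply: leq_trans (kids_le (par v)); rewrite subset_leq_card ?subsetIl.
    by exists (phi (par v)), y.
  have [||[s y] /= [yA gy s0]] := @new_root A gA; first by apply: leq_ltn_trans Dd.
    by rewrite cA.
  by exists s, y.
have sy_new : (s, y) \notin A by apply: contra yA => /mem_used.
pose phi' w := if w == v then y else phi w.
have phiX : {in X, phi' =1 phi} by move=> w wX; rewrite /phi'; case: eqP wX => // ->; rewrite (negPf vX).
have phiv : phi' v = y by rewrite /phi' eqxx.
exists phi', ((s, y) |: A); split=> //; last exact: subsetUr.
have uA' : used ((s, y) |: A) = phi' @: (v |: X).
  by rewrite usedU1 /= imsetU1 phiv uA (eq_in_imset phiX).
have phiA w : w \in X -> phi w \in used A by move=> wX; rewrite uA imset_f.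
split=> //.
- move=> w1 w2; rewrite !in_setU1 => /orP[/eqP->|w1X] /orP[/eqP->|w2X] //; rewrite ?phiv ?phiX //.
  + by move=> ey; move: yA; rewrite ey phiA.
  + by move=> ey; move: yA; rewrite -ey phiA.
  exact: injA.
- move=> w; rewrite !in_setU1 => /orP[/eqP->|wX] wr.
    rewrite (negPf (par_neq wr)) /= => pX; move: sP; rewrite wr pX => -[esy es].
    by rewrite phiv phiX // -es.
  by rewrite (negPf (novk w wX wr)) /= => pX; rewrite !phiX // eA.
- move=> x; rewrite usedU1 in_setU1 negb_or => /andP[xy xA]; rewrite ch_addl //=.
  case: (s =P x) => [esx|_]; last by rewrite addn0 fA.
  move: sP xA; rewrite -esx; case: ifP => [/andP[_ pX] [_ ->]|_ ->]; last by rewrite leq_addr.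
  by rewrite phiA.
move=> w; rewrite in_setU1 => /orP[/eqP->|wX].
  rewrite phiv ch_addl //=; apply: (@leq_trans 3); last exact: leq_addr.
  by have := fA y yA; have := leq_b1 (y \in D); have := leq_b1 (s == y); clear; lia.
rewrite phiX // ch_addl //=.
have kS : #|kids w :&: X| <= #|kids w :&: (v |: X)|.
  by apply/subset_leq_card/setIS/subsetUr.
case: (s =P phi w) => [es|_]; last by rewrite addn0; apply: leq_trans (chA w wX) _; rewrite leq_add2l.
move: sP; case: ifP => [/andP[vr pX] [_ es']|_]; last by rewrite es => ->.
have -> : kids w :&: (v |: X) = v |: (kids w :&: X).
  rewrite setIUr; congr (_ :|: _); apply/setIidPr; rewrite sub1set.
  by rewrite inE vr; apply/eqP/injA; rewrite // -es' es.
rewrite cardsU1 in_setI (negPf vX) andbF /= addnCA addnC leq_add2l.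
exact: chA.
Qed.

Lemma emb_extend D X (X' : {set T}) phi A : emb D X phi A -> X \subset X' ->
  (forall w, w \in X -> w != root -> par w \in X' -> par w \in X) -> Delta + 3 < d ->
  #|X'| + (d.*2 + 3) * m <= #|V| ->
  exists phi' A', [/\ emb D X' phi' A', A \subset A' & {in X, phi' =1 phi}].
Proof.
move=> + + + Dd roomX; have [n] := ubnP #|X' :\: X|.
elim: n X phi A => // n IH X phi A; rewrite ltnS => cn E sX clX.
have [|/set0Pn[v0 v0P]] := boolP (X' :\: X == set0).
  rewrite setD_eq0 => sX'; exists phi, A; split=> //.
  by rewrite (_ : X' = X) //; apply/eqP; rewrite eqEsubset sX'.
case: (@arg_minnP _ v0 (mem (X' :\: X)) dep v0P) => v /setDP[vX' vX] minv.
have roomX1 : #|X| + (d.*2 + 3) * m <= #|V|.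
  by apply: leq_trans roomX; rewrite leq_add2r subset_leq_card.
have [|phi1 [A1 [E1 sA1 eq1]]] := emb_step E vX _ Dd roomX1.
  by move=> w wX wr; apply/eqP => pw; move: vX; rewrite -pw clX // pw.
have [||w|phi2 [A2 [E2 sA2 eq2]]] := IH (v |: X) phi1 A1 _ E1.
- apply: leq_trans cn; rewrite setDUr; apply: proper_card; apply/properP; split; first exact: subsetIr.
  by exists v; rewrite !inE ?vX ?vX' // eqxx.
- by rewrite subUset sub1set vX'.
- rewrite !in_setU1 => /orP[/eqP->|wX] wr pX'; last by rewrite clX ?orbT.
  apply/orP; right; have := contra (minv (par v)); rewrite /= -ltnNge (dep_par wr) => /(_ (ltnSn _)).
  by rewrite in_setD pX' andbT negbK.
exists phi2, A2; split=> //; first exact: subset_trans sA2.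
by move=> w wX; rewrite eq2 ?eq1 // in_setU1 wX orbT.
Qed.

Lemma emb_bundle D X phi A p u : emb D X phi A -> 0 < h ->
  (forall v, v \in X -> v != root -> par v \in X) ->
  h.*2 <= dep p -> iter h.*2 par p \in X -> (forall i, i < h.*2 -> iter i par p \notin X) ->
  u \notin used A -> u \notin D -> Delta + c + 4 <= d ->
  #|X| + h.*2 * m + (d.*2 + 3) * m <= #|V| ->
  exists phi' A', [/\ emb (u |: D) (X :|: [set v | [exists i : 'I_h.*2, iter i par p == v]]) phi' A',
    A \subset A', {in X, phi' =1 phi}, e (phi' p) u & u \notin used A'].
Proof.
move=> E h0 clX hp zX pX uA uD Dd roomX; have cA := emb_card E; case: E => gA injA uAE eA fA chA.
set z := iter h.*2 par p in zX; set Bn := [set v | _].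
have phiA w : w \in X -> phi w \in used A by move=> wX; rewrite uAE imset_f.
have h2 : 0 < h.*2 by rewrite double_gt0.
have [|||||||A' [s [sA' gA' cA' [us ss ps uA' [news chA']]]]] :=
  @connect_pair A (phi z) u [set u] gA h0.
- by apply: contra uA => /eqP<-; apply: phiA.
- by rewrite phiA.
- by rewrite inE eqxx orbT.
- rewrite cards1; apply: leq_trans Dd; have := chA z zX.
  have : #|kids z :&: X| <= Delta by apply: leq_trans (kids_le z); rewrite subset_leq_card ?subsetIl.
  by clear; lia.
- by rewrite cards1; apply: leq_trans Dd; have := fA u uA; rewrite (negPf uD); clear; lia.
- move=> x xA _; rewrite cards1; apply: leq_trans Dd; have := fA x xA.
  by have := leq_b1 (x \in D); clear; lia.
- by rewrite cA.
(* The path runs down from [phi z] whereas [i] counts upwards from [p], hence the reversed index. *)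
pose f i := nth u s (h.*2.-1 - i).
have fs i : i < h.*2 -> f i \in s by move=> ih; rewrite mem_nth // ss; move: ih; clear; lia.
have f_inj i j : i < h.*2 -> j < h.*2 -> f i = f j -> i = j.
  by move=> ih jh /eqP; rewrite nth_uniq ?ss //; move: ih jh; clear; lia.
have dp i : i < h.*2 -> dep p - dep (iter i par p) = i.
  move=> ih; have ip := leq_trans (ltnW ih) hp.
  by rewrite (dep_iter dep_root dep_par) // subKn.
pose phi' v := if v \in X then phi v else f (dep p - dep v).
have phiX : {in X, phi' =1 phi} by move=> w wX; rewrite /phi' wX.
have phif i : i < h.*2 -> phi' (iter i par p) = f i.
  by move=> ih; rewrite /phi' (negPf (pX i ih)) dp.
have BnP v : reflect (exists2 i, i < h.*2 & v = iter i par p) (v \in Bn).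
  rewrite inE; apply: (iffP existsP) => [[i /eqP<-]|[i ih ->]]; first by exists i.
  by exists (Ordinal ih).
have edge j : j < h.*2.+1 -> e (nth u (phi z :: rcons s u) j) (nth u (rcons s u) j).
  by move=> jh; have /(pathP u) := ps; apply; rewrite size_rcons ss.
have e0 : e (f 0) u.
  have := edge h.*2 (ltnSn _); rewrite [X in e _ X]nth_rcons ss ltnn eqxx.
  by rewrite -{1}(prednK h2) /= nth_rcons ss prednK // leqnn /f subn0.
have ef i : i.+1 < h.*2 -> e (f i.+1) (f i).
  move=> ih; have jh : h.*2.-1 - i < h.*2.+1 by move: ih; clear; lia.
  have := edge _ jh; rewrite [X in e _ X]nth_rcons ss.
  have -> : h.*2.-1 - i < h.*2 by move: ih; clear; lia.
  rewrite -/(f i); have -> : h.*2.-1 - i = (h.*2.-1 - i.+1).+1 by move: ih; clear; lia.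
  rewrite /= nth_rcons ss.
  by have -> : h.*2.-1 - i.+1 < h.*2 by move: ih; clear; lia.
have elast : e (phi z) (f h.*2.-1).
  by rewrite /f subnn; have /= := edge 0 isT; rewrite nth_rcons ss h2.
exists phi', A'; split=> //; last 2 first.
- by rewrite (phif 0 h2).
- by rewrite uA' in_setU negb_or uA inE; apply/negP => /news; rewrite inE eqxx andbF.
have uA'E : used A' = phi' @: (X :|: Bn).
  rewrite uA' uAE imsetU (eq_in_imset phiX); congr (_ :|: _); apply/setP => x; rewrite inE.
  apply/idP/imsetP => [xs|[v /BnP[i ih ->] ->]]; last by rewrite phif // fs.
  have ix : index x s < h.*2 by rewrite -ss index_mem.
  have jx : h.*2.-1 - index x s < h.*2 by move: ix; clear; lia.
  exists (iter (h.*2.-1 - index x s) par p); first by apply/BnP; exists (h.*2.-1 - index x s).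
  rewrite phif // /f (_ : h.*2.-1 - _ = index x s) ?nth_index //.
  by move: ix; clear; lia.
have f_new i : i < h.*2 -> (f i \notin used A) && (f i != u).
  by move/fs/news; rewrite inE.
have zkid : iter h.*2.-1 par p != root.
  by apply: (dep_gt0 dep_root); rewrite (dep_iter dep_root dep_par); move: hp h2; clear; lia.
split=> //.
- move=> v w; rewrite !in_setU => /orP[vX|/BnP[i ih ->]] /orP[wX|/BnP[j jh ->]].
  + by rewrite (phiX v vX) (phiX w wX); apply: injA.
  + by rewrite (phiX v vX) phif // => ev; have := f_new j jh; rewrite -ev phiA.
  + by rewrite (phiX w wX) phif // => ev; have := f_new i ih; rewrite ev phiA.
  by rewrite !phif // => /f_inj ->.
- move=> v; rewrite in_setU => /orP[vX|/BnP[i ih ->]] vr.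
    by move=> _; have pvX := clX v vX vr; rewrite (phiX v vX) (phiX _ pvX) eA.
  rewrite -iterS; case: (ltnP i.+1 h.*2) => [i1h _|h2i _]; first by rewrite !phif // ef.
  have -> : i = h.*2.-1 by move: ih h2i; clear; lia.
  by rewrite prednK // -/z phif ?ltn_predL // (phiX z zX).
- move=> x; rewrite uA' in_setU negb_or inE => /andP[xA xs].
  apply: leq_trans (chA' x) _; rewrite (negPf xs) addn0 in_setU1.
  have -> : x == phi z = false by apply/negP => /eqP ex; move: xA; rewrite ex phiA.
  rewrite addn0; have := fA x xA; case: eqP => [->|_] /=; last by clear; lia.
  by rewrite (negPf uD); clear; lia.
move=> v; rewrite in_setU => /orP[vX|/BnP[i ih ->]].
  rewrite (phiX v vX); apply: leq_trans (chA' _) _.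
  have -> : phi v == u = false by apply/negP => /eqP ev; move: uA; rewrite -ev phiA.
  have -> : phi v \in s = false.
    by apply/negP => /news; rewrite phiA.
  rewrite !addn0; case: eqP => [ev|_].
    have {ev}-> : v = z by apply: injA.
    have sub : iter h.*2.-1 par p |: (kids z :&: X) \subset kids z :&: (X :|: Bn).
      rewrite subUset setIS ?subsetUl // andbT sub1set in_setI inE zkid -iterS prednK // eqxx.
      by rewrite in_setU; apply/orP; right; apply/BnP; exists h.*2.-1; rewrite // ltn_predL.
    have := subset_leq_card sub; rewrite cardsU1 in_setI (negPf (pX _ _)) ?ltn_predL // andbF.
    by have := chA z zX; clear; lia.
  rewrite addn0; apply: leq_trans (chA v vX) _; rewrite leq_add2l.
  by apply/subset_leq_card/setIS/subsetUl.
rewrite phif //; apply: leq_trans (chA' _) _; have /andP[fA' fu] := f_new i ih.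
have -> : f i == phi z = false by apply/negP => /eqP ev; move: fA'; rewrite ev phiA.
rewrite (negPf fu) (fs i ih); have := fA _ fA'; have := leq_b1 (f i \in D).
by clear; lia.
Qed.

(** * Trees with many leaves *)

Local Notation leaves := (leaves root par).

Lemma root_not_leaf : 1 < #|T| -> root \notin leaves.
Proof.
move=> T1; have /card_gt0P[v0] : 0 < #|[set~ root]| by rewrite cardsC1; move: T1; clear; lia.
rewrite !inE => v0r; rewrite -cards_eq0 -lt0n; apply/card_gt0P.
case: (@arg_minnP _ v0 (fun v => v != root) dep v0r) => v vr minv.
exists v; have [e0|pr] := eqVneq (par v) root; first by have := mem_kids par vr; rewrite e0.
by have := minv _ pr; rewrite (dep_par vr) ltnn.
Qed.

Lemma par_not_leaf v : v != root -> par v \notin leaves.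
Proof.
by move=> vr; rewrite inE; apply/set0Pn; exists v; apply: mem_kids.
Qed.

Definition ancestors p : {set T} := [set v | [exists i : 'I_(dep p).+1, iter i par p == v]].

Lemma ancestorsP p v : reflect (exists2 i, i <= dep p & v = iter i par p) (v \in ancestors p).
Proof.
rewrite inE; apply: (iffP existsP) => [[i /eqP<-]|[i ip ->]]; first by exists (val i); rewrite // -ltnS ltn_ord.
by exists (Ordinal (ip : i < (dep p).+1)).
Qed.

Lemma ancestors_closed p v : v \in ancestors p -> v != root -> par v \in ancestors p.
Proof.
case/ancestorsP => i ip -> vr; apply/ancestorsP; exists i.+1 => //.
rewrite ltn_neqAle ip andbT; apply: contra vr => /eqP ei.
by apply/eqP/(dep_eq0 dep_par); rewrite (dep_iter dep_root dep_par) // ei subnn.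
Qed.

Lemma ancestors_not_leaf p v : p \notin leaves -> v \in ancestors p -> v \notin leaves.
Proof.
move=> pl /ancestorsP[[|i] ip ->] //=; apply: par_not_leaf.
by apply: (dep_gt0 dep_root); rewrite (dep_iter dep_root dep_par) ?subn_gt0 // ltnW.
Qed.

Definition par_closed (X : {set T}) := forall v, v \in X -> v != root -> par v \in X.

Lemma par_closed_iter X p i j : par_closed X -> iter i par p \in X -> i <= j -> j <= dep p ->
  iter j par p \in X.
Proof.
move=> clX iX; elim: j => [|j IH]; first by rewrite leqn0 => /eqP e0; rewrite e0 in iX.
rewrite leq_eqVlt => /orP[/eqP<-//|ij] jp; apply: clX; first by apply: IH (ltnW jp).
by apply: (dep_gt0 dep_root); rewrite (dep_iter dep_root dep_par) ?subn_gt0 // ltnW.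
Qed.

Section Bundles.
Variables (Tp : {set T}) (foot : T -> T).
Hypothesis h_gt0 : 0 < h.
Hypothesis footP : forall t, t \in Tp ->
  [/\ foot t \in par @: leaves, h.*2 <= dep (foot t) & iter h.*2.-1 par (foot t) = t].
Hypothesis Tp_class : forall t t', t \in Tp -> t' \in Tp -> dep t = dep t' %[mod h.*2].
Hypothesis root_nleaf : root \notin leaves.

(** Bundles lie entirely inside or entirely outside [X]: closure under parents gives one half of
    this, the last condition the other. *)
Definition bundled (X : {set T}) :=
  [/\ X \subset ~: leaves, par_closed X & forall t, t \in Tp -> t \in X -> foot t \in X].

Lemma leaf_neq_root v : v \in leaves -> v != root.
Proof. by apply: contraTneq => ->. Qed.

Lemma foot_not_leaf t : t \in Tp -> foot t \notin leaves.
Proof.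
by case/footP => /imsetP[v vl ->] _ _; apply/par_not_leaf/leaf_neq_root.
Qed.

(** Take a missing top of least depth. Another missing top among the ancestors of its foot is at
    least as deep, hence lies in the same bundle, where all depths are distinct modulo [h.*2]. So
    exactly one top is added. *)
Lemma bundled_step X t0 : bundled X -> t0 \in Tp -> t0 \notin X ->
  exists t, [/\ t \in Tp, t \notin X, bundled (X :|: ancestors (foot t)),
    Tp :\: (X :|: ancestors (foot t)) = (Tp :\: X) :\ t
    & forall i, i < h.*2 -> iter i par (foot t) \notin X].
Proof.
move=> [sX clX footX] t0p t0X; have t0P : t0 \in Tp :\: X by rewrite in_setD t0X.
case: (@arg_minnP _ t0 (mem (Tp :\: X)) dep t0P) => t /setDP[tp tX] mint.
have [fP fh ft] := footP tp; have h2 : 0 < h.*2 by rewrite double_gt0.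
have h1 : h.*2.-1 <= dep (foot t) by apply: leq_trans fh; apply: leq_pred.
have new_top v : v \in Tp -> v \in ancestors (foot t) -> v \notin X -> v = t.
  move=> vp /ancestorsP[i ip ev] vX.
  have dv : dep t <= dep v by apply: mint; rewrite /= in_setD vX.
  have et : dep t = dep (iter h.*2.-1 par (foot t)) by rewrite ft.
  have ih : i < h.*2.
    by move: dv; rewrite et ev !(dep_iter dep_root dep_par) //; move: ip h1 h2 fh; clear; lia.
  have := Tp_class vp tp; rewrite et ev => /(dep_iter_inj dep_root dep_par) ei.
  by rewrite ei ?ltn_predL.
exists t; split=> //.
- split.
  + rewrite subUset sX; apply/subsetP => v va; rewrite in_setC.
    by apply: ancestors_not_leaf va; apply: foot_not_leaf.
  + move=> v; rewrite !in_setU => /orP[vX|va] vr; first by rewrite clX.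
    by rewrite ancestors_closed ?orbT.
  move=> v vp; rewrite !in_setU; have [vX _|vX /= va] := boolP (v \in X); first by rewrite footX.
  by rewrite (new_top v vp va vX); apply/orP; right; apply/ancestorsP; exists 0.
- apply/setP => v; rewrite !inE negb_or.
  have [vp|] := boolP (v \in Tp); last by rewrite !andbF.
  have [vX|vX] := boolP (v \in X); rewrite ?andbF // !andbT /=.
  apply/idP/idP; last first.
    by move=> vt; apply/existsP => -[i /eqP ev]; case/eqP: vt; apply: new_top => //;
      apply/ancestorsP; exists (val i); rewrite // -ltnS ltn_ord.
  apply: contra => /eqP->; apply/existsP; exists (Ordinal (h1 : h.*2.-1 < (dep (foot t)).+1)).
  by rewrite /= ft.
move=> i ih; apply: contra tX => iX; rewrite -ft; apply: par_closed_iter iX _ h1 => //.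
by move: ih; clear; lia.
Qed.

Lemma bundled_prefix j : j <= #|Tp| -> exists2 X, bundled X & #|X :&: Tp| = j.
Proof.
elim: j => [_|j IH jT].
  exists set0; last by rewrite set0I cards0.
  by split=> [|v|t _]; rewrite ?sub0set ?inE.
have [X bX cX] := IH (ltnW jT).
have /set0Pn[t0 /setDP[t0p t0X]] : Tp :\: X != set0.
  by rewrite -cards_eq0 cardsD setIC cX; move: jT; clear; lia.
have [t [tp tX bX' eTp _]] := bundled_step bX t0p t0X.
exists (X :|: ancestors (foot t)) => //.
have := cardsID (X :|: ancestors (foot t)) Tp; have := cardsID X Tp.
rewrite eTp [Tp :&: X]setIC cX [Tp :&: _]setIC.
by have := cardsD1 t (Tp :\: X); rewrite in_setD tX tp /=; clear; lia.
Qed.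

(** The neighbours supplied by [g] avoid [Q], so that they can be added to those that the other
    vertices have in [Q]. *)
Definition covers (D Q : {set V}) (g : V -> V) (Y : {set V}) :=
  {in D &, injective g} /\ forall u, u \in D -> [/\ e (g u) u, g u \in Y & g u \notin Q].

Lemma par_closedU_ancestors X p : par_closed X -> par_closed (X :|: ancestors p).
Proof.
move=> clX v; rewrite !in_setU => /orP[vX|va] vr; first by rewrite clX.
by rewrite ancestors_closed ?orbT.
Qed.

(* Every bundle is used to place its foot next to a vertex of [B] that would
   otherwise stay uncovered. *)
Lemma cover_bad_set (B Q D : {set V}) X phi A g : emb D X phi A -> bundled X ->
  Q \subset phi @: X -> covers D Q g (phi @: (par @: leaves :&: X)) ->
  #|B :\: (D :|: used A)| <= #|Tp :\: X| -> Delta + c + 4 <= d ->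
  #|~: leaves| + h.*2 * m + (d.*2 + 3) * m <= #|V| ->
  exists X' phi' A' (D' : {set V}) g', [/\ emb D' X' phi' A', X' \subset ~: leaves, par_closed X',
    covers D' Q g' (phi' @: (par @: leaves :&: X'))
    & [/\ B \subset D' :|: used A', X \subset X' & {in X, phi' =1 phi}]].
Proof.
move=> + + + + + Dd roomL; have [n] := ubnP #|B :\: (D :|: used A)|.
elim: n D X phi A g => // n IH D X phi A g; rewrite ltnS => cn E bX QX cov cB.
have [sX clX _] := bX.
have [|neB] := eqVneq (B :\: (D :|: used A)) set0.
  move=> /eqP; rewrite setD_eq0 => BD.
  by exists X, phi, A, D, g; split.
have /set0Pn[t0 /setDP[t0p t0X]] : Tp :\: X != set0.
  by rewrite -card_gt0; apply: leq_trans cB; rewrite card_gt0.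
have [t [tp tX bX' eTp notX]] := bundled_step bX t0p t0X.
have [fP fh _] := footP tp; set p := foot t in bX' eTp notX fP fh *.
set z := iter h.*2 par p.
have dz : dep z = dep p - h.*2 by rewrite (dep_iter dep_root dep_par).
have clY := @par_closedU_ancestors X z clX; set Y := X :|: ancestors z in clY.
have zY : z \in Y by rewrite in_setU; apply/orP; right; apply/ancestorsP; exists 0.
have notY i : i < h.*2 -> iter i par p \notin Y.
  move=> ih; rewrite in_setU negb_or notX //=; apply/ancestorsP => -[j jz].
  have ip : i <= dep p by move: ih fh; clear; lia.
  have jz' : j <= dep p - h.*2 by rewrite -dz.
  move/(congr1 dep); rewrite !(dep_iter dep_root dep_par) //.
  by move: ih jz' fh; clear; lia.
have YBn : Y :|: [set v | [exists i : 'I_h.*2, iter i par p == v]] = X :|: ancestors p.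
  rewrite -setUA; congr (_ :|: _); apply/setP => v; rewrite in_setU.
  apply/orP/idP.
    case=> [/ancestorsP[k kz ->]|].
      apply/ancestorsP; exists (k + h.*2); rewrite ?iterD //.
      by move: kz fh; rewrite dz; clear; lia.
    rewrite inE => /existsP[k /eqP<-]; apply/ancestorsP; exists (val k) => //.
    by apply: leq_trans fh; apply/ltnW/ltn_ord.
  case/ancestorsP=> k kp ->; case: (ltnP k h.*2) => kh.
    by right; rewrite inE; apply/existsP; exists (Ordinal kh).
  left; apply/ancestorsP; exists (k - h.*2); first by move: kp; rewrite dz; clear; lia.
  by rewrite /z -iterD subnK.
have sX' : X :|: ancestors p \subset ~: leaves by case: bX'.
have sY : Y \subset ~: leaves by apply: subset_trans sX'; rewrite -YBn subsetUl.
have roomX (W : {set T}) k : W \subset ~: leaves -> k <= h.*2 * m ->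
    #|W| + k + (d.*2 + 3) * m <= #|V|.
  move=> sW km; apply: leq_trans roomL; rewrite leq_add2r leq_add //.
  exact: subset_leq_card.
have sXY : X \subset Y by rewrite subsetUl.
have [|||phi1 [A1 [E1 sA1 eq1]]] := emb_extend E sXY.
- by move=> w wX wr _; apply: clX.
- by apply: leq_trans Dd; have := c_gt0; clear; lia.
- by have := roomX Y 0 sY (leq0n _); rewrite addn0.
have phi1X (W : {set T}) : W \subset X -> phi1 @: W = phi @: W.
  by move=> sW; apply: eq_in_imset => w /(subsetP sW)/eq1.
have cov1 : covers D Q g (phi1 @: (par @: leaves :&: Y)).
  case: cov => gI gP; split=> // u /gP[? gu ?]; split=> //.
  rewrite -(phi1X (par @: leaves :&: X)) ?subsetIr // in gu.
  by apply: (subsetP _ _ gu); apply/imsetS/setIS.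
have [|neB1] := eqVneq (B :\: (D :|: used A1)) set0.
  move=> /eqP; rewrite setD_eq0 => BD.
  by exists Y, phi1, A1, D, g.
have /set0Pn[u /setDP[uB]] := neB1; rewrite in_setU negb_or => /andP[uD uA1].
have [|phi2 [A2 [E2 sA2 eq2 epu uA2]]] :=
  emb_bundle E1 h_gt0 clY fh zY notY uA1 uD Dd; first exact: roomX.
rewrite YBn in E2.
have eq2X : {in X, phi2 =1 phi}.
  by move=> w wX; rewrite eq2 ?eq1 //; apply: (subsetP sXY).
have pX' : p \in X :|: ancestors p.
  by rewrite in_setU; apply/orP; right; apply/ancestorsP; exists 0.
have phi2X (W : {set T}) : W \subset X -> phi2 @: W = phi @: W.
  by move=> sW; apply: eq_in_imset => w /(subsetP sW)/eq2X.
have p_new (W : {set T}) : W \subset X -> phi2 p \notin phi @: W.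
  move=> sW; rewrite -(phi2X W sW); apply/imsetP => -[w wW epw].
  have wX := subsetP sW w wW.
  have epw' : p = w by apply: (emb_inj E2) => //; rewrite in_setU wX.
  by have := notX 0; rewrite double_gt0 h_gt0 /= epw' wX => /(_ isT).
have [||||X3 [phi3 [A3 [D3 [g3 [E3 sX3 clX3 cov3 [BD3 sXX3 eq3]]]]]]] :=
  IH (u |: D) (X :|: ancestors p) phi2 A2 (fun v => if v == u then phi2 p else g v) _ E2 bX'.
- apply: leq_trans cn; apply: proper_card; apply/properP; split.
    by apply: setDS; rewrite setUSS ?subsetUr // usedS // (subset_trans sA1).
  exists u; last by rewrite !inE eqxx.
  rewrite in_setD uB andbT in_setU negb_or uD /=; apply: contra uA1.
  exact/subsetP/usedS.
- apply: subset_trans (imsetS _ (subsetUl X (ancestors p))); by rewrite phi2X.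
- case: cov => gI gP; split=> [v w|v].
    rewrite !in_setU1; case: (eqVneq v u) => [->|vu] /=; case: (eqVneq w u) => [->|wu] //=.
    + move=> _ /gP[_ gw _] ew; case/negP: (p_new _ (subsetIr (par @: leaves) X)).
      by rewrite ew.
    + move=> /gP[_ gw _] _ ew; case/negP: (p_new _ (subsetIr (par @: leaves) X)).
      by rewrite -ew.
    exact: gI.
  rewrite in_setU1; case: (eqVneq v u) => [-> _|vu /= /gP[egv gv gQ]].
    split=> //; first by apply: imset_f; rewrite in_setI fP.
    by apply: contra (p_new X (subxx _)); apply/subsetP.
  split=> //; rewrite -(phi2X (par @: leaves :&: X)) ?subsetIr // in gv.
  by apply: (subsetP _ _ gv); apply/imsetS/setIS/subsetUl.
- have : B :\: ((u |: D) :|: used A2) \proper B :\: (D :|: used A).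
    apply/properP; split; first by apply: setDS; rewrite setUSS ?subsetUr // usedS // (subset_trans sA1).
    exists u; last by rewrite !inE eqxx.
    rewrite in_setD uB andbT in_setU negb_or uD /=; apply: contra uA1.
    exact/subsetP/usedS.
  move/proper_card => lt1; have := leq_trans lt1 cB.
  by rewrite eTp (cardsD1 t (Tp :\: X)) in_setD tX tp.
exists X3, phi3, A3, D3, g3; split=> //; split=> //.
  by apply: subset_trans sXX3; apply: subsetUl.
by move=> w wX; rewrite eq3 ?eq2X // in_setU wX.
Qed.

End Bundles.

Lemma leq_card_par (S : {set T}) : S \subset [set~ root] -> #|S| <= Delta * #|par @: S|.
Proof.
move=> sS; rewrite mulnC -sum_nat_const.
apply: (@leq_trans (\sum_(p in par @: S) #|kids p|)); last by apply: leq_sum.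
apply: leq_trans (card_bigcup_leq _ _); apply/subset_leq_card/subsetP => v vS.
apply/bigcupP; exists (par v); first exact: imset_f.
by apply: mem_kids; have := subsetP sS v vS; rewrite !inE.
Qed.

Lemma emb_empty D phi : good set0 -> emb D set0 phi set0.
Proof.
move=> g0; have ch0 x : ch set0 x = 0 by apply: ch_card0 => a; rewrite inE.
split=> //; first by move=> v w; rewrite inE.
- by rewrite /used !imset0.
- by move=> v; rewrite inE.
- by move=> x _; rewrite ch0.
by move=> v; rewrite inE.
Qed.

Lemma embed_many_leaves : good set0 -> 0 < h -> 0 < Delta -> 1 < #|T| -> #|T| = #|V| ->
  Delta + c + 4 <= d -> Delta.*2 + 3 <= d ->
  Delta * (\sum_(j < h.*2) Delta ^ j + Delta ^ h.*2.-1 * (h.*2 * (6 * m))) <= #|leaves| ->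
  h.*2 * m + (d.*2 + 3) * m <= #|leaves| ->
  exists phi : T -> V, injective phi /\ forall v, v != root -> e (phi (par v)) (phi v).
Proof.
move=> good0 h0 D0 T1 cTV Dcd D2d bigL roomL.
have rl := root_not_leaf T1; have h2 : 0 < h.*2 by rewrite double_gt0.
have v0 : V by have /card_gt0P/sigW[] : 0 < #|V| by rewrite -cTV ltnW.
set P := par @: leaves.
have sL : leaves \subset [set~ root].
  by apply/subsetP => v vl; rewrite in_setC1; apply/eqP => ev; rewrite ev (negPf rl) in vl.
have cP : \sum_(j < h.*2) Delta ^ j + Delta ^ h.*2.-1 * (h.*2 * (6 * m)) <= #|P|.
  by have := leq_trans bigL (leq_card_par sL); rewrite leq_pmul2l.
have [Tp [foot [cTp footP Tp_class]]] := many_bundles dep_root dep_par kids_le h2 D0 cP.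
have cL : #|leaves| + #|~: leaves| = #|V| by rewrite cardsC.
have roomT : #|~: leaves| + h.*2 * m + (d.*2 + 3) * m <= #|V|.
  by rewrite -cL -addnA addnC leq_add2r.
have Dd : Delta + 3 < d by apply: leq_trans Dcd; have := c_gt0; clear; lia.
have room0 (W : {set T}) : W \subset ~: leaves -> #|W| + (d.*2 + 3) * m <= #|V|.
  move=> sW; apply: leq_trans roomT; rewrite leq_add2r.
  by apply: leq_trans (subset_leq_card sW) (leq_addr _ _).
have [|X1 bX1 cX1] := @bundled_prefix Tp foot h0 footP Tp_class rl (5 * m).
  by apply: leq_trans cTp; rewrite leq_mul2r orbT.
have [sX1 clX1 footX1] := bX1.
have [|||phi1 [A1 [E1 _ _]]] := emb_extend (emb_empty set0 (fun=> v0) good0) (sub0set X1).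
- by move=> w; rewrite inE.
- exact: Dd.
- exact: room0.
have foot_inj : {in Tp &, injective foot}.
  by move=> t t' /footP[_ _ ft] /footP[_ _ ft'] ef; rewrite -ft -ft' ef.
pose P1 := foot @: (X1 :&: Tp); pose Q1 := phi1 @: P1.
have sP1 : P1 \subset X1.
  by apply/subsetP => _ /imsetP[t /setIP[tX tp] ->]; apply: footX1.
have P1P : P1 \subset P by apply/subsetP => _ /imsetP[t /setIP[_ /footP[]] ? _ _ ->].
have cQ1 : #|Q1| = 5 * m.
  rewrite card_in_imset; last first.
    by move=> v w /(subsetP sP1) vX /(subsetP sP1) wX; apply: (emb_inj E1).
  by rewrite card_in_imset // => t t' /setIP[_ tp] /setIP[_ t'p]; apply: foot_inj.
have [|B Bm absB] := @maximal_bad_set Q1; first by rewrite cQ1.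
have [|||||X2 [phi2 [A2 [D2 [g [E2 sX2 clX2 [gI gP] [BD2 sX12 eq12]]]]]]] :=
  @cover_bad_set Tp foot h0 footP Tp_class rl B (used A1) set0 X1 phi1 A1 id E1 bX1.
- by rewrite (emb_used E1).
- by split=> u; rewrite inE.
- apply: leq_trans (subset_leq_card (subsetDl _ _)) _; apply: leq_trans (ltnW Bm) _.
  have := cardsID X1 Tp; rewrite setIC cX1; move: cTp; clear; lia.
- exact: Dcd.
- exact: roomT.
have [|||phi3 [A3 [E3 sA23 eq23]]] := emb_extend E2 sX2.
- by move=> w wX wr _; apply: clX2.
- exact: Dd.
- exact: room0.
have par_in l : l \in leaves -> par l \in ~: leaves.
  by move=> ll; rewrite in_setC; apply: par_not_leaf; have := subsetP sL l ll; rewrite !inE.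
have sPT : P \subset ~: leaves by apply/subsetP => _ /imsetP[l ll ->]; apply: par_in.
have phi3P (W : {set T}) : W \subset ~: leaves -> #|phi3 @: W| = #|W|.
  move=> sW; apply: card_in_imset => v w /(subsetP sW) vT /(subsetP sW) wT.
  exact: (emb_inj E3).
have phi3X1 (W : {set T}) : W \subset X1 -> phi3 @: W = phi1 @: W.
  move=> sW; apply: eq_in_imset => w /(subsetP sW) wX1.
  by rewrite eq23 ?eq12 //; apply: (subsetP sX12).
have phi3X2 (W : {set T}) : W \subset X2 -> phi3 @: W = phi2 @: W.
  by move=> sW; apply: eq_in_imset => w /(subsetP sW)/eq23.
have cU : #|~: used A3| = #|leaves|.
  have := cardsC (used A3); rewrite (emb_used E3) phi3P // -cL.
  by move: #|~: (phi3 @: _)| #|~: leaves|; clear; lia.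
pose N l := nb (phi3 (par l)) :\: used A3.
have nbN (W : {set T}) : nbhd N W = nbhd nb (phi3 @: (par @: W)) :\: used A3.
  apply/setP => y; rewrite in_setD; apply/nbhdP/andP => [[l lW]|[yA /nbhdP[x]]].
    rewrite in_setD => /andP[-> ly]; split=> //; apply/nbhdP; exists (phi3 (par l)) => //.
    by do 2!apply: imset_f.
  by case/imsetP => _ /imsetP[l lW ->] -> ly; exists l => //; rewrite in_setD yA.
have absU (Z : {set V}) : #|Z| <= m -> Z \subset ~: used A3 -> #|Z| <= #|nbhd nb Z :&: phi3 @: P|.
  move=> Zm sZ; pose Z1 := Z :&: B; pose Z2 := Z :\: B.
  have Z2m : #|Z2| <= m by apply: leq_trans Zm; rewrite subset_leq_card ?subsetDl.
  have dZ2 : [disjoint Z2 & B] by rewrite disjoint_subset; apply/subsetP => x /setDP[].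
  have Z1D : Z1 \subset D2.
    apply/subsetP => x /setIP[xZ xB]; have := subsetP BD2 x xB; rewrite in_setU => /orP[//|xA].
    by have := subsetP sZ x xZ; rewrite in_setC (subsetP (usedS sA23) x xA).
  rewrite -(cardsID B Z) -/Z1 -/Z2 addnC.
  have cZ1 : #|Z1| = #|g @: Z1|.
    by rewrite card_in_imset // => x y /(subsetP Z1D) xD /(subsetP Z1D) yD; apply: gI.
  rewrite cZ1; apply: leq_trans (leq_add (absB _ Z2m dZ2) (leqnn _)) _; rewrite -cardsUI.
  rewrite [X in _ + #|pred_of_set X|](_ : _ = set0) ?cards0 ?addn0; last first.
    apply/eqP; rewrite -subset0; apply/subsetP => y /setIP[/setIP[_ yQ] /imsetP[x xZ ey]].
    have [_ _] := gP x (subsetP Z1D x xZ); rewrite -ey (emb_used E1) => /negP[].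
    by apply: (subsetP _ _ yQ); apply: imsetS.
  apply/subset_leq_card; rewrite subUset; apply/andP; split.
    apply: setISS; first by apply: nbhdS; apply: subsetDl.
    by rewrite /Q1 -(phi3X1 _ sP1); apply: imsetS.
  apply/subsetP => _ /imsetP[x xZ1 ->]; have [egx gx _] := gP x (subsetP Z1D x xZ1).
  rewrite in_setI; apply/andP; split.
    by apply/nbhdP; exists x; [case/setIP: xZ1|rewrite inE e_sym].
  apply: (subsetP _ _ gx); rewrite -(phi3X2 _ (subsetIr _ _)); apply: imsetS; exact: subsetIl.
have [|f [fN fI]] := @hall T V N leaves v0; last first.
  pose phi v := if v \in leaves then f v else phi3 v.
  have phi3A v : v \notin leaves -> phi3 v \in used A3.
    by move=> vl; rewrite (emb_used E3) imset_f // in_setC.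
  have fA l : l \in leaves -> f l \notin used A3 by move=> /fN; rewrite in_setD => /andP[].
  exists phi; split=> [v w|v vr]; rewrite /phi.
    case: ifP => [vl|/negbT vl]; case: ifP => [wl|/negbT wl].
    - exact: fI.
    - by move=> ev; have := fA v vl; rewrite ev phi3A.
    - by move=> ev; have := fA w wl; rewrite -ev phi3A.
    by apply: (emb_inj E3); rewrite in_setC.
  rewrite (negPf (par_not_leaf vr)); case: ifP => [vl|/negbT vl].
    by have := fN v vl; rewrite !inE => /andP[].
  by apply: (emb_edge E3); rewrite // in_setC // par_not_leaf.
move=> W sW; rewrite nbN; set S := phi3 @: (par @: W).
have sW0 : par @: W \subset P by apply: imsetS.
have cS : #|S| = #|par @: W| by apply: phi3P; apply: subset_trans sPT.
have [S2m|mS] := leqP #|S| m.*2.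
  have := good_exp (emb_good E3) S2m; rewrite nbhd_setD; apply: leq_trans.
  apply: leq_trans (leq_card_par (subset_trans sW sL)) _; rewrite -cS mulnC -sum_nat_const.
  apply: leq_sum => x /imsetP[p pW ->].
  have pT : p \in ~: leaves by apply: (subsetP sPT); apply: (subsetP sW0).
  have := emb_ch E3 pT; have : #|kids p :&: ~: leaves| <= Delta.
    by apply: leq_trans (kids_le p); rewrite subset_leq_card ?subsetIl.
  by move: D2d; clear; lia.
set Z := ~: used A3 :\: nbhd nb S.
have Zm : #|Z| < m.
  rewrite ltnNge; apply/negP => mZ; have disSZ : [disjoint S & Z].
    rewrite disjoint_subset; apply/subsetP => x xS; apply/negP => /setDP[]; rewrite in_setC => /negP[].
    rewrite (emb_used E3); apply: (subsetP _ _ xS); apply: imsetS.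
    by apply: subset_trans sPT.
  have mS' : m <= #|S| by move: mS; clear; lia.
  have [x [y [xS /setDP[_ /negP yN] exy]]] := joined disSZ mS' mZ; case: yN.
  by apply/nbhdP; exists x; rewrite ?inE.
have := absU Z (ltnW Zm) (subsetDl _ _).
have sub : nbhd nb Z :&: phi3 @: P \subset phi3 @: (P :\: par @: W).
  apply/subsetP => y /setIP[/nbhdP[z zZ ez] /imsetP[p pP epp]].
  rewrite epp in ez *; apply: imset_f; rewrite in_setD pP andbT; apply/negP => pW.
  case/setDP: zZ => _ /negP[]; apply/nbhdP; exists (phi3 p); first exact: imset_f.
  by move: ez; rewrite !inE e_sym.
move/leq_trans/(_ (subset_leq_card sub))/leq_trans/(_ (leq_imset_card _ _)) => ZP.
have sub2 : P :\: par @: W \subset par @: (leaves :\: W).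
  apply/subsetP => p /setDP[/imsetP[l ll ->] lW]; apply: imset_f; rewrite in_setD ll andbT.
  by apply: contra lW; apply: imset_f.
have := leq_trans (subset_leq_card sub2) (leq_imset_card _ _).
have := cardsD leaves W; rewrite (setIidPr sW) => -> PL.
have := cardsID (nbhd nb S) (~: used A3); rewrite -/Z cU setIC -setDE.
have := subset_leq_card sW; move: PL ZP; clear; move: #|_ :\: used A3| #|Z|; lia.
Qed.

(** * Trees with few leaves *)

Lemma sum_injective_le1 (J U : finType) (r : J -> U) v : injective r -> \sum_j (r j == v) <= 1.
Proof.
move=> rI; have [/existsP[j0 /eqP<-]|] := boolP [exists j, r j == v].
  by rewrite (bigD1 j0) //= eqxx big1 // => j nj; rewrite (inj_eq rI) (negPf nj).
by rewrite negb_exists => /forallP nr; rewrite big1 // => j _; rewrite (negPf (nr j)).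
Qed.

(** All vertices except the [k.-2] inner ones of each of [2 ^ t] bare paths are embedded as a
    forest, and the linkage uses up exactly what remains. In the constant [25], three children come
    from [emb_ch], two from the ends of links and [20] from [linkage]. *)
Lemma embed_bare_paths k t s (Tp : {set T}) (bot : T -> T) : good set0 -> 0 < h -> #|T| = #|V| ->
  (forall w, w \in Tp -> k.-1 <= dep (bot w) /\ iter k.-1 par (bot w) = w) ->
  (forall w i, w \in Tp -> 0 < i < k -> #|kids (iter i par (bot w))| = 1) ->
  (forall w w' i i', w \in Tp -> w' \in Tp -> i < k -> i' < k ->
      iter i par (bot w) = iter i' par (bot w') -> w = w' /\ i = i') ->
  2 ^ t <= #|Tp| -> k = (h.*2 + 2 + s + permuter_size t).+2 -> 6 * m <= 2 ^ t ->
  s * (6 * m) + h.*2 * m + (d.*2 + 3) * m <= s * 2 ^ t ->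
  Delta + s + 25 + c <= d ->
  exists phi : T -> V, injective phi /\ forall v, v != root -> e (phi (par v)) (phi v).
Proof.
move=> good0 h0 cTV botP single disj NT ek mN roomS Dd.
have k3 : 2 < k by rewrite ek; clear; lia.
have [tau [tauI tauT]] : exists tau : wires t -> T, injective tau /\ forall i, tau i \in Tp.
  have [S sS cS] := subset_of_card NT; rewrite -card_wires in cS.
  by have [r [rI rS _]] := set_param cS; exists r; split=> // i; apply: (subsetP sS).
pose beta i := bot (tau i).
have disj' i i' j j' : j < k -> j' < k -> iter j par (beta i) = iter j' par (beta i') ->
    i = i' /\ j = j'.
  by move=> jk j'k /(disj _ _ _ _ (tauT i) (tauT i') jk j'k) [/tauI -> ->].
have /card_gt0P[i0 _] : 0 < #|wires t| by rewrite card_wires expn_gt0.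
have [v0 _|V0] := pickP V; last first.
  have : 0 < #|V| by rewrite -cTV; apply/card_gt0P; exists (tau i0).
  by rewrite (eq_card0 V0).
pose inner v (ij : wires t * 'I_k) := (0 < ij.2 < k.-1) && (iter ij.2 par (beta ij.1) == v).
pose F := [set v | [forall ij, ~~ inner v ij]].
have nF v : reflect (exists i j, 0 < j < k.-1 /\ v = iter j par (beta i)) (v \notin F).
  rewrite inE negb_forall; apply: (iffP existsP) => [[[i j]]|[i [j [jk ->]]]].
    by rewrite negbK => /andP[jk /eqP<-]; exists i, j.
  have jk' : j < k by move: jk k3; clear; lia.
  by exists (i, Ordinal jk'); rewrite negbK /inner /= jk eqxx.
have cF : #|V| = #|F| + 2 ^ t * k.-2.
  rewrite -cTV -(cardsC F); congr (_ + _).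
  pose g (ij : wires t * 'I_k.-2) := iter ij.2.+1 par (beta ij.1).
  have gI : injective g.
    move=> [i j] [i' j'] /= eg; have [||ei [ej]] := disj' i i' j.+1 j'.+1 _ _ eg.
    - by have := ltn_ord j; move: k3; clear; lia.
    - by have := ltn_ord j'; move: k3; clear; lia.
    by rewrite ei (ord_inj ej).
  rewrite -card_wires -[k.-2]card_ord -card_prod -cardsT -(card_imset _ gI).
  apply: eq_card => v; rewrite in_setC; apply/nF/imsetP => [[i [j [/andP[j0 jk] ->]]]|[[i j] _ ->]].
    have jk' : j.-1 < k.-2 by move: j0 jk; clear; lia.
    by exists (i, Ordinal jk') => //; rewrite /g /= -iterS prednK.
  by exists i, j.+1; split=> //; have := ltn_ord j; move: k3; clear; lia.
have tauF i : tau i \in F.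
  rewrite -[_ \in _]negbK; apply/nF => -[i' [j [jk e1]]].
  have [_ e2] := botP _ (tauT i); rewrite -{1}e2 -/(beta i) in e1.
  have [||_ ej] := disj' _ _ _ _ _ _ e1; try by move: jk k3; clear; lia.
  by move: jk; rewrite -ej ltnn andbF.
have betaF i : beta i \in F.
  rewrite -[_ \in _]negbK; apply/nF => -[i' [j [jk e1]]].
  have [||_ ej] := disj' i i' 0 j _ _ e1; try by move: jk k3; clear; lia.
  by move: jk; rewrite -ej.
have k2E : k.-2 = h.*2 + 2 + s + permuter_size t by rewrite ek.
have Dd' : Delta + 3 < d by apply: leq_trans Dd; have := c_gt0; clear; lia.
have [|||phi1 [A1 [E1 _ _]]] := emb_extend (emb_empty set0 (fun=> v0) good0) (sub0set F).
- by move=> w; rewrite inE.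
- exact: Dd'.
- rewrite cF leq_add2l; apply: leq_trans (leq_addl (s * (6 * m) + h.*2 * m) _) _.
  apply: leq_trans roomS _; rewrite mulnC leq_mul2l k2E; apply/orP; right.
  by clear; lia.
have cA1 := emb_card E1.
have in1 v : v \in F -> phi1 v \in used A1 by move=> vF; rewrite (emb_used E1) imset_f.
pose a i := phi1 (tau i); pose b i := phi1 (beta i).
have aI : injective a by move=> i j /(emb_inj E1 (tauF i) (tauF j))/tauI.
have bI : injective b.
  move=> i j /(emb_inj E1 (betaF i) (betaF j)) eb.
  by have [||-> _] := disj' i j 0 0 _ _ eb => //; apply: ltn_trans k3.
have [i|i|v||||P [PP covP]] := @linkage t s a b A1 (emb_good E1) h0.
- exact: in1.
- exact: in1.
- have chv : ch A1 v <= 3 + Delta.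
    have [|vA] := boolP (v \in used A1); last first.
      by apply: leq_trans (emb_free E1 vA) _; have := leq_b1 (v \in set0); clear; lia.
    rewrite (emb_used E1) => /imsetP[x xF ->]; apply: leq_trans (emb_ch E1 xF) _.
    by rewrite leq_add2l; apply: leq_trans (kids_le x); rewrite subset_leq_card ?subsetIl.
  rewrite big_split /=; have := sum_injective_le1 v aI; have := sum_injective_le1 v bI.
  by move: (\sum_i _) (\sum_i _) chv Dd; clear; lia.
- exact: mN.
- by rewrite cA1 cF k2E.
- exact: roomS.
pose pos v := [pick ij | inner v ij].
(* Links run from the top [tau i] to the bottom [beta i], whereas the height [ij.2] is counted from
   the bottom; hence the reversed index. *)
pose phi v := if pos v is Some ij then nth v0 (P ij.1) (k.-2 - ij.2) else phi1 v.
have phiI i j : 0 < j < k.-1 -> phi (iter j par (beta i)) = nth v0 (P i) (k.-2 - j).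
  move=> jk; have jk' : j < k by move: jk k3; clear; lia.
  rewrite /phi /pos; case: pickP => [[i' j'] /= /andP[_ /eqP e1]|/(_ (i, Ordinal jk'))].
    by have [||/= -> ->] := disj' _ _ _ _ _ _ e1.
  by rewrite /inner /= jk eqxx.
have phiF v : v \in F -> phi v = phi1 v.
  by rewrite inE /phi /pos => /forallP nv; case: pickP => // ij; rewrite (negPf (nv ij)).
have sP i : size (P i) = k.-2 by have [-> _] := PP i; rewrite k2E.
have cntP i x : count_mem x (P i) <= 1.
  have := covP x; rewrite (bigD1 i) //= => ec; apply: leq_trans (leq_b1 (x \notin used A1)).
  by rewrite -ec leq_addr.
have uP i : uniq (P i).
  apply: count_mem_uniq => x; have := cntP i x; have := has_pred1 x (P i); rewrite has_count.
  by case: (count_mem x (P i)) => [|[|]] // <-.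
have P_new i x : x \in P i -> x \notin used A1.
  move=> xP; have := covP x; rewrite (bigD1 i) //=; case: (x \notin used A1) => //.
  by rewrite count_uniq_mem // xP.
have P_disj i i' x : x \in P i -> x \in P i' -> i = i'.
  move=> xi xi'; apply/eqP; apply: contraT => ne; have := covP x.
  rewrite (bigD1 i) //= (bigD1 i') /=; last by rewrite eq_sym.
  by rewrite !count_uniq_mem // xi xi'; case: (x \notin used A1).
have memP i j : 0 < j < k.-1 -> nth v0 (P i) (k.-2 - j) \in P i.
  by move=> jk; rewrite mem_nth // sP; move: jk; clear; lia.
exists phi; split=> [v w|v vr].
  have [vF|/nF[i [j [jk ->]]]] := boolP (v \in F); have [wF|/nF[i' [j' [jk' ->]]]] := boolP (w \in F).
  - by rewrite !phiF //; apply: (emb_inj E1).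
  - rewrite phiF // phiI // => ev; have := P_new _ _ (memP i' j' jk').
    by rewrite -ev in1.
  - rewrite phiI // phiF // => ev; have := P_new _ _ (memP i j jk).
    by rewrite ev in1.
  rewrite !phiI // => ev; have eii : i = i'.
    by apply: (P_disj i i' (nth v0 (P i) (k.-2 - j))); [|rewrite ev]; apply: memP.
  move: ev; rewrite eii => /eqP; rewrite nth_uniq ?sP //; try by move: jk jk'; clear; lia.
  move=> ejj; have -> // : j = j' by move: ejj jk jk'; clear; lia.
have edge i p : p < k.-1 -> e (nth v0 (a i :: rcons (P i) (b i)) p) (nth v0 (rcons (P i) (b i)) p).
  move=> pk; have [_ /(pathP v0)] := PP i; apply; rewrite size_rcons sP.
  by move: pk k3; clear; lia.
have [vF|/nF[i [j [jk ev]]]] := boolP (v \in F); last first.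
  have -> : par v = iter j.+1 par (beta i) by rewrite ev.
  rewrite ev (phiI i j jk); have [jk2|jk2] := ltnP j.+1 k.-1.
    rewrite (phiI i j.+1) //; have p1 : k.-2 - j < k.-1 by move: jk k3; clear; lia.
    have := edge i _ p1; rewrite [X in e _ X]nth_rcons sP.
    have -> : k.-2 - j < k.-2 by move: jk jk2; clear; lia.
    have ep : k.-2 - j = (k.-2 - j.+1).+1 by move: jk jk2; clear; lia.
    rewrite {1}ep /= nth_rcons sP; have -> : k.-2 - j.+1 < k.-2 by move: jk jk2; clear; lia.
    by [].
  have ej : j.+1 = k.-1 by move: jk jk2; clear; lia.
  have et : iter j.+1 par (beta i) = tau i by rewrite ej; have [] := botP _ (tauT i).
  rewrite et phiF ?tauF //.
  have := edge i 0; rewrite nth_rcons sP /=.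
  have -> : 0 < k.-2 by move: k3; clear; lia.
  have -> : k.-2 - j = 0 by move: ej; clear; lia.
  by apply; move: k3; clear; lia.
have [pF|/nF[i [j [jk ep]]]] := boolP (par v \in F).
  by rewrite !phiF // (emb_edge E1).
have db : j <= dep (beta i).
  by have [db _] := botP _ (tauT i); apply: leq_trans db; move: jk; clear; lia.
have ejp : iter j par (beta i) = par (iter j.-1 par (beta i)).
  by rewrite -iterS prednK //; case/andP: jk.
have ev : v = iter j.-1 par (beta i).
  apply: (@single_kid_eq T root par) => //; last 2 first.
  - by rewrite ep.
  - by rewrite ep; apply: single => //; move: jk k3; clear; lia.
  apply: (dep_gt0 dep_root); rewrite (dep_iter dep_root dep_par); move: jk db; clear; lia.
have j1 : j = 1.
  apply/eqP; apply: contraTT vF => nj; apply/nF; exists i, j.-1; split=> //.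
  by move: jk nj; clear; lia.
rewrite ep phiI // (phiF v vF) ev j1 /=.
have p1 : k.-2 < k.-1 by move: k3; clear; lia.
have := edge i _ p1; rewrite [X in e _ X]nth_rcons sP ltnn eqxx.
have ek2 : k.-2 = (k.-2 - 1).+1 by move: k3; clear; lia.
rewrite {1}ek2 /= nth_rcons sP.
by have -> : k.-2 - 1 < k.-2 by move: k3; clear; lia.
Qed.

End Extendability.

(** * Universality of graphs with good expansion *)

Lemma permuter_sizeE h t : permuter_size h t = h.*2 + t * (8 * h ^ 2 + 16 * h + 6).
Proof.
elim: t => [|t IH] /=; first by rewrite addn0.
by rewrite IH /switch_size; nia.
Qed.

Section Universality.
Variables (V : finType) (e : rel V) (m D : nat).
Hypothesis e_sym : symmetric e.
Hypothesis m_gt0 : 0 < m.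
Hypothesis joined : forall X Y : {set V}, [disjoint X & Y] -> m <= #|X| -> m <= #|Y| ->
  exists x y, [/\ x \in X, y \in Y & e x y].
Hypothesis expanding : forall U : {set V}, #|U| <= m -> D * #|U| <= #|nbhd (nb e) U|.

(** The demand concerns sets of up to [m.*2] vertices, the expansion only those of up to [m];
    passing to a subset of [m] vertices costs the factor two. *)
Lemma good_set0 d : d.*2 <= D -> good e m d set0.
Proof.
move=> dD; split=> [a|a b|U U2m]; rewrite ?inE //.
have -> : \sum_(x in U) (d - ch set0 x) = #|U| * d.
  rewrite -sum_nat_const; apply: eq_bigr => x _.
  by rewrite ch_card0 ?subn0 // => a; rewrite inE.
rewrite nbhd_setD /used imset0 setD0.
have [Um|mU] := leqP #|U| m.
  apply: leq_trans (expanding Um); rewrite mulnC leq_mul2r.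
  by apply/orP; right; move: dD; clear; lia.
have [S sS cS] := subset_of_card (ltnW mU).
apply: leq_trans (subset_leq_card (nbhdS _ sS)); apply: leq_trans (expanding _); rewrite cS //.
apply: leq_trans (_ : m.*2 * d <= _); first by rewrite leq_mul2r U2m orbT.
by rewrite -doubleMl doubleMr mulnC leq_mul2r dD orbT.
Qed.

Variables (T : finType) (root : T) (par : T -> T) (dep : T -> nat) (Delta : nat).
Hypothesis dep_root : dep root = 0.
Hypothesis dep_par : forall v, v != root -> dep v = (dep (par v)).+1.
Hypothesis kids_le : forall v, #|kids root par v| <= Delta.

(** Here [k] is the length of the bare paths, chosen so large that the connecting paths and the
    permuter take at most half of it; the other half becomes the [s] filling layers. *)
Lemma embed_spanning_tree h k l d c : #|T| = #|V| -> 0 < h -> 0 < Delta -> 0 < c ->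
  #|V| < 2 ^ l -> 2 * (4 * h + 4 + l * (8 * h ^ 2 + 16 * h + 6)) <= k ->
  m <= c ^ h -> d.*2 <= D -> Delta.*2 + k + c + 25 <= d ->
  56 * k * h * m * Delta ^ h.*2 <= #|V| -> 4 * k * ((h.*2 + d.*2 + 3) * m) <= #|V| ->
  exists phi : T -> V, injective phi /\ forall v, v != root -> e (phi (par v)) (phi v).
Proof.
move=> cTV h0 D0 c0 nl kl mc dD Dd bigB bigR.
have g0 := good_set0 dD.
have k8 : 8 <= k by apply: leq_trans kl; clear; lia.
have Dh : 0 < Delta ^ h.*2 by rewrite expn_gt0 D0.
have nkm : 48 * k * m <= #|V|.
  apply: leq_trans bigB; rewrite -mulnA.
  apply: (@leq_trans (56 * k * h * m)); last by rewrite leq_pmulr.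
  by rewrite mulnA -[X in _ <= X]mulnA [h * m]mulnC mulnA; apply: leq_trans (leq_pmulr _ h0);
    rewrite leq_mul2r leq_mul2r orbT orbT.
have V2 : 1 < #|V|.
  by apply: leq_trans nkm; move: k8 m_gt0; clear; nia.
have [few|many] := leqP (4 * k * #|leaves root par|) #|T|.
  have k1 : 1 < k by apply: leq_trans k8.
  have [Tp [bot [cTp botP single disj]]] := many_bare_paths dep_root dep_par k1 few.
  pose q := #|V| %/ (2 * k); pose t := trunc_log 2 q.
  have k20 : 0 < 2 * k by move: k1; clear; lia.
  have q0 : 0 < q.
    by rewrite divn_gt0 //; apply: leq_trans nkm; move: k1 m_gt0; clear; nia.
  have tq : 2 ^ t <= q by apply: trunc_logP.
  have qt : q < 2 ^ t.+1 by apply: trunc_log_ltn.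
  have qTp : q <= #|Tp|.
    by rewrite -(leq_pmul2l k20); apply: leq_trans cTp; rewrite cTV mulnC leq_divM.
  have Vt : #|V| < 4 * k * 2 ^ t.
    have := ltn_ceil #|V| k20; rewrite -/q => /leq_trans; apply.
    have -> : 4 * k * 2 ^ t = 2 ^ t.+1 * (2 * k) by rewrite expnS; clear; lia.
    by rewrite leq_mul2r qt orbT.
  have tl : t <= l.
    rewrite -(@leq_exp2l 2) //; apply: leq_trans tq (leq_trans (leq_div _ _) (ltnW nl)).
  set sz := permuter_size h t; have szE : sz = h.*2 + t * (8 * h ^ 2 + 16 * h + 6).
    exact: permuter_sizeE.
  have szk : 2 * (h.*2 + 4 + sz) <= k.
    apply: leq_trans kl; rewrite szE.
    have : t * (8 * h ^ 2 + 16 * h + 6) <= l * (8 * h ^ 2 + 16 * h + 6) by rewrite leq_mul2r tl orbT.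
    by move: (t * _) (l * _); clear; lia.
  have [s ks] : exists s, k = (h.*2 + 2 + s + sz).+2.
    by exists (k - (h.*2 + 4 + sz)); move: szk; clear; lia.
  (* Twice what the absorbing parts need, so that half of each filling layer remains as free space;
     the constant [48] is [4 * 12]. *)
  have N12 : 12 * m <= 2 ^ t.
    have := leq_ltn_trans nkm Vt; move: k1 m_gt0; move: (2 ^ t); clear; nia.
  have ks2 : k <= 2 * s by move: szk; rewrite ks; clear; lia.
  apply: (embed_bare_paths e_sym m_gt0 joined c0 mc dep_root dep_par kids_le g0 h0 cTV
    botP single disj (leq_trans tq qTp) ks).
  - by apply: leq_trans N12; rewrite leq_mul2r orbT.
  - have : 16 * ((h.*2 + d.*2 + 3) * m) <= #|V|.
      by apply: leq_trans bigR; rewrite leq_mul2r; apply/orP; right; move: k8; clear; lia.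
    have -> : s * (6 * m) + h.*2 * m + (d.*2 + 3) * m = s * (6 * m) + (h.*2 + d.*2 + 3) * m.
      by rewrite -addnA -mulnDl addnA.
    move: ((h.*2 + d.*2 + 3) * m) => R hR.
    have : 4 * R <= k * 2 ^ t by have := leq_ltn_trans hR Vt; move: (2 ^ t); clear; nia.
    have : k * 2 ^ t <= 2 * s * 2 ^ t by rewrite leq_mul2r ks2 orbT.
    have : s * (12 * m) <= s * 2 ^ t by rewrite leq_mul2l N12 orbT.
    have -> : s * (12 * m) = 2 * (s * (6 * m)) by clear; lia.
    by rewrite -mulnA; move: (k * _) (s * (6 * m)) (s * 2 ^ t); clear; lia.
  by move: Dd ks2; rewrite {1}ks; clear; lia.
apply: (embed_many_leaves e_sym m_gt0 joined c0 mc dep_root dep_par kids_le g0 h0 D0 _ cTV).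
- by rewrite cTV.
- by move: Dd; clear; lia.
- by move: Dd; clear; lia.
- have sumD : \sum_(j < h.*2) Delta ^ j <= h.*2 * Delta ^ h.*2.-1.
    rewrite -[X in X * _]card_ord -sum_nat_const; apply: leq_sum => j _.
    by rewrite leq_pexp2l //; have := ltn_ord j; clear; lia.
  (* [14 * h * m] bounds [h.*2 * (1 + 6 * m)]; together with the [4 * k] from the number of leaves
     this is the constant [56]. *)
  apply: (@leq_trans (14 * h * m * Delta ^ h.*2)).
    have h2 : h.*2 = h.*2.-1.+1 by move: h0; clear; lia.
    rewrite [in X in _ <= X]h2 expnS [X in _ <= X]mulnCA leq_mul2l; apply/orP; right.
    apply: leq_trans (leq_add sumD (leqnn _)) _; rewrite [h.*2 * _]mulnC -mulnDr mulnC leq_mul2r.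
    by apply/orP; right; move: m_gt0; clear; nia.
  have k40 : 0 < 4 * k by move: k8; clear; lia.
  rewrite -(leq_pmul2l k40); apply: ltnW; apply: leq_ltn_trans many; rewrite cTV.
  by apply: leq_trans bigB; rewrite leq_eqVlt; apply/orP; left; apply/eqP; clear; lia.
have k40 : 0 < 4 * k by move: k8; clear; lia.
rewrite -(leq_pmul2l k40); apply: ltnW; apply: leq_ltn_trans many; rewrite cTV.
by apply: leq_trans bigR; rewrite -mulnDl addnA.
Qed.

End Universality.

(** * Rooting a tree *)

Section RootTree.
Variable T : sgraph.

Lemma reach_ex (root : T) : (forall v : T, connect (@adj T) root v) -> forall v : T,
  exists k, [exists p : k.-tuple T, path (@adj T) root p && (last root p == v)].
Proof.
move=> conn v; have /connectP[p pp lp] := conn v.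
by exists (size p); apply/existsP; exists (in_tuple p); rewrite /= pp -lp eqxx.
Qed.

(** Depth is the distance from [root] and a parent is any neighbour one step closer to it. If an
    edge does not join a vertex to its parent, all vertices still reach the root without it, so it
    closes a cycle. *)
Lemma tree_rooted : is_tree T -> exists (root : T) (par : T -> T) (dep : T -> nat),
  [/\ dep root = 0, forall v, v != root -> dep v = (dep (par v)).+1,
      forall v, v != root -> adj (par v) v
    & forall x y : T, adj x y -> (y != root) && (par y == x) || (x != root) && (par x == y)].
Proof.
case=> -[/card_gt0P[root _] conn] acyc.
have ex := reach_ex (conn root); pose dep v := ex_minn (ex v).
have depP v : exists p, [/\ path (@adj T) root p, last root p = v & size p = dep v].
  rewrite /dep; case: ex_minnP => k /existsP[p /andP[pp /eqP lp]] _.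
  by exists p; rewrite size_tuple.
have dep_min p : path (@adj T) root p -> dep (last root p) <= size p.
  move=> pp; rewrite /dep; case: ex_minnP => k _ -> //.
  by apply/existsP; exists (in_tuple p); rewrite pp eqxx.
have dep0 : dep root = 0 by apply/eqP; rewrite -leqn0; apply: (dep_min [::]).
have pred v : v != root -> exists u, adj u v && (dep v == (dep u).+1).
  have [p [pp lp sp]] := depP v => vr.
  case/lastP: p => [|p w] in pp lp sp; first by rewrite -lp eqxx in vr.
  move: pp lp sp; rewrite rcons_path last_rcons size_rcons => /andP[pp aw] ew sv; subst w.
  exists (last root p); rewrite aw /= eqn_leq.
  have [q [pq lq sq]] := depP (last root p).
  have H1 := dep_min (rcons q v); rewrite rcons_path pq lq aw last_rcons size_rcons sq in H1.
  have H2 := dep_min p pp; rewrite (H1 isT) -sv ltnS; exact: H2.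
pose par v := odflt v [pick u | adj u v && (dep v == (dep u).+1)].
have parP v : v != root -> adj (par v) v && (dep v == (dep (par v)).+1).
  move/pred => [u Hu]; rewrite /par; case: pickP => [w //|/(_ u)]; by rewrite Hu.
exists root, par, dep; split=> // [v /parP/andP[_ /eqP] //|v /parP/andP[] //|x y axy].
apply/negPn/negP; rewrite negb_or => /andP[nyx nxy].
pose e' : rel T := fun u v => adj u v && ~~ ((u == x) && (v == y) || (u == y) && (v == x)).
have e'sym : symmetric e'.
  by move=> u v; rewrite /e' adj_sym orbC (andbC (u == y)) (andbC (u == x)).
have up v : v != root -> e' (par v) v.
  move=> vr; have /andP[av _] := parP v vr; rewrite /e' av /=.
  apply/negP => /orP[]/andP[/eqP e1 /eqP e2].
    by move: nyx; rewrite -e2 vr e1 eqxx.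
  by move: nxy; rewrite -e2 vr e1 eqxx.
have toroot v : connect e' root v.
  have [k] := ubnP (dep v); elim: k v => // k IH v lk.
  case: (eqVneq v root) => [->|vr]; first exact: connect0.
  apply: connect_trans (connect1 (up v vr)); apply: IH.
  by have /andP[_ /eqP dv] := parP v vr; rewrite dv ltnS in lk.
have cxy : connect e' x y.
  by apply: connect_trans (toroot y); rewrite (sym_connect_sym e'sym) toroot.
case/connectP: cxy => p0 pp0 ey; case/shortenP: pp0 ey => p pp up' _ ey.
apply: (acyc (x :: p)).
  case: p pp ey {up'} => [|z [|z' p]] //= => [_ ey|]; first by rewrite -ey adj_irrefl in axy.
  by rewrite andbT => ez ey; move: ez; rewrite /e' -ey !eqxx andbF.
rewrite /ucycle up' andbT /= rcons_path -ey adj_sym axy andbT.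
by apply: sub_path pp => u v /andP[].
Qed.

End RootTree.

Lemma tree_universal_of_expanding (V : finType) (F : {set {set V}}) (m D Delta h k l d c : nat) :
  0 < m ->
  (forall X Y : {set V}, [disjoint X & Y] -> m <= #|X| -> m <= #|Y| ->
     exists x y, [/\ x \in X, y \in Y & [set x; y] \in F]) ->
  (forall X : {set V}, #|X| <= m ->
     D * #|X| <= #|nbhd (fun x => [set y | edge_rel F x y]) X|) ->
  0 < h -> 0 < Delta -> 0 < c -> #|V| < 2 ^ l ->
  2 * (4 * h + 4 + l * (8 * h ^ 2 + 16 * h + 6)) <= k -> m <= c ^ h -> d.*2 <= D ->
  Delta.*2 + k + c + 25 <= d -> 56 * k * h * m * Delta ^ h.*2 <= #|V| ->
  4 * k * ((h.*2 + d.*2 + 3) * m) <= #|V| ->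
  tree_universal #|V| Delta (graph_of_edges F).
Proof.
move=> m0 joined expanding h0 D0 c0 Vl kl mc dD dl nl1 nl2 T TV /tree_rooted[root [par [dep [d0 dS pa edge]]]] deg.
have kl' v : #|kids root par v| <= Delta.
  apply: leq_trans deg; apply: leq_trans (leq_bigmax v).
  apply/subset_leq_card/subsetP => w; rewrite !inE => /andP[wr /eqP <-]; exact: pa.
have [|phi [phi_inj phi_e]] := embed_spanning_tree (@edge_rel_sym _ F) m0 _ expanding d0 dS kl' TV h0 D0 c0 Vl kl mc dD dl nl1 nl2.
  move=> X Y XY mX mY; have [x [y [xX yY xy]]] := joined X Y XY mX mY.
  exists x, y; split=> //; rewrite /edge_rel xy andbT.
  by apply/eqP => exy; move/pred0P: XY => /(_ x) /=; rewrite xX exy yY.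
exists phi => // x y /edge/orP[]/andP[r /eqP <-]; first exact: phi_e.
by rewrite adj_sym; exact: phi_e.
Qed.

(** * The Maker-Breaker game *)

Section Histories.
Variables (X : finType) (V : {set X}).
Implicit Types (h : history X) (A : {set X}).

Lemma unclaimed_rcons h A : unclaimed V (rcons h A) = unclaimed V h :\: A.
Proof. by rewrite /unclaimed -cats1 big_cat big_seq1 setDDl. Qed.

Lemma maker_claimed_rcons h A :
  maker_claimed (rcons h A) = if odd (size h) then maker_claimed h else maker_claimed h :|: A.
Proof.
rewrite /maker_claimed size_rcons big_mkcond big_ord_recr /= nth_rcons ltnn eqxx.
have -> : \bigcup_(i < size h) (if ~~ odd i then nth set0 (rcons h A) i else set0) = maker_claimed h.
  by rewrite /maker_claimed [RHS]big_mkcond; apply: eq_bigr => i _; rewrite nth_rcons ltn_ord.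
by case: odd; rewrite ?setU0.
Qed.

Lemma size_play (sM sB : strategy X) k : size (play sM sB k) = k.
Proof. by elim: k => //= k IH; rewrite size_rcons IH. Qed.

Lemma unclaimed_play a b (sM sB : strategy X) k :
  0 < a -> 0 < b -> legal_strategy V a sM -> legal_strategy V b sB ->
  #|unclaimed V (play sM sB k)| <= #|V| - k.
Proof.
move=> a0 b0 lM lB; elim: k => [|k IH]; first by rewrite subn0 subset_leq_card ?subsetDl.
rewrite /= unclaimed_rcons; set h := play sM sB k in IH *.
set A := if _ then _ else _.
have [sA cA] : A \subset unclaimed V h /\ minn 1 #|unclaimed V h| <= #|A|.
  rewrite /A; case: ifP => _.
    by have [-> ->] := lB h; split=> //; move: b0; clear; lia.
  by have [-> ->] := lM h; split=> //; move: a0; clear; lia.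
rewrite cardsD (setIidPr sA); move: IH cA; clear; lia.
Qed.

End Histories.

Section Hitting.
Variables (X : finType) (V : {set X}) (b : nat) (I : finType) (P : pred I) (A : I -> {set X}).
Hypothesis b_gt0 : 0 < b.
Implicit Types (U W : {set X}).

(* The weight ((2b) / (2b + 1)) ^ #|U|, multiplied by (2b + 1) ^ #|V|. *)
Definition weight U := (2 * b).+1 ^ (#|V| - #|U|) * (2 * b) ^ #|U|.

(** With denominators cleared, [(1 + 1 / (2b)) ^ i <= 1 + i / b]. This linear bound on the effect of
    Breaker's turn is the reason for the base [1 + 1 / (2b)] instead of [1 + 1 / b]. *)
Lemma bernoulli_upper i : i <= b -> b * (2 * b).+1 ^ i <= (b + i) * (2 * b) ^ i.
Proof.
elim: i => [|i IH] ib; first by rewrite !expn0 addn0.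
have {}IH := IH (ltnW ib); rewrite !expnS.
apply: leq_trans (_ : (2 * b).+1 * ((b + i) * (2 * b) ^ i) <= _).
  by rewrite mulnCA leq_mul2l IH orbT.
rewrite !mulnA leq_mul2r; apply/orP; right; move: ib; clear; nia.
Qed.

Lemma weight_setD U W : U \subset V -> #|W| <= b ->
  b * weight (U :\: W) <= (b + #|U :&: W|) * weight U.
Proof.
move=> UV Wb; rewrite /weight cardsD; set i := #|U :&: W|.
have iU : i <= #|U| by apply/subset_leq_card/subsetIl.
have ib : i <= b by apply: leq_trans Wb; apply/subset_leq_card/subsetIr.
have Uv := subset_leq_card UV.
have -> : #|V| - (#|U| - i) = i + (#|V| - #|U|) by move: iU Uv; clear; lia.
have -> : (2 * b) ^ #|U| = (2 * b) ^ (#|U| - i) * (2 * b) ^ i by rewrite -expnD subnK.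
have := bernoulli_upper ib; rewrite expnD.
move: ((2 * b).+1 ^ i) ((2 * b) ^ i) => q t; move: ((2 * b) ^ _) (_ ^ (#|V| - #|U|)) => s r H.
have -> : b * (q * r * s) = b * q * (r * s) by rewrite !mulnA.
have -> : (b + i) * (r * (s * t)) = (b + i) * t * (r * s) by rewrite -!mulnA (mulnC t) !mulnA.
by rewrite leq_mul2r H orbT.
Qed.

Lemma weight0 : weight set0 = (2 * b).+1 ^ #|V|.
Proof. by rewrite /weight cards0 subn0 muln1. Qed.

Definition alive (h : history X) i := P i && [disjoint A i & maker_claimed h].

(* The Erdos-Selfridge potential. *)
Definition danger (h : history X) := \sum_(i | alive h i) weight (A i :&: unclaimed V h).

Definition degree h x := \sum_(i | alive h i && (x \in A i)) weight (A i :&: unclaimed V h).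

Definition hitter : strategy X := fun h =>
  if [pick x in unclaimed V h] is Some x0
  then [set [arg max_(x > x0 in unclaimed V h) degree h x]] else set0.

Variant hitter_spec h : {set X} -> Prop :=
| HitterNone : unclaimed V h = set0 -> hitter_spec h set0
| HitterSome x : x \in unclaimed V h ->
    (forall y, y \in unclaimed V h -> degree h y <= degree h x) -> hitter_spec h [set x].

Lemma hitterP h : hitter_spec h (hitter h).
Proof.
rewrite /hitter; case: pickP => [x0 x0U|U0].
  by case: arg_maxnP => // x xU xmax; constructor.
by constructor; apply/setP => x; rewrite U0 inE.
Qed.

Lemma legal_hitter : legal_strategy V 1 hitter.
Proof.
move=> h; case: hitterP => [->|x xU _]; first by rewrite sub0set cards0 minn0.
rewrite sub1set cards1; split=> //.
by have : 0 < #|unclaimed V h| by [apply/card_gt0P; exists x]; move: #|_|; clear; lia.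
Qed.

(** Maker's vertex [x] removes the weight [degree h x] of the surviving sets through it. Breaker's
    vertices add at most [1 / b] times the sum of their degrees; there are at most [b] of them, and
    no degree exceeds that of [x]. *)
Lemma danger_turn h (B : {set X}) : ~~ odd (size h) -> B \subset unclaimed V (rcons h (hitter h)) -> #|B| <= b ->
  danger (rcons (rcons h (hitter h)) B) <= danger h.
Proof.
move=> hev; case: hitterP => [U0|x xU xmax] BU Bb.
  rewrite unclaimed_rcons U0 set0D subset0 in BU; move/eqP: BU => ->.
  rewrite /danger /alive !maker_claimed_rcons !unclaimed_rcons size_rcons /= (negPf hev) U0 /=.
  by rewrite setU0 !set0D.
pose U := unclaimed V h; pose w i := weight (A i :&: U).
pose al i := alive h i && (x \notin A i).
have alE i : alive (rcons (rcons h [set x]) B) i = al i.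
  rewrite /al /alive !maker_claimed_rcons size_rcons /= (negPf hev) /= -andbA; congr andb.
  rewrite -!setI_eq0 setIUr setU_eq0; congr andb.
  by rewrite setI_eq0 disjoint_sym disjoints1.
rewrite -(leq_pmul2l b_gt0) /danger (eq_bigl _ _ alE) big_distrr /=.
apply: leq_trans (_ : \sum_(i | al i) (b + #|A i :&: B|) * w i <= _).
  apply: leq_sum => i /andP[_ xA]; rewrite !unclaimed_rcons setIDA setIDA.
  have -> : (A i :&: unclaimed V h) :\: [set x] = A i :&: U.
    apply/setDidPl; rewrite disjoint_sym disjoints1 inE; apply: contra xA; by case/andP.
  apply: leq_trans (weight_setD _ Bb) _.
    by apply: subset_trans (subsetIr _ _) _; apply: subsetDl.
  rewrite leq_mul2r leq_add2l; apply/orP; right; apply/subset_leq_card/setSI/subsetIl.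
rewrite [X in _ <= b * X](bigID (fun i => x \in A i)) /= mulnDr addnC.
under eq_bigr do rewrite mulnDl.
rewrite big_split /= -big_distrr /= leq_add2l.
apply: leq_trans (_ : \sum_(y in B) degree h y <= _).
  rewrite /degree; under [X in _ <= X]eq_bigr do rewrite big_mkcondr /=.
  rewrite exchange_big /= [X in X <= _]big_mkcondr /=.
  apply: leq_sum => i _; case: ifP => // _.
  rewrite -big_mkcondr sum_nat_const leq_mul2r; apply/orP; right.
  by rewrite subset_leq_card //; apply/subsetP => y; rewrite !inE andbC.
apply: leq_trans (_ : \sum_(y in B) degree h x <= _).
  apply: leq_sum => y yB; apply: xmax; move: (subsetP BU _ yB).
  by rewrite unclaimed_rcons !inE => /andP[].
by rewrite sum_nat_const leq_mul2r Bb orbT.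
Qed.

(** Once nothing is unclaimed, a set that was never hit has the full weight [(2 * b).+1 ^ #|V|],
    which the danger never reaches. *)
Lemma hitter_hits (sB : strategy X) :
  \sum_(i | P i) weight (A i :&: V) < (2 * b).+1 ^ #|V| ->
  legal_strategy V b sB ->
  exists k, unclaimed V (play hitter sB k) = set0 /\
    forall i, P i -> ~~ [disjoint A i & maker_claimed (play hitter sB k)].
Proof.
move=> init lB.
have inv k : danger (play hitter sB k.*2) < (2 * b).+1 ^ #|V|.
  elim: k => [|k IH].
    apply: leq_ltn_trans init; rewrite /danger /alive /maker_claimed /unclaimed /= !big_nil big_ord0 setD0.
    by under eq_bigl do rewrite -setI_eq0 setI0 eqxx andbT.
  rewrite doubleS /= odd_double /=; apply: leq_ltn_trans IH; apply: danger_turn.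
  - by rewrite size_play odd_double.
  - by have [] := lB (rcons (play hitter sB k.*2) (hitter (play hitter sB k.*2))).
  - have [_ ->] := lB (rcons (play hitter sB k.*2) (hitter (play hitter sB k.*2))).
    exact: geq_minl.
(* Enough turns to claim everything, and an even number of them because the invariant holds after
   Breaker's turns. *)
exists #|V|.*2.
have U0 : unclaimed V (play hitter sB #|V|.*2) = set0.
  apply/eqP; rewrite -cards_eq0 -leqn0.
  apply: leq_trans (unclaimed_play _ _ b_gt0 legal_hitter lB) _ => //.
  by rewrite -addnn; clear; lia.
split=> // i Pi; apply/negP => Ai; have := inv #|V|; rewrite ltnNge => /negP; apply.
rewrite /danger (bigD1 i) ?/alive ?Pi // U0 setI0 weight0; exact: leq_addr.
Qed.

End Hitting.

(** * Union bound over pairs of vertex sets *)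

Lemma bernoulli_lower p i : p ^ i * (p + i) <= p.+1 ^ i * p.
Proof.
elim: i => [|i IH]; first by rewrite !expn0 addn0.
rewrite !expnS; apply: leq_trans (_ : p.+1 * (p ^ i * (p + i)) <= _).
  rewrite -mulnA mulnCA [X in _ <= X]mulnCA leq_mul2l; apply/orP; right.
  by clear; nia.
by rewrite -mulnA leq_mul2l IH orbT.
Qed.

(** By Bernoulli's inequality [(1 + 1 / (2b)) ^ (2b) >= 2], so every [2 * b] elements halve the
    weight. *)
Lemma weight_small (X : finType) (V U : {set X}) b s : 0 < b -> U \subset V -> 2 * b * s <= #|U| ->
  2 ^ s * weight V b U <= (2 * b).+1 ^ #|V|.
Proof.
move=> b0 UV sU; rewrite /weight; set p := 2 * b.
have p0 : 0 < p by rewrite muln_gt0.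
have H : 2 * p ^ p <= p.+1 ^ p.
  by have := bernoulli_lower p p; rewrite addnn -mul2n mulnCA mulnA leq_pmul2r.
have Hs : 2 ^ s * p ^ (p * s) <= p.+1 ^ (p * s).
  by rewrite (expnM p p) (expnM p.+1 p) -expnMn; case: s {sU} => // s; rewrite leq_exp2r.
have Uv := subset_leq_card UV.
have -> : p ^ #|U| = p ^ (p * s) * p ^ (#|U| - p * s) by rewrite -expnD subnKC.
have -> : p.+1 ^ #|V| = p.+1 ^ (#|V| - #|U|) * (p.+1 ^ (p * s) * p.+1 ^ (#|U| - p * s)).
  by rewrite -!expnD (subnKC sU) subnK.
rewrite mulnCA leq_mul2l mulnA; apply/orP; right; apply: leq_mul => //.
by case: (_ - _) => // i; rewrite leq_exp2r.
Qed.

Lemma binomial_leq_exp n k : 'C(n, k) <= n ^ k.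
Proof.
apply: leq_trans (_ : n ^_ k <= _); first by rewrite -bin_ffact leq_pmulr ?fact_gt0.
by elim: k => [|k IH]; rewrite ?ffactn0 // ffactnSr expnSr leq_mul // leq_subr.
Qed.

(** A scaled sum of [2 ^ - (l * #|X|)]: there are at most [#|V| ^ k] sets of size [k], so each of
    the [#|V| + 1] sizes contributes at most one. *)
Lemma sum_sets (V : finType) l : #|V| < 2 ^ l ->
  \sum_(X : {set V}) 2 ^ (l * (#|V| - #|X|)) <= 2 ^ l * 2 ^ (l * #|V|).
Proof.
move=> Vl; rewrite (partition_big (fun X : {set V} => inord #|X| : 'I_#|V|.+1) predT) //=.
apply: leq_trans (_ : \sum_(k < #|V|.+1) 2 ^ (l * #|V|) <= _); last first.
  by rewrite sum_nat_const card_ord leq_mul2r Vl orbT.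
apply: leq_sum => k _.
have kE (X : {set V}) : (inord #|X| == k) = (#|X| == k).
  by rewrite -val_eqE /= inordK // ltnS max_card.
rewrite (eq_bigl _ _ kE).
apply: leq_trans (_ : \sum_(X : {set V} | #|X| == k) 2 ^ (l * (#|V| - k)) <= _).
  by apply: leq_sum => X /eqP ->.
rewrite sum_nat_cond_const card_draws.
apply: leq_trans (_ : (2 ^ l) ^ k * 2 ^ (l * (#|V| - k)) <= _); last first.
  by rewrite -expnM -expnD -mulnDr subnKC // -ltnS.
rewrite leq_mul2r; apply/orP; right; apply: leq_trans (binomial_leq_exp _ _) _.
case: (k : nat) => // k'; rewrite leq_exp2r //; exact: ltnW.
Qed.

(** In the summand [3], two units pay for the sums over the two sets, each bounded by [sum_sets],
    and the third pays for [J]. *)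
Lemma union_bound (V J : finType) (P : pred (J * ({set V} * {set V}))) (w : J * ({set V} * {set V}) -> nat) l B :
  #|V| < 2 ^ l -> #|J| < 2 ^ l -> 0 < B ->
  (forall i, P i -> 2 ^ (l * (#|i.2.1| + #|i.2.2| + 3)) * w i <= B) ->
  \sum_(i | P i) w i < B.
Proof.
move=> Vl Jl B0 wB; set n := #|V|.
rewrite -(@ltn_pmul2l (2 ^ (l * (2 * n + 3)))) ?expn_gt0 // big_distrr /=.
apply: leq_ltn_trans (_ : \sum_(i : J * ({set V} * {set V})) (2 ^ (l * (n - #|i.2.1|)) * 2 ^ (l * (n - #|i.2.2|)) * B) < _).
  rewrite big_mkcond /=; apply: leq_sum => i _; case: ifP => // /wB H.
  apply: leq_trans (_ : 2 ^ (l * (n - #|i.2.1|)) * 2 ^ (l * (n - #|i.2.2|)) *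
     (2 ^ (l * (#|i.2.1| + #|i.2.2| + 3)) * w i) <= _); last by rewrite leq_mul2l H orbT.
  rewrite mulnA -!expnD -!mulnDr leq_mul2r leq_exp2l // leq_mul2l.
  apply/orP; right; apply/orP; right.
  have := max_card i.2.1; have := max_card i.2.2; rewrite -/n; clear; lia.
rewrite -big_distrl /= ltn_mul2r B0 /=.
have -> : \sum_(i : J * ({set V} * {set V})) (2 ^ (l * (n - #|i.2.1|)) * 2 ^ (l * (n - #|i.2.2|))) =
   #|J| * ((\sum_(X : {set V}) 2 ^ (l * (n - #|X|))) * \sum_(X : {set V}) 2 ^ (l * (n - #|X|))).
  rewrite -(pair_bigA _ (fun (j : J) (p : {set V} * {set V}) => 2 ^ (l * (n - #|p.1|)) * 2 ^ (l * (n - #|p.2|)))) /=.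
  rewrite sum_nat_const -(pair_bigA _ (fun X Y : {set V} => 2 ^ (l * (n - #|X|)) * 2 ^ (l * (n - #|Y|)))) /=.
  by rewrite big_distrlr.
apply: leq_ltn_trans (_ : #|J| * ((2 ^ l * 2 ^ (l * n)) * (2 ^ l * 2 ^ (l * n))) < _).
  by rewrite leq_mul2l leq_mul ?sum_sets // orbT.
have -> : 2 ^ (l * (2 * n + 3)) = 2 ^ l * (2 ^ l * 2 ^ (l * n) * (2 ^ l * 2 ^ (l * n))).
  rewrite -!expnD; congr (_ ^ _); clear; lia.
by rewrite ltn_mul2r !muln_gt0 !expn_gt0.
Qed.

(** * Maker obtains an expanding graph *)

Section EdgesBetween.
Variable G : sgraph.
Implicit Types X Y Z : {set G}.

Definition edges_between X Y : {set {set G}} := [set [set x; y] | x in X, y in Y & adj x y].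

Lemma edges_between_sub X Y : edges_between X Y \subset edges G.
Proof.
apply/subsetP => E /imset2P[x y xX + ->]; rewrite inE => /andP[yY xy].
by apply/imset2P; exists x y; rewrite ?inE.
Qed.

Lemma card_edges_between X Y : [disjoint X & Y] ->
  #|edges_between X Y| = \sum_(x in X) #|neighbors x :&: Y|.
Proof.
move=> XY; pose Q := [set p : G * G | (p.1 \in X) && (p.2 \in neighbors p.1 :&: Y)].
have -> : edges_between X Y = [set [set p.1; p.2] | p in Q].
  apply/setP => E; apply/imset2P/imsetP => [[x y xX]|[[x y]]].
    by rewrite inE => /andP[yY xy] ->; exists (x, y); rewrite // !inE xX xy.
  by rewrite !inE /= => /and3P[xX xy yY] ->; exists x y; rewrite ?inE ?yY.
rewrite card_in_imset.
  rewrite -sum1_card (eq_bigl _ _ (in_set _)) /=.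
  rewrite -(pair_big_dep (mem X) (fun x y => y \in neighbors x :&: Y) (fun _ _ => 1)) /=.
  by apply: eq_bigr => x _; rewrite sum1_card.
have XYF z : z \in X -> z \in Y -> False by move=> zX zY; move/pred0P: XY => /(_ z) /=; rewrite zX zY.
move=> [x y] [x' y']; rewrite !inE /= => /and3P[xX xy yY] /and3P[x'X x'y' y'Y] E.
have /set2P[ex|ex] : x \in [set x'; y'] by rewrite -E set21.
  have /set2P[ey|ey] : y \in [set x'; y'] by rewrite -E set22.
    by case: (XYF y) => //; rewrite ey.
  by rewrite ex ey.
by case: (XYF x) => //; rewrite ex.
Qed.

Lemma edges_between_nbhd X Y : [disjoint X & Y] ->
  #|nbhd (@neighbors G) X :&: Y| <= #|edges_between X Y|.
Proof.
move=> XY; rewrite card_edges_between // /nbhd big_distrl /=.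
elim/big_ind2: _ => [|A a B c Aa Bc|//]; first by rewrite cards0.
by apply: leq_trans (leq_add Aa Bc); rewrite (leq_card_setU a c).1.
Qed.

(** Counting neighbours of [X] alone gives at most [#|Y|] edges; cutting [X] into pieces of [q]
    vertices multiplies the bound by the number of pieces. *)
Lemma edges_between_chunks q r X Y : [disjoint X & Y] -> 0 < q ->
  (forall S : {set G}, S \subset X -> #|S| = q -> r <= #|nbhd (@neighbors G) S :&: Y|) ->
  #|X| %/ q * r <= #|edges_between X Y|.
Proof.
move=> + q0; move: {2}(#|X| %/ q) (leqnn (#|X| %/ q)) => t.
elim: t X => [|t IH] X tX XY H; first by move: tX; rewrite leqn0 => /eqP ->.
have [Xq|qX] := ltnP #|X| q; first by rewrite divn_small.
have [S SX cS] := subset_of_card qX.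
have cD : #|X :\: S| = #|X| - q by rewrite cardsD (setIidPr SX) cS.
have dE : #|X| %/ q = (#|X :\: S| %/ q).+1 by rewrite cD -{1}(subnK qX) divnDr ?divnn ?q0 ?addn1.
have DY : [disjoint X :\: S & Y] by apply: disjointWl XY; apply: subsetDl.
have SY : [disjoint S & Y] by apply: disjointWl XY.
rewrite dE mulSn; apply: leq_trans (_ : #|edges_between S Y| + #|edges_between (X :\: S) Y| <= _).
  apply: leq_add; first by apply: leq_trans (edges_between_nbhd SY); exact: H.
  apply: IH => //; first by rewrite -ltnS -dE.
  by move=> S' S'X; apply: H; apply: subset_trans S'X (subsetDl _ _).
rewrite !card_edges_between // [X in _ <= X](big_setID S) /= (setIidPr SX) //.
Qed.

End EdgesBetween.

Section MakerExpands.
Variables (G : sgraph) (b l q delta D : nat).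
Hypotheses (b_gt0 : 0 < b) (G_lt : #|G| < 2 ^ l) (l_gt1 : 1 < l) (q_gt0 : 0 < q) (D_gt0 : 0 < D).
Hypothesis small : forall X : {set G}, 0 < #|X| -> #|X| < q -> delta * #|X| <= #|ext_neighbors X|.
Hypothesis big : forall X Y : {set G}, [disjoint X & Y] -> #|X| = q -> #|Y| = q ->
  exists x y, [/\ x \in X, y \in Y & adj x y].
Hypothesis dq : 2 * delta * q <= 3 * #|G|.
Hypothesis Ddelta : 600 * b * l * D <= delta.

Let l_gt0 : 0 < l := ltnW l_gt1.
(** A set of [m] vertices consists of [40 * b * l] pieces of size [q], which yields the order of
    [b * l * m] edges that the union bound asks for. *)
Let m := 40 * b * l * q.
Notation N := (@neighbors G).

Lemma q_leq_m : 40 * q <= m.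
Proof. by rewrite leq_mul2r -mulnA leq_pmulr ?orbT // muln_gt0 b_gt0. Qed.

Lemma mD_leq : 10 * (m * D) <= #|G|.
Proof.
have : 2 * (600 * b * l * D) * q <= 3 * #|G|.
  by apply: leq_trans dq; rewrite leq_mul2r leq_mul2l Ddelta !orbT.
have -> : 2 * (600 * b * l * D) * q = 30 * (m * D).
  rewrite /m; clear; nia.
clear; lia.
Qed.

Lemma big_nbhd (S Z : {set G}) : [disjoint S & Z] -> #|S| = q -> #|Z| - q <= #|nbhd N S :&: Z|.
Proof.
move=> SZ cS; rewrite leqNgt; apply/negP => H.
have ZN : q <= #|Z :\: nbhd N S|.
  by move: H; rewrite cardsD setIC; clear; lia.
have [Y YZ cY] := subset_of_card ZN.
have SY : [disjoint S & Y].
  by apply: disjointWr SZ; apply: subset_trans YZ (subsetDl _ _).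
have [x [y [xS yY xy]]] := big SY cS cY.
move/subsetP/(_ y yY): YZ; rewrite inE => /andP[/negP + _]; apply.
by apply/nbhdP; exists x; rewrite // inE.
Qed.

Lemma joined_edges (X Y : {set G}) : [disjoint X & Y] -> #|X| = m -> #|Y| = m ->
  2 * b * (l * (#|X| + #|Y| + 3)) <= #|edges_between X Y|.
Proof.
move=> XY cX cY.
have H := @edges_between_chunks G q (m - q) X Y XY q_gt0 _.
have mq : m %/ q = 40 * b * l by rewrite /m mulnK.
rewrite cX mq in H; apply: leq_trans (H _) => [|S SX cS]; last first.
  by rewrite -cY; apply: big_nbhd => //; apply: disjointWl XY.
rewrite cX cY mulnA; move: q_leq_m q_gt0; move: m => m'.
have -> : 40 * b * l = b * l * 40 by rewrite -mulnA mulnC.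
have -> : 2 * b * l = b * l * 2 by rewrite -mulnA mulnC.
rewrite -!mulnA !leq_mul2l; clear; move=> *; apply/orP; right; apply/orP; right; lia.
Qed.

(** Below [q] vertices, the expansion of [G] gives enough neighbours outside [Y]. From [q] on, each
    piece of [q] vertices sees all but at most [q] vertices of [Z], which contains more than half of
    the graph as [10 * (m * D) <= #|G|]. *)
Lemma expansion_edges (X Y : {set G}) : 0 < #|X| -> #|X| <= m -> #|Y| < D * #|X| ->
  2 * b * (l * (#|X| + #|Y| + 3)) <= #|edges_between X (~: (X :|: Y))|.
Proof.
move=> X0 Xm YD; set Z := ~: (X :|: Y).
have XZ : [disjoint X & Z].
  by rewrite -setI_eq0; apply/eqP/setP => x; rewrite !inE; case: (x \in X).
have goalE : 2 * b * (l * (#|X| + #|Y| + 3)) <= 12 * (b * l * D) * #|X|.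
  have -> : 2 * b * (l * (#|X| + #|Y| + 3)) = b * l * (2 * (#|X| + #|Y| + 3)) by clear; nia.
  have -> : 12 * (b * l * D) * #|X| = b * l * (12 * (D * #|X|)) by clear; nia.
  rewrite leq_mul2l; apply/orP; right.
  have : #|X| <= D * #|X| by rewrite leq_pmull.
  move: YD X0; move: (D * _) => z; clear; lia.
apply: leq_trans goalE _.
have [Xq|qX] := ltnP #|X| q.
  apply: leq_trans (edges_between_nbhd XZ).
  have sub : ext_neighbors X :\: Y \subset nbhd N X :&: Z.
    by apply/subsetP => x; rewrite !inE negb_or => /and3P[-> -> ->].
  apply: leq_trans (subset_leq_card sub).
  have H : #|ext_neighbors X| - #|Y| <= #|ext_neighbors X :\: Y|.
    by rewrite cardsD leq_sub2l // subset_leq_card // subsetIr.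
  apply: leq_trans H; rewrite leq_subRL; last first.
    apply: leq_trans (small X0 Xq); apply: leq_trans (ltnW YD) _; rewrite leq_mul2r; apply/orP; right.
    apply: leq_trans Ddelta; rewrite leq_pmull // !muln_gt0 b_gt0 l_gt0 //.
  apply: leq_trans (small X0 Xq); apply: leq_trans (_ : D * #|X| + 12 * (b * l * D) * #|X| <= _).
    by rewrite leq_add2r ltnW.
  rewrite -mulnDl leq_mul2r; apply/orP; right; apply: leq_trans Ddelta.
  have : D <= b * l * D by rewrite leq_pmull // muln_gt0 b_gt0.
  rewrite -!mulnA (mulnA b l D); move: (b * l * D) => z; clear; lia.
have Zn : #|G| <= 2 * (#|Z| - q).
  have HZ : #|G| - (#|X| + #|Y|) <= #|Z|.
    by rewrite /Z [#|~: _|]cardsCs setCK leq_sub2l // (leq_card_setU X Y).1.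
  have := mD_leq; have := q_leq_m.
  have mX : D * #|X| <= m * D by rewrite mulnC leq_mul2r Xm orbT.
  have mm : m <= m * D by rewrite leq_pmulr.
  move: HZ YD Xm mX mm; move: (D * _) (m * D) m => z1 z2 z3; clear; lia.
apply: leq_trans (_ : #|X| %/ q * (#|Z| - q) <= _); last first.
  apply: edges_between_chunks => // S SX cS; apply: big_nbhd => //; exact: disjointWl XZ.
set t := #|X| %/ q.
have Xt : #|X| <= 2 * t * q.
  have t0 : 0 < t by rewrite divn_gt0.
  have := divn_eq #|X| q; have := ltn_pmod #|X| q_gt0; rewrite -/t => *.
  have : q <= t * q by rewrite leq_pmull.
  rewrite -mulnA; lia.
have dG : 100 * (b * l * D) * q <= #|Z| - q.
  have := dq; have : 600 * (b * l * D) * q <= delta * q.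
    by rewrite leq_mul2r !mulnA Ddelta orbT.
  rewrite -!mulnA; move: (b * _) (delta * q) Zn => u w; move: (#|Z| - q) #|G|; clear; lia.
apply: leq_trans (_ : 12 * (b * l * D) * (2 * t * q) <= _); first by rewrite leq_mul2l Xt orbT.
apply: leq_trans (_ : t * (100 * (b * l * D) * q) <= _); last by rewrite leq_mul2l dG orbT.
move: (b * l * D) => u; have -> : 12 * u * (2 * t * q) = t * (24 * u * q) by clear; nia.
rewrite leq_mul2l; apply/orP; right; rewrite leq_mul2r leq_mul2r; apply/orP; right; by rewrite orbT.
Qed.

Lemma maker_expands : exists2 sM : strategy {set G}, legal_strategy (edges G) 1 sM &
  forall sB, legal_strategy (edges G) b sB -> exists k,
  let F := edges G :&: maker_claimed (play sM sB k) in
  [/\ unclaimed (edges G) (play sM sB k) = set0,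
      forall X Y : {set G}, [disjoint X & Y] -> m <= #|X| -> m <= #|Y| ->
        exists x y, [/\ x \in X, y \in Y & [set x; y] \in F]
    & forall X : {set G}, #|X| <= m -> D * #|X| <= #|nbhd (fun x => [set y | edge_rel F x y]) X|].
Proof.
pose I := (bool * ({set G} * {set G}))%type.
pose A (i : I) := edges_between i.2.1 (if i.1 then i.2.2 else ~: (i.2.1 :|: i.2.2)).
pose P (i : I) := if i.1 then [&& [disjoint i.2.1 & i.2.2], #|i.2.1| == m & #|i.2.2| == m]
  else [&& 0 < #|i.2.1|, #|i.2.1| <= m & #|i.2.2| < D * #|i.2.1|].
have AE i : A i \subset edges G by apply: edges_between_sub.
exists (hitter (edges G) b P A); first exact: legal_hitter.
move=> sB lB; have [|k [U0 hits]] := hitter_hits (P := P) (A := A) b_gt0 _ lB.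
  apply: union_bound G_lt _ _ _; rewrite ?card_bool ?expn_gt0 //.
    by apply: leq_trans (leq_pexp2l _ l_gt1).
  move=> [[] [X Y]]; rewrite /P /A /= => H; apply: weight_small => //.
  - exact: subsetIr.
  - rewrite (setIidPl (edges_between_sub _ _)); case/and3P: H => ? /eqP ? /eqP ?; exact: joined_edges.
  - exact: subsetIr.
  - rewrite (setIidPl (edges_between_sub _ _)); case/and3P: H => ? ? ?; exact: expansion_edges.
exists k => F; split=> // [X Y XY mX mY|X Xm].
  have [[X' X'X cX] [Y' Y'Y cY]] := (subset_of_card mX, subset_of_card mY).
  have XY' : [disjoint X' & Y'] by apply: disjointW XY.
  have := hits (true, (X', Y')); rewrite /P /A /= XY' cX cY !eqxx => /(_ isT).
  case/pred0Pn => E /= /andP[EA EM]; have EG := subsetP (edges_between_sub _ _) _ EA.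
  case/imset2P: EA EM EG => x y xX; rewrite inE => /andP[yY _] -> EM EG.
  by exists x, y; rewrite inE EG EM (subsetP X'X) ?(subsetP Y'Y).
(* If [X] fails to expand, its neighbourhood [Y] in Maker's graph is small enough for the second
   family, and the edge that hits this member leads from [X] to a neighbour outside [Y]. *)
rewrite leqNgt; apply/negP; set Y := nbhd _ X => YD.
have X0 : 0 < #|X| by move: YD; case: #|X| => //; rewrite muln0.
have := hits (false, (X, Y)); rewrite /P /A /= X0 Xm YD => /(_ isT).
case/pred0Pn => E /= /andP[EA EM]; have EG := subsetP (edges_between_sub _ _) _ EA.
case/imset2P: EA EM EG => x y xX; rewrite !inE negb_or => /andP[/andP[yX /negP yY] xy] -> EM EG.
apply: yY; apply/nbhdP; exists x => //; rewrite inE /edge_rel inE EG EM !andbT.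
by apply/eqP => exy; rewrite -exy xX in yX.
Qed.
(** Take [d = D %/ k] and let [c] be half of it; the first condition makes the other half suffice
    for [Delta] and [k], the second one provides the bundles, and the third one gives [m <= c ^ h].
    All use [10 * (m * D) <= #|G|], where [10] is the sum of [8] from [8 * (k * d)] and [2] from
    lower terms. *)
Lemma maker_win_of_parameters Delta h : 0 < h -> 0 < Delta ->
  let k := 80 * l * h ^ 2 in
  k * (4 * Delta + 2 * k + 4 * h + 60) <= D -> 6 * k * h * Delta ^ h.*2 <= D ->
  #|G| <= 10 * D * (D %/ (2 * k)) ^ h ->
  universality_game_maker_win 1 b #|G| Delta G.
Proof.
move=> h0 Delta0 k R1 R2 R3.
have [sM lM wins] := maker_expands.
exists sM => // sB lB; have [j [U0 joined expanding]] := wins sB lB.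
exists j; split=> //; set F := _ :&: _ in joined expanding.
exists F; last exact: subsetIr.
rewrite inE subsetIl; apply/asboolP.
have l0 : 0 < l := ltnW l_gt1.
have : 0 < m by rewrite !muln_gt0 b_gt0 l0 q_gt0.
move: (m) joined expanding mD_leq => M joined expanding mD m0.
have k80 : 80 <= k by rewrite /k -mulnA leq_pmulr // muln_gt0 l0 expn_gt0 h0.
have k0 : 0 < k by apply: leq_trans k80.
have dk := leq_trunc_div D k; set d := D %/ k in dk.
have kE : 2 * (4 * h + 4 + l * (8 * h ^ 2 + 16 * h + 6)) <= k.
  rewrite /k -mulnA; move: (h ^ 2) (leq_pexp2l h0 (isT : 1 <= 2)) (h0) (l0) => h2; rewrite expn1.
  clear; nia.
clearbody k.
have cd : D %/ (2 * k) = d %/ 2 by rewrite mulnC divnMA.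
have d_big : 4 * Delta + 2 * k + 4 * h + 60 <= d by rewrite leq_divRL // mulnC.
apply: (tree_universal_of_expanding m0 joined expanding h0 Delta0 (l := l) (k := k) (d := d) (c := D %/ (2 * k))) => //.
- by rewrite cd; move: d_big k80; clear; lia.
- rewrite -(@leq_pmul2l (10 * D)) ?muln_gt0 ?D_gt0 //.
  by apply: leq_trans R3; apply: leq_trans mD; rewrite -mulnA (mulnC M).
- by apply: leq_trans dk; rewrite -muln2 leq_mul2l (leq_trans _ k80) ?orbT.
- by rewrite cd; move: d_big k80; clear; lia.
- apply: leq_trans mD; have -> : 56 * k * h * M * Delta ^ h.*2 = 56 * (k * h * Delta ^ h.*2) * M.
    by rewrite -!mulnA (mulnC M).
  rewrite (mulnC M) (mulnA 10) leq_mul2r; apply/orP; right; move: R2; rewrite -!mulnA; clear; lia.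
- apply: leq_trans mD; rewrite (mulnC M) !mulnA leq_mul2r; apply/orP; right.
  have : k * (4 * h + 6) <= D.
    by apply: leq_trans R1; rewrite leq_mul2l; apply/orP; right; clear; lia.
  move: dk; rewrite mulnC; have -> : 4 * k * (h.*2 + d.*2 + 3) = 8 * (k * d) + 2 * (k * (4 * h + 6)) by clear; nia.
  clear; lia.
Qed.

Lemma maker_win_moderate_degree Delta : 16 <= Delta -> l <= 4 * Delta ->
  (100 * (l * Delta)) ^ 2 <= #|G| -> (50 * Delta) ^ 2 * #|G| <= D ^ 2 ->
  universality_game_maker_win 1 b #|G| Delta G.
Proof.
move=> D16 lD lDG DD; have l0 : 0 < l := ltnW l_gt1.
have D_big : 50 * 100 * (l * Delta * Delta) <= D.
  rewrite -(leq_exp2r _ _ (isT : 0 < 2)); apply: leq_trans DD.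
  have -> : 50 * 100 * (l * Delta * Delta) = 50 * Delta * (100 * (l * Delta)).
    by rewrite [RHS]mulnACA (mulnC Delta).
  by rewrite expnMn leq_mul2l lDG orbT.
apply: (@maker_win_of_parameters Delta 1) => //; first exact: leq_trans D16.
- rewrite exp1n !muln1; apply: leq_trans D_big.
  apply: leq_trans (_ : 80 * l * (648 * Delta) <= _).
    rewrite leq_mul2l; apply/orP; right; move: D16 lD; clear; lia.
  have : l * Delta * 16 <= l * Delta * Delta by rewrite leq_mul2l D16 orbT.
  rewrite mulnACA.
  move: (l * Delta * Delta) (l * Delta) => x y; clear; lia.
- rewrite exp1n !muln1; apply: leq_trans D_big; clear; nia.
rewrite exp1n !muln1 expn1.
have P0 : 0 < 2 * (80 * l) by rewrite !muln_gt0 l0.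
have D_l : 2 * (80 * l) <= D.
  apply: leq_trans D_big; have : l * 1 <= l * (Delta * Delta).
    by rewrite leq_mul2l muln_gt0 (leq_trans _ D16) ?orbT.
  by rewrite muln1 -mulnA; clear; lia.
have H : D <= 2 * (80 * l) * (2 * (D %/ (2 * (80 * l)))).
  have := ltn_ceil D P0; have : 0 < D %/ (2 * (80 * l)) by rewrite divn_gt0.
  move: (_ %/ _) => t t0; rewrite mulnCA; have : 2 * (80 * l) <= t * (2 * (80 * l)) by rewrite leq_pmull.
  rewrite mulSn (mulnC t); clear; lia.
(* By [H], [D <= 320 * l * c] with [c = D %/ (2 * (80 * l))], hence
   [D ^ 2 <= 32 * l * (10 * D * c)]. *)
rewrite -(@leq_pmul2l (32 * l)) ?muln_gt0 ?l0 //.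
apply: leq_trans (_ : D ^ 2 <= _); last first.
  rewrite expnS expn1; apply: leq_trans (_ : D * (2 * (80 * l) * (2 * (D %/ (2 * (80 * l))))) <= _).
    by rewrite leq_mul2l H orbT.
  by move: (_ %/ _) => t; clear; nia.
apply: leq_trans DD; rewrite leq_mul2r; apply/orP; right.
have : 1 * 1 <= Delta * Delta by rewrite leq_mul // (leq_trans _ D16).
rewrite expnS expn1 mulnACA; move: lD; have : Delta <= Delta * Delta by rewrite leq_pmulr // (leq_trans _ D16).
move: (Delta * Delta) => w; clear; lia.
Qed.

(** All conditions become comparisons of powers of [Delta], since [k <= 5 * Delta ^ 4]. The
    strictest one compares the exponents [2 * h + 7] and [5 * (h - 1)] and needs [4 <= h]. As
    [c >= Delta ^ h] and [Delta >= 2 ^ 4], the power [c ^ h] is at least [2 ^ (4 * h ^ 2)], hence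
    exceeds [#|G|]. *)
Lemma maker_win_small_degree Delta h : 16 <= Delta -> 4 <= h -> l <= 4 * Delta ->
  l <= 4 * h ^ 2 -> h ^ 2 <= 4 * Delta -> Delta ^ (5 * h.-1) <= D ->
  universality_game_maker_win 1 b #|G| Delta G.
Proof.
move=> D16 h4 lD lh hD DD; have l0 : 0 < l := ltnW l_gt1.
have Dp : 0 < Delta by apply: leq_trans D16.
have h0 : 0 < h by apply: leq_trans h4.
set k := 80 * l * h ^ 2.
have D4 : 16 * 16 * Delta * Delta <= Delta ^ 4.
  by rewrite !expnS expn0 muln1 -!mulnA; apply: leq_mul => //; rewrite leq_mul2r D16 orbT.
have kD : k <= 5 * Delta ^ 4.
  apply: leq_trans (_ : 80 * (4 * Delta) * (4 * Delta) <= _); first by rewrite leq_mul // leq_mul2l lD orbT.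
  move: D4; clear; nia.
have hlD : h <= Delta.
  have : 4 * h <= h ^ 2 by rewrite expnS expn1 leq_mul2r h4 orbT.
  by move: hD; clear; lia.
have DE i j : i <= j -> Delta ^ i <= Delta ^ j by move=> ij; rewrite leq_pexp2l.
have D1 : 16 * 16 * Delta <= Delta ^ 4.
  by apply: leq_trans D4; rewrite leq_pmulr.
have k0 : 0 < k by rewrite /k !muln_gt0 l0 h0.
have D2 : 256 <= Delta ^ 2 by rewrite expnS expn1; rewrite (leq_mul D16 D16).
apply: (@maker_win_of_parameters Delta h) => //; rewrite -/k; clearbody k.
- apply: leq_trans DD; apply: leq_trans (DE 10 _ _); last by move: h4; clear; lia.
  apply: leq_trans (_ : 5 * Delta ^ 4 * (11 * Delta ^ 4) <= _).
    apply: leq_mul => //; move: kD hlD D1 D16; move: (Delta ^ 4) => w; clear; lia.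
  have -> : Delta ^ 10 = Delta ^ 4 * Delta ^ 4 * Delta ^ 2 by rewrite -!expnD.
  by rewrite mulnACA mulnC leq_mul2l (leq_trans _ D2) ?orbT.
- apply: leq_trans DD; apply: leq_trans (DE (4 + 1 + h.*2 + 2) _ _); last by move: h4; clear; lia.
  rewrite !expnD expn1; move: D2 kD; move: (Delta ^ 4) (Delta ^ 2) (Delta ^ h.*2) => w4 w2 w D2 kD.
  have -> : w4 * Delta * w * w2 = w2 * w4 * Delta * w by rewrite mulnC !mulnA.
  rewrite leq_mul2r; apply/orP; right; apply: leq_mul => //.
  apply: leq_trans (_ : 6 * (5 * w4) <= _); first by rewrite leq_mul2l kD orbT.
  by rewrite (mulnA 6) leq_mul2r (leq_trans _ D2) ?orbT.
apply: leq_trans (_ : (D %/ (2 * k)) ^ h <= _); last by rewrite leq_pmull // muln_gt0 D_gt0.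
have cD : Delta ^ h <= D %/ (2 * k).
  rewrite leq_divRL ?muln_gt0 ?k0 //; apply: leq_trans DD.
  apply: leq_trans (DE (h + 4 + 2) _ _); last by move: h4; clear; lia.
  rewrite !expnD -mulnA leq_mul2l; apply/orP; right.
  apply: leq_trans (_ : 2 * (5 * Delta ^ 4) <= _); first by rewrite leq_mul2l kD orbT.
  move: D2; move: (Delta ^ 4) (Delta ^ 2) => w4 w2 D2.
  by rewrite (mulnA 2) mulnC leq_mul2l (leq_trans _ D2) ?orbT.
apply: leq_trans (_ : (Delta ^ h) ^ h <= _); last by rewrite leq_exp2r.
rewrite -expnM; apply: leq_trans (ltnW G_lt) _; apply: leq_trans (_ : 2 ^ (4 * h ^ 2) <= _).
  by rewrite leq_exp2l.
by rewrite expnM mulnn leq_exp2r ?expn_gt0 ?h0.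
Qed.

End MakerExpands.

(** * Choice of the constants *)

Import Order.TTheory GRing.Theory Num.Theory.
Local Open Scope ring_scope.

(** Treated apart because the logarithm of [1] vanishes, and with it the lower bound on [d]. *)
Lemma maker_win_single_vertex a b Delta (G : sgraph) : #|G| = 1%N ->
  universality_game_maker_win a b 1 Delta G.
Proof.
move=> G1; have sub1 (T : sgraph) : #|T| = 1%N -> forall x y : T, x = y.
  by move=> /eqP/fintype1P[z Hz] x y; rewrite (Hz x) (Hz y).
have E0 : edges G = set0.
  apply/setP => E; rewrite inE; apply/negP => /imset2P[x y _]; rewrite inE => + _.
  by rewrite (sub1 G G1 x y) adj_irrefl.
exists (fun=> set0) => [h|sB _].
  by rewrite sub0set /unclaimed E0 set0D !cards0 minn0.
exists 0%N; split; first by rewrite /unclaimed E0 set0D.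
exists set0; rewrite ?sub0set // inE sub0set; apply/asboolP => T T1 _ _.
have /card_gt0P[z _] : (0 < #|G|)%N by rewrite G1.
exists (fun=> z) => [x y _|x y]; first exact: sub1 T1 x y.
by rewrite (sub1 T T1 x y) adj_irrefl.
Qed.

Section Reals.
Variable R : realType.

Lemma ln2_ge : 2^-1 <= ln (2 : R).
Proof.
have : ln (1 + - 2^-1) <= - 2^-1 :> R by apply: le_ln1Dx; lra.
have -> : 1 + - 2^-1 = 2^-1 :> R by rewrite {1}[1]splitr div1r addrK.
by rewrite lnV ?posrE // lerN2.
Qed.

Lemma trunc_log_le_ln n : (0 < n)%N -> (trunc_log 2 n)%:R <= 2 * ln (n%:R : R).
Proof.
move=> n0; have := trunc_logP (isT : (1 < 2)%N) n0; rewrite -(@ler_nat R) natrX.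
rewrite -ler_ln ?posrE ?exprn_gt0 ?ltr0n // lnXn // -[leLHS]mulr_natr => H.
have t0 : 0 <= (trunc_log 2 n)%:R :> R by rewrite ler0n.
have : 2^-1 * (trunc_log 2 n)%:R <= ln 2 * (trunc_log 2 n)%:R :> R by rewrite ler_wpM2r // ln2_ge.
lra.
Qed.

(* [q] is the rounded up threshold n / (2 d) of the definition of expanders. *)
Lemma expander_threshold (G : sgraph) (d : R) : 0 < d -> d <= #|G|%:R -> expander #|G| d G ->
  exists q, [/\ (0 < q)%N, (2 * Num.truncn d * q <= 3 * #|G|)%N,
    forall X : {set G}, (0 < #|X|)%N -> (#|X| < q)%N -> (Num.truncn d * #|X| <= #|ext_neighbors X|)%N
  & forall X Y : {set G}, [disjoint X & Y] -> #|X| = q -> #|Y| = q ->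
      exists x y, [/\ x \in X, y \in Y & adj x y]].
Proof.
move=> d0 dG [_ small big]; set r := #|G|%:R / (2 * d) in small big.
have ex : exists q, r <= q%:R by exists (Num.truncn r).+1; apply/ltW/real_truncnS_gt/num_real.
have d20 : 0 < 2 * d by rewrite mulr_gt0.
have r0 : 0 < r by rewrite divr_gt0 // (lt_le_trans d0).
case: (ex_minnP ex) => q rq qmin.
have lt_q k : (k < q)%N -> k%:R < r by move=> kq; rewrite ltNge; apply/negP => /qmin; rewrite leqNgt kq.
have q0 : (0 < q)%N by rewrite -(@ltr_nat R); apply: lt_le_trans rq.
have td : (Num.truncn d)%:R <= d by rewrite truncn_le ltW.
exists q; split=> // [|X X0 Xq|X Y XY cX cY].
(* By minimality of [q], [2 * d * q < #|G| + 2 * d], and this is at most [3 * #|G|] since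
   [d <= #|G|]. *)
- have : q.-1%:R < r by apply: lt_q; rewrite prednK.
  rewrite /r ltr_pdivlMr // => H.
  rewrite -(@ler_nat R) !natrM; have -> : q%:R = q.-1%:R + 1 :> R by rewrite natr1 prednK.
  have Q0 : 0 <= q.-1%:R :> R by rewrite ler0n.
  have T0 : 0 <= (Num.truncn d)%:R :> R by rewrite ler0n.
  nra.
- have := small X X0 (lt_q _ Xq) => H; rewrite -(@ler_nat R) natrM; apply: le_trans H.
  by rewrite ler_wpM2r ?ler0n.
have := big X Y XY; rewrite cX cY => /(_ erefl rq) /card_gt0P[E /imset2P[x y xX + _]].
by rewrite inE => /andP[yY xy]; exists x, y.
Qed.

(** The first bound on [C] forces [d], hence [n], up to [expR 16], so that [L >= 16]. In the second
    one, [2400] comes from [600 * b * l] with [l <= 4 * L], and [52] leaves [50 * A <= D] after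
    rounding down. *)
Lemma maker_win_large_degree n Delta b (C d : R) (G : sgraph) :
  2 * expR 16 <= C -> 2400 * 52 <= C ->
  (1 < n)%N -> (0 < Delta)%N -> (0 < b)%N -> ln (n%:R : R) <= Delta%:R ->
  0 < d -> d <= n%:R -> expander n d G ->
  Num.min (Delta%:R * n%:R `^ (1 / 2)) (Delta%:R `^ (5 * Num.sqrt (ln n%:R)))
    * (C * b%:R * ln n%:R) <= d ->
  universality_game_maker_win 1 b n Delta G.
Proof.
move=> Ce Cl n1 Delta0 b0 nDelta d0 dn expG; have [Gn _ _] := expG; subst n.
set n := #|G| in n1 nDelta dn expG *; set A := Num.min _ _ => Ad.
set L := ln _ in nDelta A Ad.
have n0 : (0 < n)%N by apply: ltnW.
have L2 : 2^-1 <= L.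
  apply: le_trans ln2_ge _; rewrite /L ler_ln ?posrE ?ltr0n // ler_nat //.
have D1 : 1 <= Delta%:R :> R by rewrite ler1n.
have n1R : 1 <= n%:R :> R by rewrite ler1n.
have A1 : 1 <= A.
  rewrite le_min; apply/andP; split.
    apply: mulr_ege1 => //; rewrite -[leLHS](powRr0 n%:R) ler_powR //; lra.
  by rewrite -[leLHS](powRr0 Delta%:R) ler_powR // mulr_ge0 // sqrtr_ge0.
have b1 : 1 <= b%:R :> R by rewrite ler1n.
have bL : 2^-1 <= b%:R * L by nra.
have Ae : expR 16 <= d.
  apply: le_trans Ad; have e0 := expR_ge0 (16 : R).
  have : expR 16 <= C * b%:R * L.
    rewrite -mulrA; apply: le_trans (_ : C * 2^-1 <= _); first by lra.
    by rewrite ler_wpM2l //; lra.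
  nra.
have L16 : 16 <= L.
  by rewrite -(expRK 16) /L ler_ln ?posrE ?expR_gt0 ?ltr0n // (le_trans Ae).
have D16 : (16 <= Delta)%N by rewrite -(@ler_nat R); apply: le_trans nDelta.
set l := (trunc_log 2 n).+1.
have n_lt : (n < 2 ^ l)%N by apply: trunc_log_ltn.
have l1 : (1 < l)%N by rewrite ltnS trunc_log_gt0.
have lL : l%:R <= 4 * L by rewrite /l -[leLHS]natr1; have := trunc_log_le_ln n0; rewrite -/L; move: L16; clear; lra.
have [q [q0 dq small big]] := expander_threshold d0 dn expG.
set delta := Num.truncn d in dq small.
set D := (delta %/ (600 * b * l))%N.
have P0 : (0 < 600 * b * l)%N by rewrite !muln_gt0 b0.
have Dd : (600 * b * l * D <= delta)%N by rewrite mulnC leq_trunc_div.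
have bp : 0 < b%:R :> R by rewrite ltr0n.
have l0 : 0 < l%:R :> R by rewrite ltr0n.
have DA : 50 * A <= D%:R.
  set p := (600 * b * l)%N in P0.
  have H1 : d <= (D%:R + 1) * p%:R.
    rewrite natr1 -natrM; apply: le_trans (_ : delta.+1%:R <= _).
      exact/ltW/real_truncnS_gt/num_real.
    by rewrite ler_nat ltn_ceil.
  have pC : 52 * p%:R <= C * b%:R * L.
    have -> : p%:R = 600 * (b%:R * l%:R) :> R by rewrite /p !natrM mulrA.
    have H2 : b%:R * l%:R <= 4 * (b%:R * L) by rewrite mulrCA ler_wpM2l // ltW.
    have H3 : 2400 * 52 * (b%:R * L) <= C * (b%:R * L) by rewrite ler_wpM2r //; lra.
    by rewrite -mulrA; lra.
  have pR : 0 < p%:R :> R by rewrite ltr0n.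
  have : A * (52 * p%:R) <= (D%:R + 1) * p%:R.
    by apply: le_trans H1; apply: le_trans Ad; rewrite ler_wpM2l //; lra.
  rewrite mulrA ler_pM2r //; lra.
have {}Cl : 400 <= C by lra.
have D0 : (0 < D)%N by rewrite -(@ltr_nat R); lra.
have lDelta : (l <= 4 * Delta)%N by rewrite -(@ler_nat R) natrM; lra.
have [Amin|Amin] : A = Delta%:R * n%:R `^ (1 / 2) \/ A = Delta%:R `^ (5 * Num.sqrt L).
  by rewrite /A minEle; case: ifP; [left|right].
- have sn : n%:R `^ (1 / 2) = Num.sqrt n%:R :> R by rewrite mul1r powR12_sqrt ?ler0n.
  rewrite sn in Amin; set s := Num.sqrt _ in Amin.
  have s2 : s ^+ 2 = n%:R by rewrite sqr_sqrtr ?ler0n.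
  have s0 : 0 < s by rewrite sqrtr_gt0 ltr0n.
  apply: (maker_win_moderate_degree b0 n_lt l1 q0 D0 small big dq Dd D16 lDelta).
  (* Divide [Delta * s * (C * b * L) <= d <= n = s ^ 2] by [s]. *)
  + have H : 100 * (l%:R * Delta%:R) <= s.
      rewrite -(ler_pM2r s0) -expr2 s2; apply: le_trans dn; apply: le_trans Ad; rewrite Amin.
      have -> : 100 * (l%:R * Delta%:R) * s = Delta%:R * s * (100 * l%:R) by ring.
      rewrite ler_wpM2l ?mulr_ge0 ?ler0n ?(ltW s0) //.
      have H1 : L <= b%:R * L by nra.
      have H2 : 400 * (b%:R * L) <= C * (b%:R * L) by rewrite ler_wpM2r // ltW // mulr_gt0 //; lra.
      by rewrite -mulrA; lra.
    rewrite -(@ler_nat R) natrX !natrM -s2 ler_sqr ?nnegrE //; last exact: ltW.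
    by rewrite !mulr_ge0 ?ler0n.
  + rewrite -(@ler_nat R) natrM !natrX natrM -s2 -exprMn ler_sqr ?nnegrE ?ler0n ?mulr_ge0 ?ler0n ?(ltW s0) //.
    by apply: le_trans DA; rewrite Amin mulrA.
set s := Num.sqrt L in Amin.
have s2 : s ^+ 2 = L by rewrite sqr_sqrtr //; lra.
have s0 : 0 <= s by apply: sqrtr_ge0.
have s4 : 4 <= s by nra.
have /andP[ts st] := truncn_itv s0.
(* With this [h], [h.-1] is the integer part of [s], so that [Delta ^ (5 * h.-1) <= A], while
   [s < h] gives [l <= 4 * h ^ 2]. *)
set h := (Num.truncn s).+1 in st.
have hE : h%:R = (Num.truncn s)%:R + 1 :> R by rewrite -natr1.
apply: (@maker_win_small_degree G b l q delta D b0 n_lt l1 q0 D0 small big dq Dd Delta h D16) => //.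
- by rewrite -(@ler_nat R); lra.
- rewrite -(@ler_nat R) natrM natrX; apply: le_trans lL _; rewrite -s2; nra.
- rewrite -(@ler_nat R) natrM natrX; nra.
rewrite -(@ler_nat R) natrX -powR_mulrn ?ler0n //.
apply: le_trans (_ : A <= _); last by lra.
rewrite Amin ler_powR // natrM /h /=; lra.
Qed.

End Reals.

Theorem corollary1p18 (R : realType) :
  exists2 C : R, 0 < C &
    forall n Delta b : nat, (0 < n)%N -> (0 < Delta)%N -> (0 < b)%N ->
      ln (n%:R : R) <= Delta%:R ->
      forall (d : R) (G : sgraph), 0 < d -> d <= n%:R -> expander n d G ->
        Num.min (Delta%:R * n%:R `^ (1 / 2))
                (Delta%:R `^ (5 * Num.sqrt (ln n%:R)))
          * (C * b%:R * ln n%:R) <= d ->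
        universality_game_maker_win 1 b n Delta G.
Proof.
have e0 := expR_gt0 (16 : R); exists (2400 * 52 + 2 * expR 16).
  by rewrite addr_gt0 ?mulr_gt0.
move=> n Delta b n0 Delta0 b0 nDelta d G d0 dn expG Ad.
have [n1|n1] := ltnP 1 n; first by apply: maker_win_large_degree Ad => //; rewrite ?lerDl ?lerDr ?mulr_ge0 // ltW.
have n_eq : n = 1%N by apply/eqP; rewrite eqn_leq n1.
by subst n; apply: maker_win_single_vertex; case: expG.
Qed.
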